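(* For $A>0$ let $L(A)$ be the error of the best uniform approximation of $\operatorname{sgn}(x)$ by entire functions of exponential type one on the set $(-\infty,-A]\cup[A,+\infty)$. Then the following limit exists and has the indicated value: $$\lim_{A\to\infty}\sqrt{A}\,\exp(A)\,L(A)=\sqrt{2/\pi}.$$
   Context: $\operatorname{sgn}(x)=1$ for $x>0$, $\operatorname{sgn}(x)=-1$ for $x<0$. ''Entire function of exponential type one'' means exponential type at most one, i.e. $\limsup_{|z|\to\infty}|z|^{-1}\log|f(z)|\le 1$. Thus $$L(A)=\inf_{f}\ \sup_{x\in\mathbf{R},\,|x|\ge A}|f(x)-\operatorname{sgn}(x)|,$$ where the infimum is over all such entire functions $f$. *)

(* Defs.v *)
From Stdlib Require Import Reals Lra.
From Coquelicot Require Import Coquelicot.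
Open Scope R_scope.

Definition entire (f : C -> C) : Prop :=
  forall z : C, ex_derive (K := C_AbsRing) (V := C_NormedModule) f z.

(* Stdlib's [ln] is 0 on nonpositive reals, whereas log 0 = -oo is needed where
   the function vanishes. *)
Definition log_ext (x : R) : Rbar :=
  if Rlt_dec 0 x then Finite (ln x) else m_infty.

(* limsup of u(z) as |z| -> +oo, i.e. the infimum over r > 0 of the suprema of
   u over { |z| >= r }. *)
Definition limsup_Cinfty (u : C -> Rbar) : Rbar :=
  Rbar_glb (fun s => exists r : R, 0 < r /\
    s = Rbar_lub (fun y => exists z : C, r <= Cmod z /\ y = u z)).

Definition exp_type_at_most_one (f : C -> C) : Prop :=
  Rbar_le
    (limsup_Cinfty
       (fun z => Rbar_mult (Finite (/ Cmod z)) (log_ext (Cmod (f z)))))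
    (Finite 1).

(* May be p_infty, when f is unbounded on the set; [sign] is Coquelicot's,
   equal to 1 on (0,+oo) and -1 on (-oo,0). *)
Definition sgn_error (A : R) (f : C -> C) : Rbar :=
  Rbar_lub (fun e => exists x : R, A <= Rabs x /\
    e = Finite (Cmod (Cminus (f (RtoC x)) (RtoC (sign x))))).

Definition best_sgn_error (A : R) : Rbar :=
  Rbar_glb (fun e => exists f : C -> C,
    entire f /\ exp_type_at_most_one f /\ e = sgn_error A f).

(* The conversion to R loses nothing: see [best_sgn_error_finite]. *)
Definition L (A : R) : R := real (best_sgn_error A).

Lemma sgn_error_ge0 (A : R) (f : C -> C) : Rbar_le (Finite 0) (sgn_error A f).
Proof.
  unfold sgn_error, Rbar_lub.
  destruct (Rbar_ex_lub _) as [l [Hub Hl]]; simpl proj1_sig.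
  eapply Rbar_le_trans.
  2: { apply Hub. exists (Rabs A). split; [|reflexivity].
       rewrite Rabs_Rabsolu. apply Rle_abs. }
  apply Cmod_ge_0.
Qed.

Lemma best_sgn_error_finite (A : R) : is_finite (best_sgn_error A).
Proof.
  assert (H0 : Rbar_le (Finite 0) (best_sgn_error A)).
  { unfold best_sgn_error, Rbar_glb.
    destruct (Rbar_ex_glb _) as [l [Hlb Hl]]; simpl proj1_sig.
    apply Hl. intros e [f [_ [_ ->]]]. apply sgn_error_ge0. }
  assert (H1 : Rbar_le (best_sgn_error A) (Finite 1)).
  { apply Rbar_le_trans with (sgn_error A (fun _ => RtoC 0)).
    - unfold best_sgn_error, Rbar_glb.
      destruct (Rbar_ex_glb _) as [l [Hlb Hl]]; simpl proj1_sig.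
      apply Hlb. exists (fun _ => RtoC 0). split; [|split; [|reflexivity]].
      + intro z. apply (ex_derive_const (K := C_AbsRing) (V := C_NormedModule)).
      + unfold exp_type_at_most_one, limsup_Cinfty, Rbar_glb.
        destruct (Rbar_ex_glb _) as [m [Hm Hm2]]; simpl proj1_sig.
        eapply Rbar_le_trans.
        * apply Hm. exists 1. split; [lra | reflexivity].
        * unfold Rbar_lub. destruct (Rbar_ex_lub _) as [k [Hk2 Hk]];
            simpl proj1_sig.
          apply Hk. intros y [z [Hz ->]].
          rewrite Cmod_0. unfold log_ext. destruct (Rlt_dec 0 0); [lra|].
          rewrite Rbar_mult_comm.
          assert (Hp : 0 < / Cmod z) by (apply Rinv_0_lt_compat; lra).
          rewrite (is_Rbar_mult_unique m_infty (Finite (/ Cmod z)) m_infty).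
          -- exact I.
          -- apply is_Rbar_mult_m_infty_pos. exact Hp.
    - unfold sgn_error, Rbar_lub.
      destruct (Rbar_ex_lub _) as [l [Hub Hl]]; simpl proj1_sig.
      apply Hl. intros e [x [_ ->]]. simpl.
      unfold Cminus. rewrite Cplus_0_l, Cmod_opp, Cmod_R.
      unfold sign. destruct (total_order_T 0 x) as [[?|?]|?];
        unfold Rabs; destruct (Rcase_abs _); lra. }
  destruct (best_sgn_error A); simpl in *; [reflexivity | easy | easy].
Qed.

(* Main.v *)
Require Import Defs.
From Stdlib Require Import Reals Lra Lia.
From Coquelicot Require Import Coquelicot.
Open Scope R_scope.

(** Both bounds on [L A] come from one explicit entire function of type one,
    [G(z) = cos q + A sin q / q] with [q^2 = z^2 - A^2] ([kern]; it is even in [q], hence entire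
    in [z]), and from the companion [E = A cos q - q sin q] ([dev]). On the real axis
    [|E(x)| <= |x|] for [|x| >= A], and [(E / x)' = - G (1 + A / x^2)]: the zeros of [G] are the
    points where [E / x] oscillates between [1] and [-1]. One expects the best approximation to
    be [sgn x - L E(x) / x], up to lower order terms.

    Upper bound. The primitive [P] of [G] that vanishes at 0 is odd and of type one. Integrating
    the relation between [G] and [E / x] by parts gives, for [x >= A],
    [P(x) = c - E(x) / x + O(1/A)] with a constant [c >= P(A)]; hence [P / c] approximates the
    sign with error at most [(1 + 1/A) / P(A)]. In the gap [G(x) >= exp (sqrt (A^2 - x^2))], so
    Laplace's method gives [P(A) >= (1 + o(1)) sqrt (A pi / 2) exp A] ([L_upper],
    [L_upper_gauss]).

    Lower bound. By duality one looks for a measure on [|x| >= A] that annihilates functions of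
    type one and whose masses alternate in sign at the extremal points. It is given by the
    residues of [1 / D] with [D = (z^2 - A^2) G] ([den]). Let [f] be odd, of type one, and within
    [M] of 1 on [[A, +oo)]. Integrate [(1 - f) / D] over the boundary of a large rectangle in the
    right half plane. Three sides contribute little, since [f] is at most [B exp |Im z|] while
    [D] grows like [|z|^2 exp |Im z|]. The imaginary axis contributes the integral of [1 / D],
    as [f] is odd. The residues are at most [M] times the total mass, which is at most
    [1 / (2 A) + 1 / (2 A (A + 1))] ([quot_rect_bound]). Comparing
    ([deviation_lower_bound]) and applying Laplace's method once more gives the same constant
    ([L_lower_gauss]).

    The growth estimate for [f] is a Phragmen-Lindelof argument, which loses an arbitrarily small
    part of the type; the loss is recovered by replacing [A] by a slightly larger [A'].

    The complex analysis is derived from differentiability at each point: Goursat's theorem for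
    rectangles by bisection, the residue of a simple pole by shrinking a square, and the maximum
    principle by applying the residue formula to powers of the function. The zeros of [D] are
    controlled by the increasing function [q + atan (q / A)] ([phase]), because
    [A sin q + q cos q = sqrt (A^2 + q^2) sin (phase A q)]. *)

(** * Continuity and differentiability in the complex plane *)

Definition cont_at (f : C -> C) (z : C) : Prop :=
  forall eps, 0 < eps -> exists delta, 0 < delta /\
    forall w, Cmod (w - z)%C < delta -> Cmod (f w - f z)%C < eps.

(** Caratheodory's form of the derivative: the rules of calculus reduce to continuity of the
    slope function [phi]. *)
Definition diff_at (f : C -> C) (z l : C) : Prop :=
  exists phi : C -> C, cont_at phi z /\ phi z = l /\
    forall w, f w = (f z + phi w * (w - z))%C.

Definition holo (f : C -> C) (z : C) : Prop := exists l, diff_at f z l.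

Lemma Cmod_sub_sym (z w : C) : Cmod (z - w)%C = Cmod (w - z)%C.
Proof. rewrite <- Cmod_opp. f_equal. ring. Qed.

Lemma Cmod_sub_ge (z w : C) : Cmod z - Cmod w <= Cmod (z - w)%C.
Proof.
  generalize (Cmod_triangle (z - w)%C w).
  replace (z - w + w)%C with z by ring. lra.
Qed.

Lemma Cmod_add_ge (z w : C) : Cmod z - Cmod w <= Cmod (z + w)%C.
Proof.
  replace (z + w)%C with (z - (- w))%C by ring.
  rewrite <- (Cmod_opp w). apply Cmod_sub_ge.
Qed.

Lemma Cmod_sub_le (z w : C) : Cmod (z - w)%C <= Cmod z + Cmod w.
Proof.
  unfold Cminus. eapply Rle_trans; [apply Cmod_triangle|]. rewrite Cmod_opp. lra.
Qed.

Lemma Csub_neq0 (z w : C) : z <> w -> (z - w)%C <> 0.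
Proof. intros H E. apply H, Ceq_minus, E. Qed.

Lemma Cmod_sqr (z : C) : Cmod z * Cmod z = fst z * fst z + snd z * snd z.
Proof.
  generalize (Cmod2_alt z). unfold Re, Im. intro H. simpl in H. lra.
Qed.

Lemma fst_le_Cmod (z : C) : Rabs (fst z) <= Cmod z.
Proof. eapply Rle_trans; [apply Rmax_l | apply Rmax_Cmod]. Qed.

Lemma snd_le_Cmod (z : C) : Rabs (snd z) <= Cmod z.
Proof. eapply Rle_trans; [apply Rmax_r | apply Rmax_Cmod]. Qed.

Lemma Cmod_le_abs (z : C) : Cmod z <= Rabs (fst z) + Rabs (snd z).
Proof.
  apply Rsqr_incr_0_var; unfold Rsqr.
  - rewrite Cmod_sqr.
    assert (H1 := Rabs_pos (fst z)). assert (H2 := Rabs_pos (snd z)).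
    assert (H3 : Rabs (fst z) * Rabs (fst z) = fst z * fst z)
      by (rewrite <- Rabs_mult; apply Rabs_pos_eq; nra).
    assert (H4 : Rabs (snd z) * Rabs (snd z) = snd z * snd z)
      by (rewrite <- Rabs_mult; apply Rabs_pos_eq; nra).
    nra.
  - generalize (Rabs_pos (fst z)) (Rabs_pos (snd z)). lra.
Qed.

Lemma cont_at_const (c z : C) : cont_at (fun _ => c) z.
Proof.
  intros eps He. exists 1. split; [lra|]. intros w _.
  replace (c - c)%C with (RtoC 0) by ring. now rewrite Cmod_0.
Qed.

Lemma cont_at_id (z : C) : cont_at (fun w => w) z.
Proof. intros eps He. exists eps. split; [lra|]. now intros w Hw. Qed.

Lemma cont_at_plus (f g : C -> C) (z : C) :
  cont_at f z -> cont_at g z -> cont_at (fun w => f w + g w)%C z.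
Proof.
  intros Hf Hg eps He.
  destruct (Hf (eps / 2)) as [d1 [Hd1 H1]]; [lra|].
  destruct (Hg (eps / 2)) as [d2 [Hd2 H2]]; [lra|].
  exists (Rmin d1 d2). split; [now apply Rmin_pos|]. intros w Hw.
  specialize (H1 w (Rlt_le_trans _ _ _ Hw (Rmin_l _ _))).
  specialize (H2 w (Rlt_le_trans _ _ _ Hw (Rmin_r _ _))).
  replace (f w + g w - (f z + g z))%C with ((f w - f z) + (g w - g z))%C by ring.
  eapply Rle_lt_trans; [apply Cmod_triangle|]. lra.
Qed.

Lemma cont_at_mult (f g : C -> C) (z : C) :
  cont_at f z -> cont_at g z -> cont_at (fun w => f w * g w)%C z.
Proof.
  intros Hf Hg eps He.
  set (K := Cmod (f z) + Cmod (g z) + 1).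
  assert (P1 := Cmod_ge_0 (f z)). assert (P2 := Cmod_ge_0 (g z)).
  assert (HK : 1 <= K) by (unfold K; lra).
  set (e := Rmin 1 (eps / (2 * K))).
  assert (He' : 0 < e).
  { apply Rmin_pos; [lra|]. apply Rdiv_lt_0_compat; lra. }
  assert (He1 : e <= 1) by apply Rmin_l.
  assert (He2 : 2 * K * e <= eps).
  { assert (e <= eps / (2 * K)) by apply Rmin_r.
    apply Rmult_le_compat_l with (r := 2 * K) in H; [|lra].
    replace (2 * K * (eps / (2 * K))) with eps in H by (field; lra). exact H. }
  destruct (Hf e) as [d1 [Hd1 H1]]; [lra|].
  destruct (Hg e) as [d2 [Hd2 H2]]; [lra|].
  exists (Rmin d1 d2). split; [now apply Rmin_pos|]. intros w Hw.
  specialize (H1 w (Rlt_le_trans _ _ _ Hw (Rmin_l _ _))).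
  specialize (H2 w (Rlt_le_trans _ _ _ Hw (Rmin_r _ _))).
  replace (f w * g w - f z * g z)%C
    with ((f w - f z) * (g w - g z) + (f z * (g w - g z) + g z * (f w - f z)))%C by ring.
  eapply Rle_lt_trans; [apply Cmod_triangle|].
  eapply Rle_lt_trans;
    [apply Rplus_le_compat_l; apply Cmod_triangle|].
  rewrite !Cmod_mult.
  assert (Q1 := Cmod_ge_0 (f w - f z)%C). assert (Q2 := Cmod_ge_0 (g w - g z)%C).
  unfold K in *. nra.
Qed.

Lemma cont_at_scal (c : C) (f : C -> C) (z : C) :
  cont_at f z -> cont_at (fun w => c * f w)%C z.
Proof. intro H. apply (cont_at_mult (fun _ => c)); [apply cont_at_const | exact H]. Qed.

Lemma cont_at_ext (f g : C -> C) (z : C) :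
  (forall w, f w = g w) -> cont_at f z -> cont_at g z.
Proof.
  intros E H eps He. destruct (H eps He) as [d [Hd Hw]].
  exists d. split; [exact Hd|]. intros w. rewrite <- !E. apply Hw.
Qed.

Lemma cont_at_opp (f : C -> C) (z : C) : cont_at f z -> cont_at (fun w => - f w)%C z.
Proof.
  intro H. apply (cont_at_ext (fun w => (- (1)) * f w)%C); [intro; ring|].
  now apply cont_at_scal.
Qed.

Lemma cont_at_minus (f g : C -> C) (z : C) :
  cont_at f z -> cont_at g z -> cont_at (fun w => f w - g w)%C z.
Proof. intros Hf Hg. apply cont_at_plus; [exact Hf | now apply cont_at_opp]. Qed.

Lemma cont_at_comp (f g : C -> C) (z : C) :
  cont_at f z -> cont_at g (f z) -> cont_at (fun w => g (f w)) z.
Proof.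
  intros Hf Hg eps He. destruct (Hg eps He) as [d [Hd H]].
  destruct (Hf d Hd) as [d' [Hd' H']]. exists d'. split; [exact Hd'|].
  intros w Hw. apply H, H', Hw.
Qed.

Lemma cont_at_inv (z : C) : z <> 0 -> cont_at Cinv z.
Proof.
  intros Hz eps He. apply Cmod_gt_0 in Hz as Hm.
  set (m := Cmod z) in *.
  exists (Rmin (m / 2) (eps * m * m / 2)).
  assert (0 < eps * m * m) by (apply Rmult_lt_0_compat; [apply Rmult_lt_0_compat|]; lra).
  split; [apply Rmin_pos; lra|]. intros w Hw.
  assert (Hw1 := Rlt_le_trans _ _ _ Hw (Rmin_l _ _)).
  assert (Hw2 := Rlt_le_trans _ _ _ Hw (Rmin_r _ _)).
  assert (Hwm : m / 2 < Cmod w).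
  { generalize (Cmod_sub_ge z w). rewrite Cmod_sub_sym. fold m. lra. }
  assert (Hw0 : w <> 0).
  { apply Cmod_gt_0. lra. }
  replace (/ w - / z)%C with (- ((w - z) * / (w * z)))%C by (field; now split).
  rewrite Cmod_opp, Cmod_mult, Cmod_inv, Cmod_mult by now apply Cmult_neq_0.
  fold m.
  apply Rmult_lt_reg_r with (Cmod w * m); [nra|].
  rewrite Rmult_assoc, Rinv_l by nra. nra.
Qed.

Lemma cont_at_div (f g : C -> C) (z : C) :
  cont_at f z -> cont_at g z -> g z <> 0 -> cont_at (fun w => f w / g w)%C z.
Proof.
  intros Hf Hg H0. apply cont_at_mult; [exact Hf|].
  apply (cont_at_comp g Cinv); [exact Hg | now apply cont_at_inv].
Qed.

Lemma cont_at_local (f g : C -> C) (z : C) (r : R) : 0 < r ->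
  (forall w, Cmod (w - z)%C < r -> f w = g w) -> cont_at f z -> cont_at g z.
Proof.
  intros Hr E H eps He. destruct (H eps He) as [d [Hd Hw]].
  exists (Rmin d r). split; [now apply Rmin_pos|]. intros w Hwd.
  assert (H1 := Rlt_le_trans _ _ _ Hwd (Rmin_l _ _)).
  assert (H2 := Rlt_le_trans _ _ _ Hwd (Rmin_r _ _)).
  rewrite <- (E w H2), <- (E z); [now apply Hw|].
  replace (z - z)%C with (RtoC 0) by ring. now rewrite Cmod_0.
Qed.

Lemma diff_at_cont (f : C -> C) (z l : C) : diff_at f z l -> cont_at f z.
Proof.
  intros [phi [Hc [_ E]]].
  apply (cont_at_ext (fun w => f z + phi w * (w - z))%C); [intro w; now rewrite (E w)|].
  apply cont_at_plus; [apply cont_at_const|]. apply cont_at_mult; [exact Hc|].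
  apply cont_at_minus; [apply cont_at_id | apply cont_at_const].
Qed.

Lemma holo_cont (f : C -> C) (z : C) : holo f z -> cont_at f z.
Proof. intros [l H]. now apply diff_at_cont in H. Qed.

Lemma diff_at_ext (f g : C -> C) (z l : C) :
  (forall w, f w = g w) -> diff_at f z l -> diff_at g z l.
Proof.
  intros E [phi [Hc [Hl H]]]. exists phi. repeat split; trivial.
  intro w. rewrite <- !E. apply H.
Qed.

Lemma diff_at_const (c z : C) : diff_at (fun _ => c) z 0.
Proof.
  exists (fun _ => RtoC 0). split; [apply cont_at_const|]. split; [reflexivity|].
  intro w. ring.
Qed.

Lemma diff_at_id (z : C) : diff_at (fun w => w) z 1.
Proof.
  exists (fun _ => RtoC 1). split; [apply cont_at_const|]. split; [reflexivity|].
  intro w. ring.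
Qed.

Lemma diff_at_plus (f g : C -> C) (z l m : C) :
  diff_at f z l -> diff_at g z m -> diff_at (fun w => f w + g w)%C z (l + m)%C.
Proof.
  intros [p [Hp [Ep H]]] [q [Hq [Eq H']]].
  exists (fun w => p w + q w)%C. split; [now apply cont_at_plus|].
  split; [now rewrite Ep, Eq|]. intro w. rewrite (H w), (H' w). ring.
Qed.

Lemma diff_at_mult (f g : C -> C) (z l m : C) :
  diff_at f z l -> diff_at g z m ->
  diff_at (fun w => f w * g w)%C z (l * g z + f z * m)%C.
Proof.
  intros Hf Hg. assert (Cg := diff_at_cont _ _ _ Hg).
  destruct Hf as [p [Hp [Ep H]]], Hg as [q [Hq [Eq H']]].
  exists (fun w => p w * g w + f z * q w)%C. split.
  - apply cont_at_plus; [now apply cont_at_mult | now apply cont_at_scal].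
  - split; [now rewrite Ep, Eq|]. intro w. rewrite (H w), (H' w). ring.
Qed.

Lemma diff_at_scal (c : C) (f : C -> C) (z l : C) :
  diff_at f z l -> diff_at (fun w => c * f w)%C z (c * l)%C.
Proof.
  intro H. generalize (diff_at_mult (fun _ => c) f z _ _ (diff_at_const c z) H).
  replace (0 * f z + c * l)%C with (c * l)%C by ring. easy.
Qed.

Lemma diff_at_opp (f : C -> C) (z l : C) :
  diff_at f z l -> diff_at (fun w => - f w)%C z (- l)%C.
Proof.
  intro H. replace (- l)%C with (- (1) * l)%C by ring.
  apply (diff_at_ext (fun w => (- (1)) * f w)%C); [intro; ring|].
  now apply diff_at_scal.
Qed.

Lemma diff_at_minus (f g : C -> C) (z l m : C) :
  diff_at f z l -> diff_at g z m -> diff_at (fun w => f w - g w)%C z (l - m)%C.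
Proof. intros Hf Hg. apply diff_at_plus; [exact Hf | now apply diff_at_opp]. Qed.

Lemma diff_at_comp (f g : C -> C) (z l m : C) :
  diff_at f z l -> diff_at g (f z) m -> diff_at (fun w => g (f w)) z (m * l)%C.
Proof.
  intros Hf Hg. assert (Cf := diff_at_cont _ _ _ Hf).
  destruct Hf as [p [Hp [Ep H]]], Hg as [q [Hq [Eq H']]].
  exists (fun w => q (f w) * p w)%C. split.
  - apply cont_at_mult; [now apply (cont_at_comp f q) | exact Hp].
  - split; [now rewrite Ep, Eq|]. intro w. rewrite (H' (f w)).
      replace (f w - f z)%C with (p w * (w - z))%C by (rewrite (H w); ring). ring.
Qed.

Lemma diff_at_inv (z : C) : z <> 0 -> holo Cinv z.
Proof.
  intro Hz. exists (- (/ z * / z))%C.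
  (* Away from 0 the quotient is -1/(wz); at w = 0 the inverse is the junk value 0. *)
  exists (fun w => if Ceq_dec w 0 then / z * / z else - (/ z * / w))%C. split.
  - apply Cmod_gt_0 in Hz as Hm.
    apply (cont_at_local (fun w => - (/ z * / w))%C _ z (Cmod z)); [exact Hm| |].
    + intros w Hw. destruct (Ceq_dec w 0) as [->|]; [|reflexivity].
      exfalso. rewrite Cmod_sub_sym in Hw. replace (z - 0)%C with z in Hw by ring. lra.
    + apply cont_at_opp, cont_at_scal, cont_at_inv, Hz.
  - split.
    + destruct (Ceq_dec z 0); [easy | reflexivity].
    + intro w. destruct (Ceq_dec w 0) as [->|Hw].
      * replace (/ 0)%C with (RtoC 0).
        -- field. exact Hz.
        -- unfold Cinv. simpl. apply injective_projections; simpl; unfold Rdiv; ring.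
      * field. now split.
Qed.

Lemma diff_at_of_little_o (f : C -> C) (z l : C) :
  (forall eps, 0 < eps -> exists delta, 0 < delta /\ forall w, Cmod (w - z)%C < delta ->
     Cmod (f w - f z - l * (w - z))%C <= eps * Cmod (w - z)%C) ->
  diff_at f z l.
Proof.
  intro H.
  exists (fun w => if Ceq_dec w z then l else (f w - f z) / (w - z))%C. split; [|split].
  - intros eps He. destruct (H (eps / 2)) as (dl & Hdl & Hw); [lra|].
    exists dl. split; [exact Hdl|]. intros w Hwd. specialize (Hw w Hwd).
    destruct (Ceq_dec z z) as [_|n]; [|easy].
    destruct (Ceq_dec w z) as [->|Hn].
    { replace (l - l)%C with (RtoC 0) by ring. now rewrite Cmod_0. }
    apply Csub_neq0 in Hn. apply Cmod_gt_0 in Hn as Hp.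
    replace ((f w - f z) / (w - z) - l)%C
      with ((f w - f z - l * (w - z)) * / (w - z))%C by (field; exact Hn).
    rewrite Cmod_mult, Cmod_inv by exact Hn.
    apply Rmult_lt_reg_r with (Cmod (w - z)%C); [exact Hp|].
    rewrite Rmult_assoc, Rinv_l, Rmult_1_r by lra. nra.
  - destruct (Ceq_dec z z); easy.
  - intro w. destruct (Ceq_dec w z) as [->|Hn]; [ring|]. field. now apply Csub_neq0.
Qed.

Lemma diff_at_little_o (f : C -> C) (z l : C) : diff_at f z l ->
  forall eps, 0 < eps -> exists delta, 0 < delta /\ forall w, Cmod (w - z)%C < delta ->
     Cmod (f w - f z - l * (w - z))%C <= eps * Cmod (w - z)%C.
Proof.
  intros [phi [Hc [<- E]]] eps He. destruct (Hc eps He) as (d & Hd & Hw).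
  exists d. split; [exact Hd|]. intros w Hwd. specialize (Hw w Hwd). rewrite (E w).
  replace (f z + phi w * (w - z) - f z - phi z * (w - z))%C
    with ((phi w - phi z) * (w - z))%C by ring.
  rewrite Cmod_mult. apply Rmult_le_compat_r; [apply Cmod_ge_0 | lra].
Qed.

Lemma holo_plus (f g : C -> C) (z : C) :
  holo f z -> holo g z -> holo (fun w => f w + g w)%C z.
Proof. intros [l Hl] [m Hm]. exists (l + m)%C. now apply diff_at_plus. Qed.

Lemma holo_minus (f g : C -> C) (z : C) :
  holo f z -> holo g z -> holo (fun w => f w - g w)%C z.
Proof. intros [l Hl] [m Hm]. exists (l - m)%C. now apply diff_at_minus. Qed.

Lemma holo_mult (f g : C -> C) (z : C) :
  holo f z -> holo g z -> holo (fun w => f w * g w)%C z.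
Proof. intros [l Hl] [m Hm]. eexists. apply diff_at_mult; eassumption. Qed.

Lemma holo_const (c z : C) : holo (fun _ => c) z.
Proof. eexists. apply diff_at_const. Qed.

Lemma holo_id (z : C) : holo (fun w => w) z.
Proof. eexists. apply diff_at_id. Qed.

Lemma holo_scal (c : C) (f : C -> C) (z : C) : holo f z -> holo (fun w => c * f w)%C z.
Proof. intros [l Hl]. exists (c * l)%C. now apply diff_at_scal. Qed.

Lemma holo_comp (f g : C -> C) (z : C) :
  holo f z -> holo g (f z) -> holo (fun w => g (f w)) z.
Proof. intros [l Hl] [m Hm]. eexists. eapply diff_at_comp; eassumption. Qed.

Lemma holo_div (f g : C -> C) (z : C) :
  holo f z -> holo g z -> g z <> 0 -> holo (fun w => f w / g w)%C z.
Proof.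
  intros Hf Hg H0. apply holo_mult; [exact Hf|].
  apply (holo_comp g Cinv); [exact Hg | now apply diff_at_inv].
Qed.

Lemma holo_pow (f : C -> C) (n : nat) (z : C) : holo f z -> holo (fun w => f w ^ n)%C z.
Proof.
  intro Hf. induction n as [|n IH]; simpl; [apply holo_const | now apply holo_mult].
Qed.

Lemma holo_ext (f g : C -> C) (z : C) : (forall w, f w = g w) -> holo f z -> holo g z.
Proof. intros E [l H]. exists l. now apply (diff_at_ext f). Qed.

(** The filter-based derivative unfolds to the same [o(|w - z|)] estimate in [Cmod]. *)
Lemma ex_derive_holo (f : C -> C) (z : C) :
  ex_derive (K := C_AbsRing) (V := C_NormedModule) f z <-> holo f z.
Proof.
  split.
  - intros [l [_ H]]. specialize (H z (fun P HP => HP)). exists l.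
    apply diff_at_of_little_o. intros eps He.
    destruct (H (mkposreal _ He)) as [d Hd]. exists d. split; [apply cond_pos|].
    intros w Hw. rewrite (Cmult_comm l). exact (Hd w Hw).
  - intros [l H]. exists l. split; [apply is_linear_scal_l|].
    intros x Hx. rewrite <- (is_filter_lim_locally_unique _ _ Hx). clear x Hx.
    intros [eps He]. destruct (diff_at_little_o f z l H eps He) as (d & Hd & Hw).
    exists (mkposreal d Hd). intros w Hb.
    change (Cmod ((f w - f z) - (w - z) * l)%C <= eps * Cmod (w - z)%C).
    rewrite (Cmult_comm (w - z)). exact (Hw w Hb).
Qed.

(** * Integrals over segments and rectangles *)

Definition rcont (g : R -> C) (t : R) : Prop :=
  continuous (fun s => fst (g s)) t /\ continuous (fun s => snd (g s)) t.

Definition CInt (g : R -> C) (a b : R) : C :=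
  (RInt (fun t => fst (g t)) a b, RInt (fun t => snd (g t)) a b).

Lemma ex_RInt_cont (h : R -> R) (a b : R) :
  (forall t, Rmin a b <= t <= Rmax a b -> continuous h t) -> ex_RInt h a b.
Proof. apply (ex_RInt_continuous (V := R_CompleteNormedModule)). Qed.

Lemma ex_derive_cont (h : R -> R) (t : R) : ex_derive h t -> continuous h t.
Proof. apply (ex_derive_continuous (V := R_NormedModule)). Qed.

Lemma ex_derive_continuity_pt (h : R -> R) (t : R) : ex_derive h t -> continuity_pt h t.
Proof. intro H. now apply continuity_pt_filterlim, ex_derive_cont. Qed.

Lemma mean_value (h h' : R -> R) (a b : R) :
  (forall t, Rmin a b <= t <= Rmax a b -> is_derive h t (h' t)) ->
  exists c, Rmin a b <= c <= Rmax a b /\ h b - h a = h' c * (b - a).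
Proof.
  intro H. destruct (MVT_gen h a b h') as [c Hc].
  - intros t Ht. apply H. lra.
  - intros t Ht. apply ex_derive_continuity_pt. eexists. now apply H.
  - now exists c.
Qed.

Lemma continuous_eps (h : R -> R) (t : R) :
  (forall eps, 0 < eps -> exists d, 0 < d /\ forall s, Rabs (s - t) < d -> Rabs (h s - h t) < eps) ->
  continuous h t.
Proof.
  intro H. apply (proj2 (filterlim_locally _ _)). intros [e He].
  destruct (H e He) as [d [Hd Hs]]. exists (mkposreal d Hd). intros s Hb. apply Hs, Hb.
Qed.

Lemma rcont_path (f : C -> C) (p : R -> C) (K t : R) :
  (forall s, Cmod (p s - p t)%C <= K * Rabs (s - t)) ->
  cont_at f (p t) -> rcont (fun s => f (p s)) t.
Proof.
  intros Hp Hf.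
  assert (H : forall eps, 0 < eps -> exists d, 0 < d /\
    forall s, Rabs (s - t) < d -> Cmod (f (p s) - f (p t))%C < eps).
  { intros eps He. destruct (Hf eps He) as [d [Hd Hw]].
    exists (d / (Rabs K + 1)). assert (HK := Rabs_pos K).
    split; [apply Rdiv_lt_0_compat; lra|]. intros s Hs. apply Hw.
    eapply Rle_lt_trans; [apply Hp|].
    apply Rle_lt_trans with ((Rabs K + 1) * Rabs (s - t)).
    - apply Rmult_le_compat_r; [apply Rabs_pos|]. generalize (Rle_abs K). lra.
    - apply Rmult_lt_compat_l with (r := Rabs K + 1) in Hs; [|lra].
      replace ((Rabs K + 1) * (d / (Rabs K + 1))) with d in Hs by (field; lra). exact Hs. }
  split; apply continuous_eps; intros eps He; destruct (H eps He) as [d [Hd Hw]];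
    exists d; (split; [exact Hd|]); intros s Hs; specialize (Hw s Hs);
    eapply Rle_lt_trans; try exact Hw.
  - apply (fst_le_Cmod (f (p s) - f (p t))%C).
  - apply (snd_le_Cmod (f (p s) - f (p t))%C).
Qed.

Lemma rcont_horizontal (f : C -> C) (c t : R) : cont_at f (t, c) -> rcont (fun s => f (s, c)) t.
Proof.
  intro H. apply (rcont_path f (fun s => (s, c)) 1); [|exact H].
  intro s. eapply Rle_trans; [apply Cmod_le_abs|]. simpl.
  replace (c + - c) with 0 by ring. rewrite Rabs_R0. unfold Rminus. lra.
Qed.

Lemma rcont_vertical (f : C -> C) (c t : R) : cont_at f (c, t) -> rcont (fun s => f (c, s)) t.
Proof.
  intro H. apply (rcont_path f (fun s => (c, s)) 1); [|exact H].
  intro s. eapply Rle_trans; [apply Cmod_le_abs|]. simpl.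
  replace (c + - c) with 0 by ring. rewrite Rabs_R0. unfold Rminus. lra.
Qed.

Definition rcont_on (g : R -> C) (a b : R) : Prop :=
  forall t, Rmin a b <= t <= Rmax a b -> rcont g t.

Lemma rcont_on_ex (g : R -> C) (a b : R) : rcont_on g a b ->
  ex_RInt (fun t => fst (g t)) a b /\ ex_RInt (fun t => snd (g t)) a b.
Proof.
  intro H. split; apply ex_RInt_cont; intros t Ht; now apply H.
Qed.

Lemma CInt_ext (g h : R -> C) (a b : R) :
  (forall t, Rmin a b < t < Rmax a b -> g t = h t) -> CInt g a b = CInt h a b.
Proof.
  intro H. unfold CInt. f_equal; apply RInt_ext; intros t Ht; now rewrite H.
Qed.

Lemma CInt_plus (g h : R -> C) (a b : R) : rcont_on g a b -> rcont_on h a b ->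
  CInt (fun t => g t + h t)%C a b = (CInt g a b + CInt h a b)%C.
Proof.
  intros Hg Hh. apply rcont_on_ex in Hg as [G1 G2]. apply rcont_on_ex in Hh as [H1 H2].
  unfold CInt. apply injective_projections; simpl.
  - now apply (RInt_plus (V := R_CompleteNormedModule)).
  - now apply (RInt_plus (V := R_CompleteNormedModule)).
Qed.

Lemma CInt_scal (c : C) (g : R -> C) (a b : R) : rcont_on g a b ->
  CInt (fun t => c * g t)%C a b = (c * CInt g a b)%C.
Proof.
  intro Hg. apply rcont_on_ex in Hg as [G1 G2].
  apply (RInt_correct (V := R_CompleteNormedModule)) in G1, G2.
  unfold CInt. apply injective_projections; simpl.
  - apply is_RInt_unique.
    exact (is_RInt_minus (V := R_NormedModule) _ _ _ _ _ _
      (is_RInt_scal (V := R_NormedModule) _ _ _ (fst c) _ G1)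
      (is_RInt_scal (V := R_NormedModule) _ _ _ (snd c) _ G2)).
  - apply is_RInt_unique.
    exact (is_RInt_plus (V := R_NormedModule) _ _ _ _ _ _
      (is_RInt_scal (V := R_NormedModule) _ _ _ (fst c) _ G2)
      (is_RInt_scal (V := R_NormedModule) _ _ _ (snd c) _ G1)).
Qed.

Lemma CInt_Chasles (g : R -> C) (a b c : R) : rcont_on g a b -> rcont_on g b c ->
  (CInt g a b + CInt g b c)%C = CInt g a c.
Proof.
  intros Hg Hh. apply rcont_on_ex in Hg as [G1 G2]. apply rcont_on_ex in Hh as [H1 H2].
  unfold CInt. apply injective_projections; simpl.
  - now apply (RInt_Chasles (V := R_CompleteNormedModule)).
  - now apply (RInt_Chasles (V := R_CompleteNormedModule)).
Qed.

Lemma CInt_const (c : C) (a b : R) : CInt (fun _ => c) a b = ((b - a) * c)%C.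
Proof.
  unfold CInt. rewrite !RInt_const. apply injective_projections; simpl;
  unfold scal; simpl; unfold mult; simpl; ring.
Qed.

(** Rotating the integral onto the positive axis reduces this to real integrals. *)
Lemma CInt_bound (g : R -> C) (a b M : R) : a <= b -> rcont_on g a b ->
  (forall t, a <= t <= b -> Cmod (g t) <= M) -> Cmod (CInt g a b) <= M * (b - a).
Proof.
  intros Hab Hg HM. set (I := CInt g a b).
  assert (HI := Cmod_ge_0 I).
  destruct (Req_dec (Cmod I) 0) as [H0|H0].
  { rewrite H0. apply Rmult_le_pos; [|lra].
    eapply Rle_trans; [apply Cmod_ge_0 | apply (HM a); lra]. }
  apply Rmult_le_reg_l with (Cmod I); [lra|].
  rewrite Cmod_sqr.
  assert (E : RInt (fun t => fst (Cconj I * g t)%C) a b = fst I * fst I + snd I * snd I).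
  { change (fst (CInt (fun t => Cconj I * g t)%C a b) = fst I * fst I + snd I * snd I).
    rewrite CInt_scal by exact Hg. fold I. generalize I. intro J. simpl. ring. }
  rewrite <- E.
  replace (Cmod I * (M * (b - a))) with (RInt (fun _ => Cmod I * M) a b).
  2: { rewrite RInt_const. unfold scal; simpl. unfold mult; simpl. ring. }
  apply rcont_on_ex in Hg as [G1 G2].
  apply RInt_le; [exact Hab| | |].
  - apply (ex_RInt_minus (V := R_NormedModule)); apply (ex_RInt_scal (V := R_NormedModule)); assumption.
  - apply ex_RInt_const.
  - intros t Ht. eapply Rle_trans; [apply Rle_abs|].
    eapply Rle_trans; [apply (fst_le_Cmod (Cconj I * g t)%C)|].
    rewrite Cmod_mult, Cmod_conj. apply Rmult_le_compat_l; [exact HI|]. apply HM. lra.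
Qed.

(** Counterclockwise when [a <= b] and [c <= d]. *)
Definition rect (f : C -> C) (a b c d : R) : C :=
  (CInt (fun x => f (x, c)) a b - CInt (fun x => f (x, d)) a b
   + Ci * (CInt (fun y => f (b, y)) c d - CInt (fun y => f (a, y)) c d))%C.

Definition on_rect (P : C -> Prop) (a b c d : R) : Prop :=
  forall x y, a <= x <= b -> c <= y <= d -> P (x, y).

Definition on_boundary (P : C -> Prop) (a b c d : R) : Prop :=
  (forall x, a <= x <= b -> P (x, c) /\ P (x, d)) /\
  (forall y, c <= y <= d -> P (a, y) /\ P (b, y)).

Lemma on_rect_boundary (P : C -> Prop) (a b c d : R) : a <= b -> c <= d ->
  on_rect P a b c d -> on_boundary P a b c d.
Proof. intros Hab Hcd H. split; intros; split; apply H; lra. Qed.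

Lemma boundary_rcont (f : C -> C) (a b c d : R) : a <= b -> c <= d ->
  on_boundary (cont_at f) a b c d ->
  rcont_on (fun x => f (x, c)) a b /\ rcont_on (fun x => f (x, d)) a b /\
  rcont_on (fun y => f (a, y)) c d /\ rcont_on (fun y => f (b, y)) c d.
Proof.
  intros Hab Hcd [H1 H2].
  split; [|split; [|split]]; intros t Ht; rewrite Rmin_left, Rmax_right in Ht by assumption;
    (apply rcont_horizontal || apply rcont_vertical); (now apply H1) || (now apply H2).
Qed.

Lemma rect_plus (f g : C -> C) (a b c d : R) : a <= b -> c <= d ->
  on_boundary (cont_at f) a b c d -> on_boundary (cont_at g) a b c d ->
  rect (fun z => f z + g z)%C a b c d = (rect f a b c d + rect g a b c d)%C.
Proof.
  intros Hab Hcd Hf Hg. apply boundary_rcont in Hf as (F1 & F2 & F3 & F4); trivial.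
  apply boundary_rcont in Hg as (G1 & G2 & G3 & G4); trivial.
  unfold rect. rewrite !CInt_plus by assumption. ring.
Qed.

Lemma rect_scal (k : C) (f : C -> C) (a b c d : R) : a <= b -> c <= d ->
  on_boundary (cont_at f) a b c d ->
  rect (fun z => k * f z)%C a b c d = (k * rect f a b c d)%C.
Proof.
  intros Hab Hcd Hf. apply boundary_rcont in Hf as (F1 & F2 & F3 & F4); trivial.
  unfold rect. rewrite !CInt_scal by assumption. ring.
Qed.

Lemma rect_ext (f g : C -> C) (a b c d : R) : a <= b -> c <= d ->
  on_boundary (fun z => f z = g z) a b c d -> rect f a b c d = rect g a b c d.
Proof.
  intros Hab Hcd [H1 H2]. unfold rect. 
  rewrite (CInt_ext (fun x => f (x, c)) (fun x => g (x, c))).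
  rewrite (CInt_ext (fun x => f (x, d)) (fun x => g (x, d))).
  rewrite (CInt_ext (fun y => f (a, y)) (fun y => g (a, y))).
  rewrite (CInt_ext (fun y => f (b, y)) (fun y => g (b, y))). reflexivity.
  all: intros t; rewrite Rmin_left, Rmax_right by assumption; intro Ht;
    (apply H1 || apply H2); lra.
Qed.

Lemma rect_bound (f : C -> C) (a b c d M : R) : a <= b -> c <= d ->
  on_boundary (cont_at f) a b c d -> on_boundary (fun z => Cmod (f z) <= M) a b c d ->
  Cmod (rect f a b c d) <= M * (2 * ((b - a) + (d - c))).
Proof.
  intros Hab Hcd Hf [H1 H2]. apply boundary_rcont in Hf as (F1 & F2 & F3 & F4); trivial.
  assert (B1 := CInt_bound _ a b M Hab F1 (fun t Ht => proj1 (H1 t Ht))).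
  assert (B2 := CInt_bound _ a b M Hab F2 (fun t Ht => proj2 (H1 t Ht))).
  assert (B3 := CInt_bound _ c d M Hcd F3 (fun t Ht => proj1 (H2 t Ht))).
  assert (B4 := CInt_bound _ c d M Hcd F4 (fun t Ht => proj2 (H2 t Ht))).
  unfold rect. eapply Rle_trans; [apply Cmod_triangle|].
  rewrite Cmod_mult, Cmod_Ci, Rmult_1_l.
  assert (C1 := Cmod_sub_le (CInt (fun x => f (x, c)) a b) (CInt (fun x => f (x, d)) a b)).
  assert (C2 := Cmod_sub_le (CInt (fun y => f (b, y)) c d) (CInt (fun y => f (a, y)) c d)).
  lra.
Qed.

Lemma rcont_on_incl (g : R -> C) (a b a' b' : R) : a <= a' <= b' -> b' <= b ->
  rcont_on g a b -> rcont_on g a' b'.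
Proof.
  intros Ha Hb H t. rewrite Rmin_left, Rmax_right by lra. intro Ht. apply H.
  rewrite Rmin_left, Rmax_right by lra. lra.
Qed.

Lemma rect_split_x (f : C -> C) (a e b c d : R) : a <= e <= b -> c <= d ->
  on_boundary (cont_at f) a b c d ->
  (rect f a e c d + rect f e b c d)%C = rect f a b c d.
Proof.
  intros He Hcd Hf. apply boundary_rcont in Hf as (F1 & F2 & F3 & F4); try lra.
  unfold rect.
  rewrite <- (CInt_Chasles (fun x => f (x, c)) a e b).
  rewrite <- (CInt_Chasles (fun x => f (x, d)) a e b). ring.
  all: eapply rcont_on_incl; [| |eassumption]; lra.
Qed.

Lemma rect_split_y (f : C -> C) (a b c e d : R) : a <= b -> c <= e <= d ->
  on_boundary (cont_at f) a b c d ->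
  (rect f a b c e + rect f a b e d)%C = rect f a b c d.
Proof.
  intros Hab He Hf. apply boundary_rcont in Hf as (F1 & F2 & F3 & F4); try lra.
  unfold rect.
  rewrite <- (CInt_Chasles (fun y => f (a, y)) c e d).
  rewrite <- (CInt_Chasles (fun y => f (b, y)) c e d). ring.
  all: eapply rcont_on_incl; [| |eassumption]; lra.
Qed.

(** * Goursat's theorem *)

Lemma CInt_linear (p q : C) (a b : R) :
  CInt (fun t => p + t * q)%C a b = ((b - a) * p + (b * b - a * a) / 2 * q)%C.
Proof.
  assert (H : forall u v w, RInt (fun t => u + (t * v - 0 * w)) a b
                    = (b - a) * u + (b * b - a * a) / 2 * v).
  { intros u v w. apply is_RInt_unique.
    replace ((b - a) * u + (b * b - a * a) / 2 * v)
      with (minus (b * u + b * b / 2 * v) (a * u + a * a / 2 * v))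
      by (unfold minus, plus, opp; simpl; field).
    apply (is_RInt_derive (V := R_CompleteNormedModule) (fun t => t * u + t * t / 2 * v)).
    - intros t _. auto_derive; [easy | field].
    - intros t _. apply continuous_eps. intros eps He.
      exists (eps / (Rabs v + 1)). assert (HK := Rabs_pos v).
      split; [apply Rdiv_lt_0_compat; lra|]. intros s Hs.
      replace (u + (s * v - 0 * w) - (u + (t * v - 0 * w))) with ((s - t) * v) by ring.
      rewrite Rabs_mult.
      apply Rmult_lt_compat_r with (r := Rabs v + 1) in Hs; [|lra].
      unfold Rdiv in Hs. rewrite Rmult_assoc, Rinv_l in Hs by lra.
      generalize (Rabs_pos (s - t)). nra. }
  unfold CInt. simpl. apply injective_projections; simpl.
  - rewrite H. field.
  - rewrite (RInt_ext _ (fun t => snd p + (t * snd q - 0 * fst q)))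
      by (intros t _; simpl; match goal with |- ?x = ?y => change (@eq R x y) end; ring).
    rewrite H. field.
Qed.

Lemma rect_affine (p q : C) (a b c d : R) : rect (fun z => p + q * z)%C a b c d = 0.
Proof.
  unfold rect.
  assert (Hh : forall e, CInt (fun x => p + q * (x, e))%C a b
     = ((b - a) * (p + q * Ci * e) + (b * b - a * a) / 2 * q)%C).
  { intro e. rewrite <- CInt_linear. apply CInt_ext. intros t _.
    apply injective_projections; simpl; ring. }
  assert (Hv : forall e, CInt (fun y => p + q * (e, y))%C c d
     = ((d - c) * (p + q * e) + (d * d - c * c) / 2 * (q * Ci))%C).
  { intro e. rewrite <- CInt_linear. apply CInt_ext. intros t _.
    apply injective_projections; simpl; ring. }
  rewrite !Hh, !Hv. apply injective_projections; simpl; field.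
Qed.

Record box := Box { bl : R; br : R; bb : R; bt : R }.

Definition brect (f : C -> C) (Q : box) : C := rect f (bl Q) (br Q) (bb Q) (bt Q).

Definition quad (Q : box) (i j : bool) : box :=
  let mx := (bl Q + br Q) / 2 in let my := (bb Q + bt Q) / 2 in
  Box (if i then mx else bl Q) (if i then br Q else mx)
      (if j then my else bb Q) (if j then bt Q else my).

(** By the triangle inequality the last quarter is large when the three others are small. *)
Definition pick (f : C -> C) (Q : box) : box :=
  let good i j := Rle_dec (Cmod (brect f Q) / 4) (Cmod (brect f (quad Q i j))) in
  if good true true then quad Q true true else
  if good true false then quad Q true false else
  if good false true then quad Q false true else quad Q false false.

Lemma pick_quad (f : C -> C) (Q : box) : exists i j, pick f Q = quad Q i j.
Proof. unfold pick. repeat destruct (Rle_dec _ _); eauto. Qed.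

Lemma pick_large (f : C -> C) (Q : box) : bl Q <= br Q -> bb Q <= bt Q ->
  on_rect (cont_at f) (bl Q) (br Q) (bb Q) (bt Q) ->
  Cmod (brect f Q) / 4 <= Cmod (brect f (pick f Q)).
Proof.
  destruct Q as [a b c d]. simpl. intros Hab Hcd Hf.
  assert (E : brect f (Box a b c d) =
    (brect f (quad (Box a b c d) false false) + brect f (quad (Box a b c d) false true)
     + (brect f (quad (Box a b c d) true false) + brect f (quad (Box a b c d) true true)))%C).
  { unfold brect, quad; simpl.
    rewrite (rect_split_y f a), (rect_split_y f _ b), rect_split_x; try lra; trivial;
      apply on_rect_boundary; try lra; intros x y Hx Hy; apply Hf; lra. }
  unfold pick. repeat destruct (Rle_dec _ _); trivial.
  assert (T1 := Cmod_triangle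
    (brect f (quad (Box a b c d) false false) + brect f (quad (Box a b c d) false true))
    (brect f (quad (Box a b c d) true false) + brect f (quad (Box a b c d) true true))).
  rewrite <- E in T1.
  assert (T2 := Cmod_triangle (brect f (quad (Box a b c d) false false))
                  (brect f (quad (Box a b c d) false true))).
  assert (T3 := Cmod_triangle (brect f (quad (Box a b c d) true false))
                  (brect f (quad (Box a b c d) true true))).
  lra.
Qed.

Lemma nested_intervals (u v : nat -> R) :
  (forall n, u n <= v n) -> (forall n, u n <= u (S n)) -> (forall n, v (S n) <= v n) ->
  exists p, forall n, u n <= p <= v n.
Proof.
  intros Huv Hu Hv.
  assert (Mu : forall m k, u m <= u (m + k)%nat).
  { intros m k. induction k as [|k IH]; [rewrite Nat.add_0_r; lra|].
    rewrite Nat.add_succ_r. eapply Rle_trans; [exact IH | apply Hu]. }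
  assert (Mv : forall m k, v (m + k)%nat <= v m).
  { intros m k. induction k as [|k IH]; [rewrite Nat.add_0_r; lra|].
    rewrite Nat.add_succ_r. eapply Rle_trans; [apply Hv | exact IH]. }
  assert (B : forall m n, u m <= v n).
  { intros m n. apply Rle_trans with (u (m + n)%nat); [apply Mu|].
    eapply Rle_trans; [apply Huv|]. rewrite Nat.add_comm. apply Mv. }
  destruct (completeness (fun x => exists n, x = u n)) as [p [Hp1 Hp2]].
  - exists (v 0%nat). intros x [n ->]. apply B.
  - exists (u 0%nat). now exists 0%nat.
  - exists p. intro n. split.
    + apply Hp1. now exists n.
    + apply Hp2. intros x [m ->]. apply B.
Qed.

(** Bisect, keeping at each step a quarter with a large boundary integral. At the common point
    of the nested rectangles [f] is affine up to [eps |w - p|]; affine functions integrate to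
    zero, and the error is of the order of [eps] times the area. *)
Theorem goursat (f : C -> C) (a b c d : R) : a <= b -> c <= d ->
  on_rect (holo f) a b c d -> rect f a b c d = 0.
Proof.
  intros Hab Hcd Hf.
  set (Q := fun n => Nat.iter n (pick f) (Box a b c d)).
  set (s := (b - a) + (d - c)).
  assert (Inv : forall n,
    (bl (Q n) <= br (Q n) /\ bb (Q n) <= bt (Q n)) /\
    (a <= bl (Q n) /\ br (Q n) <= b /\ c <= bb (Q n) /\ bt (Q n) <= d) /\
    (br (Q n) - bl (Q n)) + (bt (Q n) - bb (Q n)) = s / 2 ^ n /\
    Cmod (rect f a b c d) <= 4 ^ n * Cmod (brect f (Q n)) /\
    (bl (Q n) <= bl (Q (S n)) /\ br (Q (S n)) <= br (Q n)
     /\ bb (Q n) <= bb (Q (S n)) /\ bt (Q (S n)) <= bt (Q n))).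
  { assert (Step : forall n, bl (Q n) <= br (Q n) -> bb (Q n) <= bt (Q n) ->
      (bl (Q n) <= bl (Q (S n)) /\ br (Q (S n)) <= br (Q n)
       /\ bb (Q n) <= bb (Q (S n)) /\ bt (Q (S n)) <= bt (Q n)) /\
      bl (Q (S n)) <= br (Q (S n)) /\ bb (Q (S n)) <= bt (Q (S n)) /\
      (br (Q (S n)) - bl (Q (S n))) + (bt (Q (S n)) - bb (Q (S n)))
       = ((br (Q n) - bl (Q n)) + (bt (Q n) - bb (Q n))) / 2).
    { intros n H1 H2. change (Q (S n)) with (pick f (Q n)).
      destruct (pick_quad f (Q n)) as [i [j ->]].
      unfold quad; destruct i, j; simpl; repeat split; lra. }
    induction n as [|n IH].
    - destruct (Step 0%nat) as (S1 & S2 & S3 & S4); simpl; trivial.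
      simpl in *. unfold brect, s; simpl. repeat split; try lra; try apply S1.
    - destruct IH as ((I1 & I2) & (I3 & I4 & I5 & I6) & I7 & I8 & I9).
      destruct (Step n I1 I2) as (S1 & S2 & S3 & S4).
      destruct (Step (S n) S2 S3) as (S5 & S6 & S7 & S8).
      repeat split; try tauto; try lra.
      + rewrite S4, I7. simpl. field. apply pow_nonzero. lra.
      + eapply Rle_trans; [exact I8|]. simpl.
        rewrite (Rmult_comm 4), Rmult_assoc. apply Rmult_le_compat_l.
        * apply pow_le. lra.
        * change (Q (S n)) with (pick f (Q n)).
          assert (L := pick_large f (Q n) I1 I2). 
          enough (Cmod (brect f (Q n)) / 4 <= Cmod (brect f (pick f (Q n)))) by lra.
          apply L. intros x y Hx Hy. apply holo_cont, Hf; lra. }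
  destruct (nested_intervals (fun n => bl (Q n)) (fun n => br (Q n))) as [px Hpx];
    try (intro n; apply (Inv n)).
  destruct (nested_intervals (fun n => bb (Q n)) (fun n => bt (Q n))) as [py Hpy];
    try (intro n; apply (Inv n)).
  set (p := (px, py) : C).
  assert (Hp : holo f p).
  { destruct (Inv 0%nat) as (_ & (I3 & I4 & I5 & I6) & _).
    specialize (Hpx 0%nat). specialize (Hpy 0%nat). apply Hf; lra. }
  destruct Hp as [l [phi [Hc [El E]]]].
  assert (Hs : 0 <= s) by (unfold s; lra).
  apply Cmod_eq_0. apply Rle_antisym; [|apply Cmod_ge_0].
  apply le_epsilon. intros e He. rewrite Rplus_0_l.
  set (eps := e / (2 * s * s + 1)).
  assert (Heps : 0 < eps) by (apply Rdiv_lt_0_compat; nra).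
  destruct (Hc eps Heps) as (dl & Hdl & Hphi).
  assert (Hn : exists n, s / 2 ^ n < dl).
  { destruct (pow_lt_1_zero (/ 2)) with (y := dl / (s + 1)) as [N HN].
    - rewrite Rabs_pos_eq; lra.
    - apply Rdiv_lt_0_compat; lra.
    - exists N. specialize (HN N (le_n N)).
      rewrite pow_inv in HN.
      rewrite Rabs_pos_eq in HN by (left; apply Rinv_0_lt_compat, pow_lt; lra).
      assert (HP : 0 < / 2 ^ N) by (apply Rinv_0_lt_compat, pow_lt; lra).
      apply Rmult_lt_compat_l with (r := s + 1) in HN; [|lra].
      replace ((s + 1) * (dl / (s + 1))) with dl in HN by (field; lra).
      unfold Rdiv. nra. }
  destruct Hn as [n Hn].
  destruct (Inv n) as ((I1 & I2) & (I3 & I4 & I5 & I6) & I7 & I8 & _).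
  specialize (Hpx n). specialize (Hpy n).
  eapply Rle_trans; [exact I8|].
  set (g := fun z => ((phi z - phi p) * (z - p))%C).
  assert (Hd : forall x y, bl (Q n) <= x <= br (Q n) -> bb (Q n) <= y <= bt (Q n) ->
     Cmod ((x, y) - p)%C <= s / 2 ^ n).
  { intros x y Hx Hy. eapply Rle_trans; [apply Cmod_le_abs|]. unfold p. simpl.
    rewrite <- I7. apply Rplus_le_compat; apply Rabs_le; lra. }
  assert (Cg : on_rect (cont_at g) (bl (Q n)) (br (Q n)) (bb (Q n)) (bt (Q n))).
  { intros x y Hx Hy.
    apply (cont_at_ext (fun z => f z - (f p - phi p * p + phi p * z))%C).
    - intro w. unfold g. rewrite (E w). ring.
    - apply cont_at_minus; [apply holo_cont, Hf; lra|].
      apply cont_at_plus; [apply cont_at_const | apply cont_at_scal, cont_at_id]. }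
  assert (EQ : brect f (Q n) = brect g (Q n)).
  { unfold brect.
    rewrite (rect_ext f (fun z => (f p - phi p * p + phi p * z) + g z)%C); trivial.
    - rewrite rect_plus; trivial.
      + rewrite rect_affine. ring.
      + apply on_rect_boundary; trivial. intros x y _ _.
        apply cont_at_plus; [apply cont_at_const | apply cont_at_scal, cont_at_id].
      + now apply on_rect_boundary.
    - apply on_rect_boundary; trivial. intros x y _ _. unfold g. rewrite (E (x, y)). ring. }
  rewrite EQ.
  assert (B := rect_bound g (bl (Q n)) (br (Q n)) (bb (Q n)) (bt (Q n)) (eps * (s / 2 ^ n))
     I1 I2 (on_rect_boundary _ _ _ _ _ I1 I2 Cg)).
  rewrite I7 in B.
  apply Rle_trans with (4 ^ n * (eps * (s / 2 ^ n) * (2 * (s / 2 ^ n)))).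
  - apply Rmult_le_compat_l; [apply pow_le; lra|]. apply B.
    apply on_rect_boundary; trivial. intros x y Hx Hy.
    unfold g. rewrite Cmod_mult. apply Rmult_le_compat; try apply Cmod_ge_0.
    + left. apply Hphi. eapply Rle_lt_trans; [apply Hd; assumption | exact Hn].
    + now apply Hd.
  - replace (4 ^ n) with (2 ^ n * 2 ^ n) by (rewrite <- Rpow_mult_distr; reflexivity).
    assert (HP : 2 ^ n <> 0) by (apply pow_nonzero; lra).
    replace (2 ^ n * 2 ^ n * (eps * (s / 2 ^ n) * (2 * (s / 2 ^ n)))) with (eps * (2 * s * s))
      by (field; exact HP).
    unfold eps. apply Rmult_le_reg_r with (2 * s * s + 1); [nra|].
    replace (e / (2 * s * s + 1) * (2 * s * s) * (2 * s * s + 1)) with (e * (2 * s * s))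
      by (field; nra).
    nra.
Qed.

(** * Residues at simple poles and the maximum principle *)

Lemma sum_squares_pos (u r : R) : 0 < r -> 0 < u * u + r * r.
Proof. intro Hr. assert (0 <= u * u) by apply Rle_0_sqr. nra. Qed.

Lemma square_odd_part (m r : R) : 0 < r ->
  is_RInt (fun t => (t - m) / ((t - m) * (t - m) + r * r)) (m - r) (m + r) 0.
Proof.
  intro Hr.
  replace 0 with (minus (/ 2 * ln ((m + r - m) * (m + r - m) + r * r))
                        (/ 2 * ln ((m - r - m) * (m - r - m) + r * r))).
  2: { replace (m + r - m) with r by ring. replace (m - r - m) with (- r) by ring.
       replace (- r * - r) with (r * r) by ring. unfold minus, plus, opp; simpl. ring. }
  apply (is_RInt_derive (V := R_CompleteNormedModule)
    (fun t => / 2 * ln ((t - m) * (t - m) + r * r))).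
  - intros t _. assert (HP := sum_squares_pos (t - m) r Hr).
    auto_derive; [assumption|]. field. lra.
  - intros t _. apply ex_derive_cont.
    assert (HP := sum_squares_pos (t - m) r Hr). auto_derive. nra.
Qed.

Lemma square_even_part (m r : R) : 0 < r ->
  is_RInt (fun t => r / ((t - m) * (t - m) + r * r)) (m - r) (m + r) (PI / 2).
Proof.
  intro Hr.
  replace (PI / 2) with (minus (atan ((m + r - m) / r)) (atan ((m - r - m) / r))).
  2: { replace ((m + r - m) / r) with 1 by (field; lra).
       replace ((m - r - m) / r) with (- (1)) by (field; lra).
       rewrite atan_opp, atan_1. unfold minus, plus, opp; simpl. field. }
  apply (is_RInt_derive (V := R_CompleteNormedModule) (fun t => atan ((t - m) / r))).
  - intros t _. assert (HP := sum_squares_pos (t - m) r Hr). auto_derive; [lra|].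
    field. lra.
  - intros t _. apply ex_derive_cont.
    assert (HP := sum_squares_pos (t - m) r Hr). auto_derive. nra.
Qed.

Lemma square_winding (p : C) (r : R) : 0 < r ->
  rect (fun z => / (z - p))%C (fst p - r) (fst p + r) (snd p - r) (snd p + r)
   = (2 * PI * Ci)%C.
Proof.
  intro Hr. destruct p as [p1 p2]. simpl fst; simpl snd.
  assert (O := fun m => is_RInt_unique _ _ _ _ (square_odd_part m r Hr)).
  assert (V := fun m => is_RInt_unique _ _ _ _ (square_even_part m r Hr)).
  assert (O' : forall m, RInt (fun t => - ((t - m) / ((t - m) * (t - m) + r * r))) (m - r) (m + r) = 0).
  { intro m. apply is_RInt_unique. replace 0 with (opp 0) by (unfold opp; simpl; ring).
    apply (is_RInt_opp (V := R_NormedModule)), square_odd_part, Hr. }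
  assert (V' : forall m, RInt (fun t => - (r / ((t - m) * (t - m) + r * r))) (m - r) (m + r) = - (PI / 2)).
  { intro m. apply is_RInt_unique.
    apply (is_RInt_opp (V := R_NormedModule) _ _ _ (PI / 2)), square_even_part, Hr. }
  unfold rect, CInt.
  assert (E : forall (u v : R -> R) (a b : R), (forall t, u t = v t) -> RInt u a b = RInt v a b).
  { intros u v a b H. apply RInt_ext. intros; apply H. }
  rewrite (E (fun t => fst (/ ((t, (p2 - r)%R) - (p1, p2)))%C) (fun t => (t - p1) / ((t - p1) * (t - p1) + r * r))).
  rewrite (E (fun t => snd (/ ((t, (p2 - r)%R) - (p1, p2)))%C) (fun t => r / ((t - p1) * (t - p1) + r * r))).
  rewrite (E (fun t => fst (/ ((t, (p2 + r)%R) - (p1, p2)))%C) (fun t => (t - p1) / ((t - p1) * (t - p1) + r * r))).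
  rewrite (E (fun t => snd (/ ((t, (p2 + r)%R) - (p1, p2)))%C) (fun t => - (r / ((t - p1) * (t - p1) + r * r)))).
  rewrite (E (fun t => fst (/ (((p1 + r)%R, t) - (p1, p2)))%C) (fun t => r / ((t - p2) * (t - p2) + r * r))).
  rewrite (E (fun t => snd (/ (((p1 + r)%R, t) - (p1, p2)))%C) (fun t => - ((t - p2) / ((t - p2) * (t - p2) + r * r)))).
  rewrite (E (fun t => fst (/ (((p1 - r)%R, t) - (p1, p2)))%C) (fun t => - (r / ((t - p2) * (t - p2) + r * r)))).
  rewrite (E (fun t => snd (/ (((p1 - r)%R, t) - (p1, p2)))%C) (fun t => - ((t - p2) / ((t - p2) * (t - p2) + r * r)))).
  rewrite !O, !V, !O', !V'. apply injective_projections; simpl; field.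
  all: intro t; simpl; unfold Rdiv.
  all: match goal with |- context [/ (?u * ?u + ?v * ?v)] =>
         match goal with |- _ * / ?e = _ => replace e with (u * u + v * v) by ring end end; ring.
Qed.

Lemma margin_pos (p : C) (a b c d : R) : a < fst p < b -> c < snd p < d ->
  exists m, 0 < m /\ m <= fst p - a /\ m <= b - fst p /\ m <= snd p - c /\ m <= d - snd p.
Proof.
  intros Hx Hy.
  exists (Rmin (Rmin (fst p - a) (b - fst p)) (Rmin (snd p - c) (d - snd p))).
  assert (L := Rmin_l (Rmin (fst p - a) (b - fst p)) (Rmin (snd p - c) (d - snd p))).
  assert (R := Rmin_r (Rmin (fst p - a) (b - fst p)) (Rmin (snd p - c) (d - snd p))).
  assert (L1 := Rmin_l (fst p - a) (b - fst p)). assert (L2 := Rmin_r (fst p - a) (b - fst p)).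
  assert (R1 := Rmin_l (snd p - c) (d - snd p)). assert (R2 := Rmin_r (snd p - c) (d - snd p)).
  split; [repeat apply Rmin_pos; lra | lra].
Qed.

(** A pole of order at most one, with its residue [r] as the limit of [(w - p) g(w)]. *)
Definition pole_at (g : C -> C) (p r : C) : Prop :=
  forall eps, 0 < eps -> exists delta, 0 < delta /\
    forall w, w <> p -> Cmod (w - p)%C < delta -> Cmod ((w - p) * g w - r)%C < eps.

Lemma rect_nested (g : C -> C) (a b c d a' b' c' d' : R) :
  a <= a' -> a' <= b' -> b' <= b -> c <= c' -> c' <= d' -> d' <= d ->
  (forall x y, a <= x <= b -> c <= y <= d -> ~ (a' < x < b' /\ c' < y < d') -> holo g (x, y)) ->
  rect g a b c d = rect g a' b' c' d'.
Proof.
  intros H1 H2 H3 H4 H5 H6 Hg.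
  assert (B : forall x y u v, a <= x -> x <= y -> y <= b -> c <= u -> u <= v -> v <= d ->
     (x = a \/ x = a') -> (y = b \/ y = b') -> (u = c \/ u = c') -> (v = d \/ v = d') ->
     on_boundary (cont_at g) x y u v).
  { intros x y u v ? ? ? ? ? ? Hx Hy Hu Hv.
    split; intros t Ht; split; apply holo_cont, Hg; lra. }
  rewrite <- (rect_split_x g a a' b) by (try apply B; lra).
  rewrite <- (rect_split_x g a' b' b) by (try apply B; lra).
  rewrite <- (rect_split_y g a' b' c c' d) by (try apply B; lra).
  rewrite <- (rect_split_y g a' b' c' d' d) by (try apply B; lra).
  rewrite (goursat g a a' c d), (goursat g b' b c d), (goursat g a' b' c c'),
    (goursat g a' b' d' d); try lra.
  - ring.
  - intros x y Hx Hy. apply Hg; lra.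
  - intros x y Hx Hy. apply Hg; lra.
  - intros x y Hx Hy. apply Hg; lra.
  - intros x y Hx Hy. apply Hg; lra.
Qed.

(** Shrink the rectangle to a small square around the pole, where [g] is [r/(z-p)] up to
    an error [eps/|z-p|], whose integral over the square is at most [8 eps]. *)
Theorem residue_rect (g : C -> C) (p r : C) (a b c d : R) :
  a < fst p < b -> c < snd p < d ->
  on_rect (fun z => z <> p -> holo g z) a b c d -> pole_at g p r ->
  rect g a b c d = (2 * PI * Ci * r)%C.
Proof.
  intros Hx Hy Hg Hp.
  enough (K : Cmod (rect g a b c d - 2 * PI * Ci * r)%C = 0).
  { apply Cmod_eq_0 in K. apply Ceq_minus. exact K. }
  apply Rle_antisym; [|apply Cmod_ge_0]. apply le_epsilon. intros e He. rewrite Rplus_0_l.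
  destruct (Hp (e / 8)) as (dl & Hdl & HP); [lra|].
  destruct (margin_pos p a b c d Hx Hy) as (m & Hm & M1 & M2 & M3 & M4).
  set (h := Rmin (m / 2) (dl / 4)).
  assert (Hh : 0 < h) by (apply Rmin_pos; lra).
  assert (Hh1 : h <= m / 2) by apply Rmin_l. assert (Hh2 : h <= dl / 4) by apply Rmin_r.
  clearbody h.
  assert (NE : forall x y, ~ (fst p - h < x < fst p + h /\ snd p - h < y < snd p + h) -> (x, y) <> p).
  { intros x y N E. apply N. rewrite <- E. simpl. lra. }
  rewrite (rect_nested g a b c d (fst p - h) (fst p + h) (snd p - h) (snd p + h)); try lra.
  2: { intros x y Hx' Hy' N. apply Hg; try lra. now apply NE. }
  rewrite <- (square_winding p h Hh).
  assert (BD : forall P : C -> Prop, (forall z, h <= Cmod (z - p)%C <= 2 * h -> z <> p ->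
      a <= fst z <= b -> c <= snd z <= d -> P z) ->
    on_boundary P (fst p - h) (fst p + h) (snd p - h) (snd p + h)).
  { intros P HPz. split; intros t Ht; split; apply HPz; simpl; try lra.
    all: try (apply NE; lra).
    all: split; [|eapply Rle_trans; [apply Cmod_le_abs|]; simpl;
      replace (2 * h) with (h + h) by ring; apply Rplus_le_compat; apply Rabs_le; lra].
    - eapply Rle_trans; [|apply snd_le_Cmod]; simpl. rewrite Rabs_left; lra.
    - eapply Rle_trans; [|apply snd_le_Cmod]; simpl. rewrite Rabs_right; lra.
    - eapply Rle_trans; [|apply fst_le_Cmod]; simpl. rewrite Rabs_left; lra.
    - eapply Rle_trans; [|apply fst_le_Cmod]; simpl. rewrite Rabs_right; lra. }
  assert (CI : forall z, z <> p -> cont_at (fun z => / (z - p))%C z).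
  { intros z Hz. apply (cont_at_comp (fun w => w - p)%C Cinv).
    - apply cont_at_minus; [apply cont_at_id | apply cont_at_const].
    - now apply cont_at_inv, Csub_neq0. }
  assert (CG : on_boundary (cont_at g) (fst p - h) (fst p + h) (snd p - h) (snd p + h)).
  { apply BD. intros [x y] _ Hz Hx' Hy'. apply holo_cont, Hg; trivial. }
  replace (rect g (fst p - h) (fst p + h) (snd p - h) (snd p + h) -
     rect (fun z => / (z - p)) (fst p - h) (fst p + h) (snd p - h) (snd p + h) * r)%C
    with (rect (fun z => g z + (- r) * / (z - p))%C (fst p - h) (fst p + h) (snd p - h) (snd p + h)).
  2: { rewrite rect_plus; try lra; trivial.
       - rewrite rect_scal; try lra; [ring|]. apply BD. intros z _ Hz _ _. now apply CI.
       - apply BD. intros z _ Hz _ _. apply cont_at_scal. now apply CI. }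
  eapply Rle_trans; [apply (rect_bound _ _ _ _ _ (e / 8 / h)); try lra|].
  - apply BD. intros [x y] _ Hz Hx' Hy'. apply cont_at_plus.
    + apply holo_cont, Hg; trivial.
    + apply cont_at_scal. now apply CI.
  - apply BD. intros z [Hz1 Hz2] Hz _ _.
    assert (Hn : (z - p)%C <> 0) by now apply Csub_neq0.
    replace (g z + - r * / (z - p))%C with (((z - p) * g z - r) * / (z - p))%C by (field; exact Hn).
    rewrite Cmod_mult, Cmod_inv by exact Hn.
    unfold Rdiv at 1. apply Rmult_le_compat; try apply Cmod_ge_0.
    + left. apply Rinv_0_lt_compat. lra.
    + left. apply HP; trivial. lra.
    + apply Rinv_le_contravar; lra.
  - right. field. lra.
Qed.

(** The Cauchy formula for [f^n] bounds [|f p|^n] by [K B^n], with a constant [K] that depends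
    on the rectangle only; let [n] grow. *)
Theorem maximum_modulus_rect (f : C -> C) (p : C) (a b c d B : R) :
  a < fst p < b -> c < snd p < d -> 0 < B ->
  on_rect (holo f) a b c d -> on_boundary (fun z => Cmod (f z) <= B) a b c d ->
  Cmod (f p) <= B.
Proof.
  intros Hx Hy HB Hf Hb.
  destruct (margin_pos p a b c d Hx Hy) as (m & Hm & M1 & M2 & M3 & M4).
  assert (Hfp : holo f p) by (destruct p; apply Hf; simpl in *; lra).
  assert (HI : forall z, z <> p -> holo (fun z => / (z - p))%C z).
  { intros z Hz. apply (holo_comp (fun w => w - p)%C Cinv).
    - apply holo_minus; [apply holo_id | apply holo_const].
    - now apply diff_at_inv, Csub_neq0. }
  set (K := 2 * ((b - a) + (d - c)) / m).
  assert (HK : 0 < K) by (apply Rdiv_lt_0_compat; lra).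
  assert (Main : forall n, Cmod (f p) ^ n <= K * B ^ n).
  { intro n.
    assert (HG : on_rect (fun z => z <> p -> holo (fun z => f z ^ n * / (z - p))%C z) a b c d).
    { intros x y Hx' Hy' Hz. apply holo_mult; [now apply holo_pow, Hf | now apply HI]. }
    assert (R := residue_rect (fun z => f z ^ n * / (z - p))%C p (f p ^ n)%C a b c d Hx Hy HG).
    assert (BD : forall P : C -> Prop, (forall z, m <= Cmod (z - p)%C -> z <> p ->
      a <= fst z <= b -> c <= snd z <= d -> Cmod (f z) <= B -> P z) -> on_boundary P a b c d).
    { intros P HPz.
      assert (HPz' : forall z, m <= Cmod (z - p)%C ->
        a <= fst z <= b -> c <= snd z <= d -> Cmod (f z) <= B -> P z).
      { intros z H1 H2 H3 H4. apply HPz; trivial. intro E. rewrite E in H1.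
        replace (p - p)%C with (RtoC 0) in H1 by ring. rewrite Cmod_0 in H1. lra. }
      split; intros t Ht; split; apply HPz'; simpl; try lra; try (now apply Hb).
      - eapply Rle_trans; [|apply snd_le_Cmod]; simpl. rewrite Rabs_left; lra.
      - eapply Rle_trans; [|apply snd_le_Cmod]; simpl. rewrite Rabs_right; lra.
      - eapply Rle_trans; [|apply fst_le_Cmod]; simpl. rewrite Rabs_left; lra.
      - eapply Rle_trans; [|apply fst_le_Cmod]; simpl. rewrite Rabs_right; lra. }
    assert (U : Cmod (rect (fun z => f z ^ n * / (z - p))%C a b c d)
                <= B ^ n * / m * (2 * ((b - a) + (d - c)))).
    { apply rect_bound; try lra.
      - apply BD. intros [x y] _ Hz H1 H2 _. apply holo_cont. now apply HG.
      - apply BD. intros z H1 Hz _ _ H2.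
        assert (Hn : (z - p)%C <> 0) by now apply Csub_neq0.
        rewrite Cmod_mult, Cmod_inv, Cmod_pow by exact Hn.
        apply Rmult_le_compat.
        + apply pow_le, Cmod_ge_0.
        + left. apply Rinv_0_lt_compat. lra.
        + apply pow_incr. split; [apply Cmod_ge_0 | exact H2].
        + apply Rinv_le_contravar; lra. }
    rewrite R in U.
    - rewrite !Cmod_mult, Cmod_Ci, Cmod_pow, !Cmod_R in U.
      rewrite (Rabs_pos_eq PI) in U by (generalize PI_RGT_0; lra).
      rewrite (Rabs_pos_eq 2) in U by lra.
      assert (P1 := pow_le _ n (Cmod_ge_0 (f p))).
      assert (P2 := PI_RGT_0). assert (P3 := PI2_1).
      replace (K * B ^ n) with (B ^ n * / m * (2 * (b - a + (d - c)))) by (unfold K; field; lra).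
      nra.
    - intros eps He.
      destruct (holo_cont _ _ (holo_pow f n p Hfp) eps He) as (dl & Hdl & H).
      exists dl. split; [exact Hdl|]. intros w Hw Hwd.
      replace ((w - p) * (f w ^ n * / (w - p)))%C with (f w ^ n)%C; [now apply H|].
      field. now apply Csub_neq0. }
  destruct (Rle_lt_dec (Cmod (f p)) B) as [|Hlt]; [assumption|exfalso].
  set (q := Cmod (f p) / B).
  assert (Hq : 1 < q).
  { unfold q. apply Rmult_lt_reg_r with B; [exact HB|]. unfold Rdiv.
    rewrite Rmult_assoc, Rinv_l; lra. }
  destruct (Pow_x_infinity q) with (b := K + 1) as [N HN].
  { rewrite Rabs_pos_eq; lra. }
  specialize (HN N (le_n N)). rewrite Rabs_pos_eq in HN by (apply pow_le; lra).
  specialize (Main N).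
  assert (HBN : 0 < B ^ N) by (apply pow_lt; lra).
  replace (Cmod (f p) ^ N) with (q ^ N * B ^ N) in Main.
  2: { rewrite <- Rpow_mult_distr. f_equal. unfold q. field. lra. }
  nra.
Qed.

(** * Primitives of entire functions *)

Lemma CInt_swap (g : R -> C) (a b : R) : rcont_on g a b -> CInt g b a = (- CInt g a b)%C.
Proof.
  intro Hg. apply rcont_on_ex in Hg as [G1 G2].
  unfold CInt. apply injective_projections; simpl; symmetry.
  - now apply (opp_RInt_swap (V := R_CompleteNormedModule)).
  - now apply (opp_RInt_swap (V := R_CompleteNormedModule)).
Qed.

Lemma rcont_all (g : R -> C) (a b : R) : (forall t, rcont g t) -> rcont_on g a b.
Proof. intros H t _. apply H. Qed.

Lemma CInt_bound_abs (g : R -> C) (a b M : R) : (forall t, rcont g t) ->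
  (forall t, Rmin a b <= t <= Rmax a b -> Cmod (g t) <= M) ->
  Cmod (CInt g a b) <= M * Rabs (b - a).
Proof.
  intros Hg HM. destruct (Rle_dec a b) as [H|H].
  - rewrite Rabs_pos_eq by lra. apply CInt_bound; [exact H | now apply rcont_all|].
    intros t Ht. apply HM. rewrite Rmin_left, Rmax_right; lra.
  - rewrite Rabs_left, CInt_swap, Cmod_opp by (lra || now apply rcont_all).
    replace (- (b - a)) with (a - b) by ring.
    apply CInt_bound; [lra | now apply rcont_all|].
    intros t Ht. apply HM. rewrite Rmin_right, Rmax_left; lra.
Qed.

Lemma goursat_oriented (f : C -> C) (a b c d : R) :
  (forall z, holo f z) -> rect f a b c d = 0.
Proof.
  intro Hf.
  assert (H1 : forall e t, rcont (fun s => f (s, e)) t) by (intros; apply rcont_horizontal, holo_cont, Hf).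
  assert (H2 : forall e t, rcont (fun s => f (e, s)) t) by (intros; apply rcont_vertical, holo_cont, Hf).
  assert (K : forall a b c d, c <= d -> rect f a b c d = 0).
  { intros a' b' c' d' H. destruct (Rle_dec a' b') as [H'|H'].
    - apply goursat; trivial. intros x y _ _. apply Hf.
    - replace (rect f a' b' c' d') with (- rect f b' a' c' d')%C.
      + rewrite goursat; [ring | lra | trivial |]. intros x y _ _. apply Hf.
      + unfold rect. rewrite (CInt_swap (fun x => f (x, c')) a' b'),
          (CInt_swap (fun x => f (x, d')) a' b') by now apply rcont_all. ring. }
  destruct (Rle_dec c d) as [H|H]; [now apply K|].
  replace (rect f a b c d) with (- rect f a b d c)%C; [rewrite K by lra; ring|].
  unfold rect. rewrite (CInt_swap (fun y => f (b, y)) c d),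
    (CInt_swap (fun y => f (a, y)) c d) by now apply rcont_all. ring.
Qed.

(** First along the real direction, then along the imaginary one. Goursat's theorem makes the
    increments independent of the base point 0. *)
Definition primitive (f : C -> C) (z : C) : C :=
  (CInt (fun s => f (s, 0)) 0 (fst z) + Ci * CInt (fun t => f (fst z, t)) 0 (snd z))%C.

Theorem diff_at_primitive (f : C -> C) (z : C) : (forall w, holo f w) -> diff_at (primitive f) z (f z).
Proof.
  intro Hf.
  assert (H1 : forall e t, rcont (fun s => f (s, e)) t) by (intros; apply rcont_horizontal, holo_cont, Hf).
  assert (H2 : forall e t, rcont (fun s => f (e, s)) t) by (intros; apply rcont_vertical, holo_cont, Hf).
  assert (Inc : forall w, (primitive f w - primitive f z)%C =
    (CInt (fun s => f (s, snd z)) (fst z) (fst w)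
     + Ci * CInt (fun t => f (fst w, t)) (snd z) (snd w))%C).
  { intro w. assert (G := goursat_oriented f (fst z) (fst w) 0 (snd z) Hf).
    unfold rect in G. unfold primitive.
    rewrite <- (CInt_Chasles (fun s => f (s, 0)) 0 (fst z) (fst w)) by now apply rcont_all.
    rewrite <- (CInt_Chasles (fun t => f (fst w, t)) 0 (snd z) (snd w)) by now apply rcont_all.
    apply Ceq_minus. apply Ceq_minus in G. rewrite <- G. ring. }
  apply diff_at_of_little_o. intros eps He.
  destruct (holo_cont _ _ (Hf z) (eps / 4)) as (dl & Hdl & H); [lra|].
  exists (dl / 2). split; [lra|]. intros w Hw.
  assert (Q := Cmod_ge_0 (w - z)%C).
  assert (D1 : Rabs (fst w - fst z) <= Cmod (w - z)%C) by apply (fst_le_Cmod (w - z)%C).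
  assert (D2 : Rabs (snd w - snd z) <= Cmod (w - z)%C) by apply (snd_le_Cmod (w - z)%C).
  assert (E : ((primitive f w - primitive f z) - f z * (w - z))%C =
    (CInt (fun s => f (s, snd z) + - f z) (fst z) (fst w)
   + Ci * CInt (fun t => f (fst w, t) + - f z) (snd z) (snd w))%C).
  { rewrite Inc. rewrite !CInt_plus.
    2,3,4,5: apply rcont_all; trivial; intro t; split; apply continuous_const.
    rewrite !CInt_const.
    replace (f z * (w - z))%C with (f z * ((fst w - fst z) + Ci * (snd w - snd z)))%C.
    2: { f_equal. apply injective_projections; simpl; ring. }
    ring. }
  rewrite E.
  assert (RC : forall g : R -> C, (forall t, rcont g t) -> forall t, rcont (fun t => g t + - f z)%C t).
  { intros g Hg t. destruct (Hg t) as [Q1 Q2]. split.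
    - apply (continuous_plus (V := R_NormedModule) (fun t => fst (g t))); [exact Q1 | apply continuous_const].
    - apply (continuous_plus (V := R_NormedModule) (fun t => snd (g t))); [exact Q2 | apply continuous_const]. }
  assert (Near : forall u v, Rabs (u - fst z) <= Cmod (w - z)%C -> Rabs (v - snd z) <= Cmod (w - z)%C ->
    Cmod (f (u, v) + - f z)%C <= eps / 4).
  { intros u v Hu Hv. left. apply H. eapply Rle_lt_trans; [apply Cmod_le_abs|]. simpl.
    unfold Rminus in *. lra. }
  assert (Between : forall x y t, Rmin x y <= t <= Rmax x y -> Rabs (t - x) <= Rabs (y - x)).
  { intros x y t Ht. unfold Rmin, Rmax in Ht. destruct (Rle_dec x y).
    - rewrite !Rabs_pos_eq; lra.
    - rewrite !Rabs_left1; lra. }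
  eapply Rle_trans; [apply Cmod_triangle|]. rewrite Cmod_mult, Cmod_Ci, Rmult_1_l.
  assert (B1 := CInt_bound_abs (fun s => f (s, snd z) + - f z)%C (fst z) (fst w) (eps / 4)
    (RC _ (H1 _))).
  assert (B2 := CInt_bound_abs (fun t => f (fst w, t) + - f z)%C (snd z) (snd w) (eps / 4)
    (RC _ (H2 _))).
  assert (B1' := B1 ltac:(intros t Ht; apply Near;
    [eapply Rle_trans; [now apply Between | exact D1]
    | rewrite Rminus_diag, Rabs_R0; lra])).
  assert (B2' := B2 ltac:(intros t Ht; apply Near; [exact D1|];
    eapply Rle_trans; [now apply Between | exact D2])).
  apply (Rmult_le_compat_l (eps / 4)) in D1, D2; try lra. assert (0 <= eps * Cmod (w - z)%C) by nra.
  lra.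
Qed.

(** * Derivatives along segments *)

Lemma is_derive_caratheodory (h psi : R -> R) (t : R) :
  continuous psi t -> (forall s, h s = h t + psi s * (s - t)) -> is_derive h t (psi t).
Proof.
  intros Hc E. split; [apply is_linear_scal_l|].
  intros x Hx. rewrite <- (is_filter_lim_locally_unique _ _ Hx). clear x Hx.
  intros [eps He]. simpl.
  destruct (proj1 (filterlim_locally psi (psi t)) Hc (mkposreal eps He)) as [d Hd].
  exists d. intros s Hs. specialize (Hd s Hs). simpl in Hd.
  change (Rabs (psi s - psi t) < eps) in Hd.
  change (Rabs (h s - h t - (s - t) * psi t) <= eps * Rabs (s - t)).
  rewrite (E s). replace (h t + psi s * (s - t) - h t - (s - t) * psi t)
    with ((psi s - psi t) * (s - t)) by ring.
  rewrite Rabs_mult. apply Rmult_le_compat_r; [apply Rabs_pos | lra].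
Qed.

Lemma diff_at_segment (f : C -> C) (a b l : C) (t : R) : diff_at f (a + t * b)%C l ->
  is_derive (fun s : R => fst (f (a + s * b)%C)) t (fst (l * b)%C) /\
  is_derive (fun s : R => snd (f (a + s * b)%C)) t (snd (l * b)%C).
Proof.
  intros [phi [Hc [<- E]]].
  assert (RC : rcont (fun s : R => phi (a + s * b) * b)%C t).
  { apply (rcont_path (fun w => phi w * b)%C (fun s : R => a + s * b)%C (Cmod b)).
    - intro s. replace (a + s * b - (a + t * b))%C with ((s - t) * b)%C by ring.
      rewrite <- RtoC_minus, Cmod_mult, Cmod_R. lra.
    - apply cont_at_mult; [exact Hc | apply cont_at_const]. }
  destruct RC as [RC1 RC2]. split.
  - apply (is_derive_caratheodory _ (fun s : R => fst (phi (a + s * b) * b)%C)); [exact RC1|].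
    intro s. rewrite (E (a + s * b)%C). simpl. ring.
  - apply (is_derive_caratheodory _ (fun s : R => snd (phi (a + s * b) * b)%C)); [exact RC2|].
    intro s. rewrite (E (a + s * b)%C). simpl. ring.
Qed.

(** Apply the real mean value theorem to the component of [h] in the direction of the
    increment; this loses no constant. *)
Lemma mean_value_bound (h h' : C -> C) (z : C) (M : R) :
  (forall w, diff_at h w (h' w)) ->
  (forall t : R, 0 <= t <= 1 -> Cmod (h' (t * z)%C) <= M) ->
  Cmod (h z - h 0)%C <= M * Cmod z.
Proof.
  intros Hd HM. set (D := (h z - h 0)%C).
  assert (HD := Cmod_ge_0 D).
  destruct (Req_dec (Cmod D) 0) as [E0|E0].
  { rewrite E0. apply Rmult_le_pos; [|apply Cmod_ge_0].
    eapply Rle_trans; [apply Cmod_ge_0 | apply (HM 0); lra]. }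
  destruct (mean_value (fun t : R => fst (Cconj D * h (0 + t * z))%C)
    (fun t : R => fst (Cconj D * h' (0 + t * z) * z)%C) 0 1) as [c [Hc1 Hc2]].
  { intros t _. apply (diff_at_segment (fun w => Cconj D * h w)%C 0 z), diff_at_scal, Hd. }
  rewrite Rmin_left, Rmax_right in Hc1 by lra.
  replace (0 + 1 * z)%C with z in Hc2 by ring. replace (0 + 0 * z)%C with (RtoC 0) in Hc2 by ring.
  assert (E : Cmod D * Cmod D = fst (Cconj D * h' (0 + c * z) * z)%C).
  { rewrite Cmod_sqr. rewrite Rminus_0_r, Rmult_1_r in Hc2. rewrite <- Hc2.
    unfold D. generalize (h z) (h 0). intros u v. simpl. ring. }
  apply Rmult_le_reg_l with (Cmod D); [lra|]. rewrite E.
  eapply Rle_trans; [apply Rle_abs|]. eapply Rle_trans; [apply fst_le_Cmod|].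
  rewrite !Cmod_mult, Cmod_conj. rewrite Rmult_assoc. apply Rmult_le_compat_l; [exact HD|].
  apply Rmult_le_compat_r; [apply Cmod_ge_0|].
  replace (0 + c * z)%C with (c * z)%C by ring. now apply HM.
Qed.

(** * Complex exponential and trigonometric functions *)

Definition cexp (z : C) : C := (exp (fst z) * cos (snd z), exp (fst z) * sin (snd z)).

Lemma cexp_plus (z w : C) : cexp (z + w)%C = (cexp z * cexp w)%C.
Proof.
  unfold cexp. apply injective_projections; simpl; rewrite exp_plus.
  - rewrite cos_plus. ring.
  - rewrite sin_plus. ring.
Qed.

Lemma cexp_0 : cexp 0 = 1.
Proof. unfold cexp. simpl. rewrite exp_0, cos_0, sin_0. apply injective_projections; simpl; ring. Qed.

Lemma cexp_opp_l (z : C) : (cexp (- z) * cexp z)%C = 1.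
Proof. rewrite <- cexp_plus. replace (- z + z)%C with (RtoC 0) by ring. apply cexp_0. Qed.

Lemma Cmod_cexp (z : C) : Cmod (cexp z) = exp (fst z).
Proof.
  assert (P := exp_pos (fst z)). apply Rsqr_inj; [apply Cmod_ge_0 | lra|].
  unfold Rsqr. rewrite Cmod_sqr. unfold cexp; simpl.
  generalize (sin2_cos2 (snd z)). unfold Rsqr. intro H.
  replace (exp (fst z) * exp (fst z)) with (exp (fst z) * exp (fst z) * 1) at 1 by ring.
  rewrite <- H. ring.
Qed.

Lemma exp_taylor1 (x : R) : Rabs x <= 1 / 2 -> Rabs (exp x - 1 - x) <= 2 * (x * x).
Proof.
  intro Hx. apply Rabs_le_between in Hx.
  assert (L := exp_ineq1_le x). assert (L' := exp_ineq1_le (- x)).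
  assert (E : exp x * exp (- x) = 1) by (rewrite <- exp_plus, Rplus_opp_r; apply exp_0).
  assert (P := exp_pos x).
  rewrite Rabs_pos_eq by lra.
  enough (exp x <= 1 + x + 2 * (x * x)) by lra.
  apply Rmult_le_reg_r with (1 - x); [lra|].
  apply Rle_trans with 1; [nra|].
  replace ((1 + x + 2 * (x * x)) * (1 - x)) with (1 + x * x * (1 - 2 * x)) by ring. nra.
Qed.

Lemma Rabs_between_0 (y c : R) : Rmin 0 y <= c <= Rmax 0 y -> Rabs c <= Rabs y.
Proof.
  unfold Rmin, Rmax. intro Hc. destruct (Rle_dec 0 y);
    [rewrite !Rabs_pos_eq; lra | rewrite !Rabs_left1; lra].
Qed.

Lemma Rsqr_Rabs (y : R) : Rabs y * Rabs y = y * y.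
Proof. rewrite <- Rabs_mult. apply Rabs_pos_eq, Rle_0_sqr. Qed.

Lemma Rabs_sin_le (y : R) : Rabs (sin y) <= Rabs y.
Proof.
  destruct (mean_value sin cos 0 y) as [c [_ E]].
  { intros t _. auto_derive; [easy | ring]. }
  rewrite sin_0, !Rminus_0_r in E. rewrite E, Rabs_mult.
  assert (Rabs (cos c) <= 1) by (apply Rabs_le; generalize (COS_bound c); lra).
  generalize (Rabs_pos y). nra.
Qed.

Lemma cos_taylor1 (y : R) : Rabs (cos y - 1) <= y * y.
Proof.
  destruct (mean_value cos (fun t => - sin t) 0 y) as [c [Hc E]].
  { intros t _. auto_derive; [easy | ring]. }
  rewrite cos_0, Rminus_0_r in E. rewrite E, Rabs_mult, Rabs_Ropp, <- (Rsqr_Rabs y).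
  apply Rmult_le_compat_r; [apply Rabs_pos|].
  eapply Rle_trans; [apply Rabs_sin_le | now apply Rabs_between_0].
Qed.

Lemma sin_taylor1 (y : R) : Rabs y <= 1 -> Rabs (sin y - y) <= y * y.
Proof.
  intro Hy. destruct (mean_value (fun t => sin t - t) (fun t => cos t - 1) 0 y) as [c [Hc E]].
  { intros t _. auto_derive; [easy | ring]. }
  rewrite sin_0, !Rminus_0_r in E. rewrite E, Rabs_mult, <- (Rsqr_Rabs y).
  apply Rmult_le_compat_r; [apply Rabs_pos|].
  apply Rabs_between_0 in Hc. eapply Rle_trans; [apply cos_taylor1|]. rewrite <- Rsqr_Rabs.
  generalize (Rabs_pos c). nra.
Qed.

Lemma cexp_taylor1 (h : C) : Cmod h <= 1 / 2 -> Cmod (cexp h - 1 - h)%C <= 10 * (Cmod h * Cmod h).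
Proof.
  intro Hh. destruct h as [x y].
  assert (X := fst_le_Cmod (x, y)). assert (Y := snd_le_Cmod (x, y)). simpl in X, Y.
  set (m := Cmod (x, y)) in *. assert (M := Cmod_ge_0 (x, y)). fold m in M.
  eapply Rle_trans; [apply Cmod_le_abs|]. simpl. clearbody m.
  assert (Ex := exp_taylor1 x ltac:(lra)).
  assert (Sy := sin_taylor1 y ltac:(lra)). assert (Cy := cos_taylor1 y).
  assert (Bs := Rabs_sin_le y).
  assert (X2 : x * x <= m * m).
  { rewrite <- (Rsqr_Rabs x). apply Rmult_le_compat; trivial; apply Rabs_pos. }
  assert (Y2 : y * y <= m * m).
  { rewrite <- (Rsqr_Rabs y). apply Rmult_le_compat; trivial; apply Rabs_pos. }
  assert (Bc : Rabs (cos y) <= 1) by (apply Rabs_le; generalize (COS_bound y); lra).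
  assert (E1 : exp x * cos y + - (1) + - x
    = (exp x - 1 - x) * cos y + (1 + x) * (cos y - 1)) by ring.
  assert (E2 : exp x * sin y + - 0 + - y = (exp x - 1 - x + x) * sin y + (sin y - y)) by ring.
  rewrite E1, E2.
  assert (A1 : Rabs ((exp x - 1 - x) * cos y) <= 2 * (m * m)).
  { rewrite Rabs_mult. generalize (Rabs_pos (exp x - 1 - x)) (Rabs_pos (cos y)). nra. }
  assert (A2 : Rabs ((1 + x) * (cos y - 1)) <= 2 * (m * m)).
  { rewrite Rabs_mult. assert (Rabs (1 + x) <= 2).
    { apply Rabs_le_between in X. apply Rabs_le. lra. }
    generalize (Rabs_pos (1 + x)) (Rabs_pos (cos y - 1)). nra. }
  assert (A3 : Rabs ((exp x - 1 - x + x) * sin y) <= 4 * (m * m)).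
  { rewrite Rabs_mult. assert (Rabs (exp x - 1 - x + x) <= 2 * m).
    { eapply Rle_trans; [apply Rabs_triang|]. nra. }
    generalize (Rabs_pos (exp x - 1 - x + x)) (Rabs_pos (sin y)). nra. }
  assert (T1 := Rabs_triang ((exp x - 1 - x) * cos y) ((1 + x) * (cos y - 1))).
  assert (T2 := Rabs_triang ((exp x - 1 - x + x) * sin y) (sin y - y)).
  assert (0 <= m * m) by nra. lra.
Qed.

Lemma diff_at_of_quadratic (f : C -> C) (z l : C) (K r : R) : 0 < r -> 0 < K ->
  (forall w, Cmod (w - z)%C <= r ->
     Cmod (f w - f z - l * (w - z))%C <= K * (Cmod (w - z)%C * Cmod (w - z)%C)) ->
  diff_at f z l.
Proof.
  intros Hr HK H. apply diff_at_of_little_o. intros eps He. exists (Rmin r (eps / K)).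
  split; [apply Rmin_pos; trivial; now apply Rdiv_lt_0_compat|].
  intros w Hw.
  assert (Hw1 := Rlt_le_trans _ _ _ Hw (Rmin_l _ _)).
  assert (Hw2 := Rlt_le_trans _ _ _ Hw (Rmin_r _ _)).
  eapply Rle_trans; [apply H; lra|]. rewrite <- Rmult_assoc.
  apply Rmult_le_compat_r; [apply Cmod_ge_0|].
  apply Rmult_lt_compat_l with (r := K) in Hw2; [|exact HK].
  replace (K * (eps / K)) with eps in Hw2 by (field; lra). lra.
Qed.

Lemma diff_at_cexp (z : C) : diff_at cexp z (cexp z).
Proof.
  assert (P : 0 < Cmod (cexp z)) by (rewrite Cmod_cexp; apply exp_pos).
  apply (diff_at_of_quadratic cexp z (cexp z) (10 * Cmod (cexp z)) (1 / 2)); [lra | lra|].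
  intros w Hw. replace (cexp w) with (cexp z * cexp (w - z))%C.
  2: { rewrite <- cexp_plus. f_equal. ring. }
  replace (cexp z * cexp (w - z) - cexp z - cexp z * (w - z))%C
    with (cexp z * (cexp (w - z) - 1 - (w - z)))%C by ring.
  rewrite Cmod_mult. assert (T := cexp_taylor1 _ Hw). nra.
Qed.

Lemma C2_nz : RtoC 2 <> 0.
Proof. intro E. apply RtoC_inj in E. lra. Qed.

Ltac cfield := field; repeat split; (apply C2_nz || apply Ci_nz).

Lemma Ci2 : (Ci * Ci)%C = (- (1))%C.
Proof. apply injective_projections; simpl; ring. Qed.

Lemma Cinv_2Ci : (/ (2 * Ci))%C = (/ 2 * - Ci)%C.
Proof. rewrite <- Ci_inv. cfield. Qed.

Definition ccos (q : C) : C := ((cexp (Ci * q) + cexp (- (Ci * q))) / 2)%C.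
Definition csin (q : C) : C := ((cexp (Ci * q) - cexp (- (Ci * q))) / (2 * Ci))%C.

Lemma diff_at_cexp_lin (a z : C) : diff_at (fun q => cexp (a * q)) z (a * cexp (a * z))%C.
Proof.
  replace (a * cexp (a * z))%C with (cexp (a * z) * (a * 1))%C by ring.
  apply (diff_at_comp (fun q => a * q)%C cexp); [|apply diff_at_cexp].
  apply diff_at_scal, diff_at_id.
Qed.

Lemma diff_at_ccos (z : C) : diff_at ccos z (- csin z)%C.
Proof.
  apply (diff_at_ext (fun q => / 2 * (cexp (Ci * q) + cexp (- Ci * q)))%C).
  { intro q. unfold ccos. replace (- Ci * q)%C with (- (Ci * q))%C by ring. cfield. }
  replace (- csin z)%C with (/ 2 * (Ci * cexp (Ci * z) + - Ci * cexp (- Ci * z)))%C.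
  - apply diff_at_scal, diff_at_plus; apply diff_at_cexp_lin.
  - unfold csin. replace (- Ci * z)%C with (- (Ci * z))%C by ring.
    generalize (cexp (Ci * z)) (cexp (- (Ci * z))). intros u v.
    unfold Cdiv. rewrite Cinv_2Ci. ring.
Qed.

Lemma diff_at_csin (z : C) : diff_at csin z (ccos z).
Proof.
  apply (diff_at_ext (fun q => / (2 * Ci) * (cexp (Ci * q) - cexp (- Ci * q)))%C).
  { intro q. unfold csin. replace (- Ci * q)%C with (- (Ci * q))%C by ring.
    unfold Cdiv. ring. }
  replace (ccos z) with (/ (2 * Ci) * (Ci * cexp (Ci * z) - - Ci * cexp (- Ci * z)))%C.
  - apply diff_at_scal, diff_at_minus; apply diff_at_cexp_lin.
  - unfold ccos. replace (- Ci * z)%C with (- (Ci * z))%C by ring.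
    cfield.
Qed.

Lemma ccos_opp (q : C) : ccos (- q) = ccos q.
Proof.
  unfold ccos. replace (Ci * - q)%C with (- (Ci * q))%C by ring.
  replace (- - (Ci * q))%C with (Ci * q)%C by ring. cfield.
Qed.

Lemma csin_opp (q : C) : csin (- q) = (- csin q)%C.
Proof.
  unfold csin. replace (Ci * - q)%C with (- (Ci * q))%C by ring.
  replace (- - (Ci * q))%C with (Ci * q)%C by ring. cfield.
Qed.

Lemma ccos_0 : ccos 0 = 1.
Proof.
  unfold ccos. replace (Ci * 0)%C with (RtoC 0) by ring. rewrite Copp_0, cexp_0.
  cfield.
Qed.

Lemma csin_0 : csin 0 = 0.
Proof.
  unfold csin. replace (Ci * 0)%C with (RtoC 0) by ring. rewrite Copp_0, cexp_0.
  unfold Cdiv. ring.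
Qed.

Lemma half_sum_cexp (p q : C) :
  exists u v u' v', (u * u' = 1 /\ v * v' = 1 /\
   cexp (Ci * p) = u * v /\ cexp (Ci * q) = u * v' /\
   cexp (- (Ci * p)) = u' * v' /\ cexp (- (Ci * q)) = u' * v /\
   cexp (Ci * ((p + q) / 2)) = u /\ cexp (- (Ci * ((p + q) / 2))) = u' /\
   cexp (Ci * ((p - q) / 2)) = v /\ cexp (- (Ci * ((p - q) / 2))) = v')%C.
Proof.
  exists (cexp (Ci * ((p + q) / 2)))%C, (cexp (Ci * ((p - q) / 2)))%C,
    (cexp (- (Ci * ((p + q) / 2))))%C, (cexp (- (Ci * ((p - q) / 2))))%C.
  split; [rewrite Cmult_comm; apply cexp_opp_l|].
  split; [rewrite Cmult_comm; apply cexp_opp_l|].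
  rewrite <- !cexp_plus. repeat split; f_equal; field; apply C2_nz.
Qed.

Lemma ccos_minus_ccos (p q : C) :
  (ccos p - ccos q)%C = (- (2) * csin ((p + q) / 2) * csin ((p - q) / 2))%C.
Proof.
  destruct (half_sum_cexp p q) as (u & v & u' & v' & _ & _ & E1 & E2 & E3 & E4 & E5 & E6 & E7 & E8).
  unfold ccos, csin. rewrite E1, E2, E3, E4, E5, E6, E7, E8.
  unfold Cdiv. rewrite Cinv_2Ci.
  replace (- (2) * ((u - u') * (/ 2 * - Ci)) * ((v - v') * (/ 2 * - Ci)))%C
    with (- (2) * (u - u') * (v - v') * / 2 * / 2 * (Ci * Ci))%C by ring.
  rewrite Ci2. cfield.
Qed.

Lemma csin_minus_csin (p q : C) :
  (csin p - csin q)%C = (2 * ccos ((p + q) / 2) * csin ((p - q) / 2))%C.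
Proof.
  destruct (half_sum_cexp p q) as (u & v & u' & v' & _ & _ & E1 & E2 & E3 & E4 & E5 & E6 & E7 & E8).
  unfold ccos, csin. rewrite E1, E2, E3, E4, E5, E6, E7, E8.
  cfield.
Qed.

Lemma ccos_components (a b : R) : ccos (a, b) = (cos a * cosh b, - (sin a * sinh b)).
Proof.
  unfold ccos, cexp, cosh, sinh. apply injective_projections; simpl.
  - replace (0 * a - 1 * b) with (- b) by ring. replace (0 * b + 1 * a) with a by ring.
    rewrite Ropp_involutive, cos_neg, sin_neg. field.
  - replace (0 * a - 1 * b) with (- b) by ring. replace (0 * b + 1 * a) with a by ring.
    rewrite Ropp_involutive, cos_neg, sin_neg. field.
Qed.

Lemma csin_components (a b : R) : csin (a, b) = (sin a * cosh b, cos a * sinh b).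
Proof.
  unfold csin, cexp, cosh, sinh. apply injective_projections; simpl.
  - replace (0 * a - 1 * b) with (- b) by ring. replace (0 * b + 1 * a) with a by ring.
    rewrite Ropp_involutive, cos_neg, sin_neg. field.
  - replace (0 * a - 1 * b) with (- b) by ring. replace (0 * b + 1 * a) with a by ring.
    rewrite Ropp_involutive, cos_neg, sin_neg. field.
Qed.

Lemma ccos_real (x : R) : ccos x = cos x.
Proof. unfold RtoC at 1. rewrite ccos_components, cosh_0, sinh_0.
  apply injective_projections; simpl; ring. Qed.

Lemma csin_real (x : R) : csin x = sin x.
Proof. unfold RtoC at 1. rewrite csin_components, cosh_0, sinh_0.
  apply injective_projections; simpl; ring. Qed.

Lemma exp_le (x y : R) : x <= y -> exp x <= exp y.
Proof. intros [H | ->]; [left; now apply exp_increasing | lra]. Qed.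

Lemma exp_le_abs (x : R) : exp x <= exp (Rabs x) /\ exp (- x) <= exp (Rabs x).
Proof. split; apply exp_le; [apply Rle_abs | rewrite <- Rabs_Ropp; apply Rle_abs]. Qed.

Lemma Cmod_ccos_le (q : C) : Cmod (ccos q) <= exp (Rabs (snd q)).
Proof.
  unfold ccos, Cdiv. rewrite Cmod_mult, Cmod_inv, Cmod_R, (Rabs_pos_eq 2) by (lra || apply C2_nz).
  destruct q as [a b]. assert (T := Cmod_triangle (cexp (Ci * (a, b))) (cexp (- (Ci * (a, b))))).
  rewrite !Cmod_cexp in T. simpl in *.
  replace (0 * a - 1 * b) with (- b) in T by ring. rewrite Ropp_involutive in T.
  destruct (exp_le_abs b). lra.
Qed.

Lemma Cmod_csin_le (q : C) : Cmod (csin q) <= exp (Rabs (snd q)).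
Proof.
  unfold csin, Cdiv. rewrite Cmod_mult, Cmod_inv, Cmod_mult, Cmod_R, Cmod_Ci, (Rabs_pos_eq 2).
  2: lra. 2: apply Cmult_neq_0; [apply C2_nz | apply Ci_nz].
  destruct q as [a b]. assert (T := Cmod_sub_le (cexp (Ci * (a, b))) (cexp (- (Ci * (a, b))))).
  rewrite !Cmod_cexp in T. simpl in *.
  replace (0 * a - 1 * b) with (- b) in T by ring. rewrite Ropp_involutive in T.
  destruct (exp_le_abs b). lra.
Qed.

(** * The entire functions [cos (sqrt v)] and [sin (sqrt v) / sqrt v] *)

Definition csinc (q : C) : C := if Ceq_dec q 0 then RtoC 1 else (csin q / q)%C.

Lemma csinc_0 : csinc 0 = 1.
Proof. unfold csinc. destruct (Ceq_dec 0 0); easy. Qed.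

Lemma mult_csinc (q : C) : (q * csinc q)%C = csin q.
Proof.
  unfold csinc. destruct (Ceq_dec q 0) as [->|H]; [rewrite csin_0; ring | field; exact H].
Qed.

Lemma csinc_opp (q : C) : csinc (- q) = csinc q.
Proof.
  unfold csinc. destruct (Ceq_dec q 0) as [->|H].
  - rewrite Copp_0. destruct (Ceq_dec 0 0); easy.
  - destruct (Ceq_dec (- q) 0) as [H'|H'].
    + exfalso. apply H. replace q with (- - q)%C by ring. rewrite H'. ring.
    + rewrite csin_opp. field. exact H.
Qed.

Lemma snd_scal_le (t : R) (z : C) : 0 <= t <= 1 -> Rabs (snd (t * z)%C) <= Rabs (snd z).
Proof.
  intro Ht. simpl. replace (t * snd z + 0 * fst z) with (t * snd z) by ring.
  rewrite Rabs_mult, (Rabs_pos_eq t) by lra. generalize (Rabs_pos (snd z)). nra.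
Qed.

Lemma Cmod_csin_le_mult (q : C) : Cmod (csin q) <= exp (Rabs (snd q)) * Cmod q.
Proof.
  replace (csin q) with (csin q - csin 0)%C by (rewrite csin_0; ring).
  apply (mean_value_bound csin ccos); [apply diff_at_csin|].
  intros t Ht. eapply Rle_trans; [apply Cmod_ccos_le|]. now apply exp_le, snd_scal_le.
Qed.

Lemma Cmod_csinc_le (q : C) : Cmod (csinc q) <= exp (Rabs (snd q)).
Proof.
  unfold csinc. destruct (Ceq_dec q 0) as [->|H].
  - rewrite Cmod_1. simpl. rewrite Rabs_R0, exp_0. lra.
  - unfold Cdiv. rewrite Cmod_mult, Cmod_inv by exact H. apply Cmod_gt_0 in H.
    apply Rmult_le_reg_r with (Cmod q); [exact H|].
    rewrite Rmult_assoc, Rinv_l, Rmult_1_r by lra. apply Cmod_csin_le_mult.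
Qed.

(** [csinc] is the difference quotient of [csin] at 0. *)
Lemma cont_at_csinc (q : C) : cont_at csinc q.
Proof.
  destruct (Ceq_dec q 0) as [->|H0].
  - destruct (diff_at_csin 0) as [phi [Hc [E0 E]]].
    apply (cont_at_ext phi); [|exact Hc]. intro w. unfold csinc.
    destruct (Ceq_dec w 0) as [->|Hw]; [now rewrite E0, ccos_0|].
    rewrite (E w), csin_0. field. exact Hw.
  - apply Cmod_gt_0 in H0 as Hp.
    apply (cont_at_local (fun q => csin q / q)%C csinc q (Cmod q)); [exact Hp| |].
    + intros w Hw. unfold csinc. destruct (Ceq_dec w 0) as [->|]; [|reflexivity].
      exfalso. rewrite Cmod_sub_sym in Hw. replace (q - 0)%C with q in Hw by ring. lra.
    + apply (cont_at_div csin (fun q => q)); [|apply cont_at_id | exact H0].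
      eapply diff_at_cont, diff_at_csin.
Qed.

Definition csqrt (v : C) : C :=
  (sqrt ((Cmod v + fst v) / 2),
   if Rlt_dec (snd v) 0 then - sqrt ((Cmod v - fst v) / 2) else sqrt ((Cmod v - fst v) / 2)).

Lemma csqrt_sq (v : C) : (csqrt v * csqrt v)%C = v.
Proof.
  destruct v as [x y]. unfold csqrt. simpl fst; simpl snd.
  assert (M := Cmod_sqr (x, y)). simpl in M.
  assert (X := fst_le_Cmod (x, y)). simpl in X. apply Rabs_le_between in X.
  set (m := Cmod (x, y)) in *. clearbody m.
  set (a := sqrt ((m + x) / 2)). set (b := sqrt ((m - x) / 2)).
  assert (Ha : a * a = (m + x) / 2) by (apply sqrt_sqrt; lra).
  assert (Hb : b * b = (m - x) / 2) by (apply sqrt_sqrt; lra).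
  assert (Hab : 2 * (a * b) = Rabs y).
  { unfold a, b. rewrite <- sqrt_mult by lra.
    replace ((m + x) / 2 * ((m - x) / 2)) with (Rsqr (y / 2)) by (unfold Rsqr; nra).
    rewrite sqrt_Rsqr_abs. unfold Rdiv. rewrite Rabs_mult, (Rabs_pos_eq (/ 2)) by lra. lra. }
  destruct (Rlt_dec y 0) as [H|H]; apply injective_projections; simpl.
  - lra.
  - rewrite Rabs_left in Hab; lra.
  - lra.
  - rewrite Rabs_pos_eq in Hab; lra.
Qed.

Lemma Csqr_eq (p q : C) : (p * p)%C = (q * q)%C -> p = q \/ p = (- q)%C.
Proof.
  intro E. destruct (Ceq_dec (p - q)%C 0) as [H|H]; [left; apply Ceq_minus, H|].
  right. apply Ceq_minus. destruct (Ceq_dec (p - - q)%C 0) as [H'|H']; [exact H'|].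
  exfalso. apply (Cmult_neq_0 _ _ H H').
  replace ((p - q) * (p - - q))%C with (p * p - q * q)%C by ring. rewrite E. ring.
Qed.

Definition ccos_sqrt (v : C) : C := ccos (csqrt v).
Definition csinc_sqrt (v : C) : C := csinc (csqrt v).

Lemma ccos_sqrt_sq (q : C) : ccos_sqrt (q * q) = ccos q.
Proof.
  unfold ccos_sqrt. destruct (Csqr_eq _ _ (csqrt_sq (q * q)%C)) as [-> | ->]; [reflexivity | apply ccos_opp].
Qed.

Lemma csinc_sqrt_sq (q : C) : csinc_sqrt (q * q) = csinc q.
Proof.
  unfold csinc_sqrt. destruct (Csqr_eq _ _ (csqrt_sq (q * q)%C)) as [-> | ->]; [reflexivity | apply csinc_opp].
Qed.

Lemma mult_csinc_sqrt_sq (q : C) : (q * q * csinc_sqrt (q * q))%C = (q * csin q)%C.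
Proof. rewrite csinc_sqrt_sq, <- mult_csinc. ring. Qed.

(** The choice of the root nearest to [q] is continuous at [q^2], also for [q = 0], whereas no
    branch of the square root is continuous in a neighbourhood of 0. *)
Definition near_root (q v : C) : C :=
  if Rle_dec (Cmod (csqrt v - q)%C) (Cmod (csqrt v + q)%C) then csqrt v else (- csqrt v)%C.

Lemma near_root_sq (q v : C) : (near_root q v * near_root q v)%C = v.
Proof.
  rewrite <- (csqrt_sq v) at 3. unfold near_root. destruct (Rle_dec _ _); ring.
Qed.

(** [v - q^2 = (r - q)(r + q)], and the nearest root [r] makes the first factor the smaller. *)
Lemma near_root_dist (q v : C) :
  Cmod (near_root q v - q)%C * Cmod (near_root q v - q)%C <= Cmod (v - q * q)%C.
Proof.
  assert (H : Cmod (near_root q v - q)%C <= Cmod (near_root q v + q)%C).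
  { unfold near_root. destruct (Rle_dec _ _) as [H|H]; [exact H|].
    replace (- csqrt v - q)%C with (- (csqrt v + q))%C by ring.
    replace (- csqrt v + q)%C with (- (csqrt v - q))%C by ring. rewrite !Cmod_opp. lra. }
  rewrite <- (near_root_sq q v) at 3.
  replace (near_root q v * near_root q v - q * q)%C
    with ((near_root q v - q) * (near_root q v + q))%C by ring.
  rewrite Cmod_mult. apply Rmult_le_compat_l; [apply Cmod_ge_0 | exact H].
Qed.

Lemma near_root_base (q : C) : near_root q (q * q) = q.
Proof.
  apply Ceq_minus, Cmod_eq_0. assert (H := near_root_dist q (q * q)%C).
  replace (q * q - q * q)%C with (RtoC 0) in H by ring. rewrite Cmod_0 in H.
  generalize (Cmod_ge_0 (near_root q (q * q) - q)%C). nra.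
Qed.

Lemma cont_at_near_root (q : C) : cont_at (near_root q) (q * q)%C.
Proof.
  intros eps He. exists (eps * eps). split; [nra|]. intros w Hw. rewrite near_root_base.
  assert (H := near_root_dist q w). generalize (Cmod_ge_0 (near_root q w - q)%C). nra.
Qed.

(** With [r] the root of [w] nearest to [q], the difference [cos r - cos q] is
    [- 2 sin ((r + q) / 2) sin ((r - q) / 2)], and [w - q^2 = (r + q) (r - q)]; the slope is
    therefore a product of two values of [csinc]. *)
Lemma diff_at_ccos_sqrt (v : C) : diff_at ccos_sqrt v (- (/ 2) * csinc_sqrt v)%C.
Proof.
  rewrite <- (csqrt_sq v). set (q := csqrt v). clearbody q.
  exists (fun w => - (/ 2) * (csinc ((near_root q w + q) / 2) * csinc ((near_root q w - q) / 2)))%C.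
  assert (C1 := cont_at_near_root q).
  split; [|split].
  - apply cont_at_scal, cont_at_mult.
    + apply (cont_at_comp (fun w => (near_root q w + q) / 2)%C csinc); [|apply cont_at_csinc].
      apply cont_at_mult; [|apply cont_at_const]. apply cont_at_plus; [exact C1 | apply cont_at_const].
    + apply (cont_at_comp (fun w => (near_root q w - q) / 2)%C csinc); [|apply cont_at_csinc].
      apply cont_at_mult; [|apply cont_at_const]. apply cont_at_minus; [exact C1 | apply cont_at_const].
  - rewrite near_root_base, csinc_sqrt_sq.
    replace ((q + q) / 2)%C with q by cfield. replace ((q - q) / 2)%C with (RtoC 0) by cfield.
    rewrite csinc_0. ring.
  - intro w. rewrite <- (near_root_sq q w) at 1 4. set (r := near_root q w). rewrite !ccos_sqrt_sq.
    replace (ccos r) with (ccos q + (ccos r - ccos q))%C by ring.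
    rewrite ccos_minus_ccos, <- !mult_csinc. cfield.
Qed.

Lemma cont_at_csinc_sqrt (v : C) : cont_at csinc_sqrt v.
Proof.
  rewrite <- (csqrt_sq v). set (q := csqrt v). clearbody q.
  apply (cont_at_ext (fun w => csinc (near_root q w))).
  - intro w. rewrite <- (csinc_sqrt_sq (near_root q w)), near_root_sq. reflexivity.
  - apply (cont_at_comp (near_root q) csinc); [apply cont_at_near_root | apply cont_at_csinc].
Qed.

(** As for [ccos_sqrt], now with [r sin r - q sin q]; here the slope has the denominator
    [r + q], which vanishes only away from [q^2] when [q <> 0]. *)
Lemma diff_at_mult_csinc_sqrt (v : C) : diff_at (fun v => v * csinc_sqrt v)%C v (/ 2 * (csinc_sqrt v + ccos_sqrt v))%C.
Proof.
  destruct (Ceq_dec v 0) as [->|Hv].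
  { exists csinc_sqrt. split; [apply cont_at_csinc_sqrt|]. split; [|intro w; ring].
    replace (RtoC 0) with (0 * 0)%C by ring. rewrite csinc_sqrt_sq, ccos_sqrt_sq, csinc_0, ccos_0. cfield. }
  revert Hv. rewrite <- (csqrt_sq v). set (q := csqrt v). clearbody q. intro Hq2.
  assert (Hq : q <> 0) by (intros ->; apply Hq2; ring).
  assert (H2q : (q + q)%C <> 0).
  { replace (q + q)%C with (2 * q)%C by ring. apply Cmult_neq_0; [apply C2_nz | exact Hq]. }
  exists (fun w => let r := near_root q w in
    if Ceq_dec (r + q) 0 then (r * csin r - q * csin q) / (w - q * q) else
    (csin r + q * ccos ((r + q) / 2) * csinc ((r - q) / 2)) / (r + q))%C.
  assert (C1 := cont_at_near_root q).
  assert (CS : cont_at (fun w => csin (near_root q w)) (q * q)%C).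
  { apply (cont_at_comp (near_root q) csin); [exact C1 | eapply diff_at_cont, diff_at_csin]. }
  split; [|split].
  - apply Cmod_gt_0 in Hq as Hp.
    destruct (C1 (Cmod q) Hp) as (dl & Hdl & Hw).
    apply (cont_at_local (fun w => (csin (near_root q w) + q * ccos ((near_root q w + q) / 2)
        * csinc ((near_root q w - q) / 2)) / (near_root q w + q))%C _ _ dl Hdl).
    + intros w Hwd. specialize (Hw w Hwd). rewrite near_root_base in Hw. simpl.
      destruct (Ceq_dec (near_root q w + q)%C 0) as [E|]; [exfalso|reflexivity].
      replace (near_root q w - q)%C with (- (q + q))%C in Hw.
      2: { replace (near_root q w) with (near_root q w + q - q)%C by ring. rewrite E. ring. }
      rewrite Cmod_opp in Hw. replace (q + q)%C with (2 * q)%C in Hw by ring.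
      rewrite Cmod_mult, Cmod_R, (Rabs_pos_eq 2) in Hw by lra. lra.
    + apply cont_at_div.
      * apply cont_at_plus; [exact CS|]. apply cont_at_mult; [apply cont_at_scal|].
        -- apply (cont_at_comp (fun w => (near_root q w + q) / 2)%C ccos).
           ++ apply cont_at_mult; [|apply cont_at_const].
              apply cont_at_plus; [exact C1 | apply cont_at_const].
           ++ eapply diff_at_cont, diff_at_ccos.
        -- apply (cont_at_comp (fun w => (near_root q w - q) / 2)%C csinc); [|apply cont_at_csinc].
           apply cont_at_mult; [|apply cont_at_const].
           apply cont_at_minus; [exact C1 | apply cont_at_const].
      * apply cont_at_plus; [exact C1 | apply cont_at_const].
      * rewrite near_root_base. exact H2q.
  - simpl. rewrite near_root_base, csinc_sqrt_sq, ccos_sqrt_sq. destruct (Ceq_dec (q + q) 0); [easy|].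
    replace ((q + q) / 2)%C with q by cfield. replace ((q - q) / 2)%C with (RtoC 0) by cfield.
    rewrite csinc_0, <- mult_csinc. field; repeat split; first [exact H2q | apply C2_nz].
  - intro w. cbv zeta.
    assert (Ew := near_root_sq q w). set (r := near_root q w) in *. clearbody r.
    rewrite <- Ew. rewrite !mult_csinc_sqrt_sq.
    destruct (Ceq_dec (r + q) 0) as [E|E].
    + assert (r = - q)%C as -> by (replace r with (r + q - q)%C by ring; rewrite E; ring).
      rewrite csin_opp. replace (- q * - q - q * q)%C with (RtoC 0) by ring. ring.
    + replace (r * r - q * q)%C with ((r - q) * (r + q))%C by ring.
      replace (r * csin r)%C with (q * csin q + (r - q) * csin r + q * (csin r - csin q))%C by ring.
      rewrite csin_minus_csin, <- (mult_csinc ((r - q) / 2)%C).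
      field; repeat split; first [exact E | apply C2_nz].
Qed.

(** The derivative of [ccos_sqrt] at 0 says that [cos q = 1 - q^2/2 + o(q^2)];
    integrating once gives the expansion of the sine. *)
Lemma csinc_little_o (eps : R) : 0 < eps -> exists delta, 0 < delta /\
  forall q, Cmod q * Cmod q < delta ->
    Cmod (csinc q - 1 + / 6 * (q * q))%C <= eps * (Cmod q * Cmod q).
Proof.
  intro He. destruct (diff_at_little_o ccos_sqrt 0 _ (diff_at_ccos_sqrt 0) eps He) as (d & Hd & Hw).
  assert (Ez : RtoC 0 = (0 * 0)%C) by ring.
  assert (S0 : csinc_sqrt 0 = 1) by (rewrite Ez, csinc_sqrt_sq; apply csinc_0).
  assert (C0 : ccos_sqrt 0 = 1) by (rewrite Ez, ccos_sqrt_sq; apply ccos_0).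
  assert (N6 : RtoC 6 <> 0) by (intro E; apply RtoC_inj in E; lra).
  exists d. split; [exact Hd|]. intros q Hq.
  destruct (Ceq_dec q 0) as [->|H0].
  { rewrite csinc_0, Cmod_0. replace (1 - 1 + / 6 * (0 * 0))%C with (RtoC 0) by ring.
    rewrite Cmod_0. lra. }
  assert (B : Cmod (csin q - q + / 6 * (q * q * q) - (csin 0 - 0 + / 6 * (0 * 0 * 0)))%C
      <= eps * (Cmod q * Cmod q) * Cmod q).
  { apply (mean_value_bound (fun w => csin w - w + / 6 * (w * w * w))%C
      (fun w => ccos w - 1 + / 6 * ((1 * w + w * 1) * w + w * w * 1))%C).
    - intro w. apply diff_at_plus.
      + apply diff_at_minus; [apply diff_at_csin | apply diff_at_id].
      + apply diff_at_scal, (diff_at_mult (fun w => w * w)%C (fun w => w)); [|apply diff_at_id].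
        apply diff_at_mult; apply diff_at_id.
    - intros t Ht. set (w := (t * q)%C).
      assert (Hwq : Cmod (w * w)%C <= Cmod q * Cmod q).
      { unfold w. rewrite !Cmod_mult, Cmod_R, Rabs_pos_eq by lra.
        assert (Cmod q * Cmod q * (t * t) <= Cmod q * Cmod q * 1)
          by (apply Rmult_le_compat_l; [apply Rle_0_sqr | nra]). lra. }
      assert (Hw2 := Hw (w * w)%C). replace (w * w - 0)%C with (w * w)%C in Hw2 by ring.
      rewrite ccos_sqrt_sq, C0, S0 in Hw2.
      replace (ccos w - 1 + / 6 * ((1 * w + w * 1) * w + w * w * 1))%C
        with (ccos w - 1 - - / 2 * 1 * (w * w))%C.
      + eapply Rle_trans; [apply Hw2; lra|]. apply Rmult_le_compat_l; lra.
      + replace (/ 6 * ((1 * w + w * 1) * w + w * w * 1))%C with (3 * / 6 * (w * w))%C.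
        * replace (3 * / 6)%C with (/ 2)%C; [ring|]. apply injective_projections; simpl; field.
        * replace (RtoC 3) with (1 + 1 + 1)%C; [ring|]. apply injective_projections; simpl; ring. }
  apply Cmod_gt_0 in H0 as Hp. apply Rmult_le_reg_r with (Cmod q); [exact Hp|].
  eapply Rle_trans; [|exact B]. rewrite <- Cmod_mult. right. f_equal.
  rewrite csin_0, <- mult_csinc. ring.
Qed.

Lemma holo_csinc_sqrt (v : C) : holo csinc_sqrt v.
Proof.
  destruct (Ceq_dec v 0) as [->|Hv].
  - exists (- / 6)%C. apply diff_at_of_little_o. intros eps He.
    destruct (csinc_little_o eps He) as (d & Hd & Hw). exists d. split; [exact Hd|].
    intro w. replace (w - 0)%C with w by ring. rewrite <- (csqrt_sq w). set (q := csqrt w).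
    rewrite Cmod_mult. intro Hq. replace (RtoC 0) with (0 * 0)%C by ring. rewrite !csinc_sqrt_sq, csinc_0.
    replace (csinc q - 1 - - / 6 * (q * q))%C with (csinc q - 1 + / 6 * (q * q))%C by ring.
    now apply Hw.
  - apply Cmod_gt_0 in Hv as Hp.
    assert (H : holo (fun w => (w * csinc_sqrt w) / w)%C v).
    { apply holo_div; [eexists; apply diff_at_mult_csinc_sqrt | apply holo_id | exact Hv]. }
    destruct H as [l H]. exists l. apply diff_at_of_little_o. intros eps He.
    destruct (diff_at_little_o _ _ _ H eps He) as (dl & Hdl & Hw).
    exists (Rmin dl (Cmod v)). split; [now apply Rmin_pos|]. intros w Hwd.
    assert (H1 := Rlt_le_trans _ _ _ Hwd (Rmin_l _ _)).
    assert (H2 := Rlt_le_trans _ _ _ Hwd (Rmin_r _ _)).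
    assert (Hw0 : w <> 0).
    { intros ->. rewrite Cmod_sub_sym in H2. replace (v - 0)%C with v in H2 by ring. lra. }
    assert (X : forall u : C, u <> 0 -> csinc_sqrt u = (u * csinc_sqrt u / u)%C) by (intros u Hu; field; exact Hu).
    rewrite (X w Hw0), (X v Hv). now apply Hw.
Qed.

Lemma holo_ccos_sqrt (v : C) : holo ccos_sqrt v.
Proof. eexists. apply diff_at_ccos_sqrt. Qed.

Lemma ccos_sqrt_pos (q : R) : ccos_sqrt (RtoC (q * q)) = cos q.
Proof. rewrite RtoC_mult, ccos_sqrt_sq. apply ccos_real. Qed.

Lemma mult_csinc_sqrt_pos (q : R) : (RtoC (q * q) * csinc_sqrt (RtoC (q * q)))%C = RtoC (q * sin q).
Proof. now rewrite !RtoC_mult, mult_csinc_sqrt_sq, csin_real. Qed.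

Lemma neg_sq (w : R) : RtoC (- (w * w)) = ((0, w) * (0, w))%C.
Proof. apply injective_projections; simpl; ring. Qed.

Lemma ccos_sqrt_neg (w : R) : ccos_sqrt (RtoC (- (w * w))) = cosh w.
Proof.
  rewrite neg_sq, ccos_sqrt_sq, ccos_components, cos_0, sin_0.
  apply injective_projections; simpl; ring.
Qed.

Lemma mult_csinc_sqrt_neg (w : R) : (RtoC (- (w * w)) * csinc_sqrt (RtoC (- (w * w))))%C = RtoC (- (w * sinh w)).
Proof.
  rewrite neg_sq, mult_csinc_sqrt_sq, csin_components, cos_0, sin_0.
  apply injective_projections; simpl; ring.
Qed.

Lemma csinc_sqrt_0 : csinc_sqrt 0 = 1.
Proof. replace (RtoC 0) with (0 * 0)%C by ring. rewrite csinc_sqrt_sq. apply csinc_0. Qed.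

Lemma csinc_sqrt_div (v s : R) : v <> 0 -> (RtoC v * csinc_sqrt (RtoC v))%C = RtoC s -> csinc_sqrt (RtoC v) = RtoC (s / v).
Proof.
  intros Hv E. assert (Hv' : RtoC v <> 0) by (intro H; apply Hv, RtoC_inj, H).
  rewrite RtoC_div, <- E by exact Hv. field. exact Hv'.
Qed.

(** * The Phragmen-Lindelof principle *)

Lemma bounded_on_segment (g : R -> C) (a b : R) :
  (forall t, rcont g t) -> exists K, forall t, a <= t <= b -> Cmod (g t) <= K.
Proof.
  intro Hg.
  destruct (bounded_continuity (V := R_NormedModule) (fun t => fst (g t)) a b) as [K1 H1].
  { intros t _. apply Hg. }
  destruct (bounded_continuity (V := R_NormedModule) (fun t => snd (g t)) a b) as [K2 H2].
  { intros t _. apply Hg. }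
  exists (K1 + K2). intros t Ht. eapply Rle_trans; [apply Cmod_le_abs|].
  specialize (H1 t Ht). specialize (H2 t Ht).
  change (Rabs (fst (g t)) < K1) in H1. change (Rabs (snd (g t)) < K2) in H2. lra.
Qed.

Lemma cos_ge_half (t : R) : Rabs t <= PI / 3 -> 1 / 2 <= cos t.
Proof.
  intro Ht. assert (P := PI_RGT_0).
  replace (cos t) with (cos (Rabs t)).
  - rewrite <- cos_PI3. apply cos_decr_1; generalize (Rabs_pos t); lra.
  - unfold Rabs. destruct (Rcase_abs t); [apply cos_neg | reflexivity].
Qed.

Lemma polar_sector (x y : R) : Rabs y < x ->
  exists t th, - (PI / 4) < th < PI / 4 /\ cexp (t, th) = (x, y).
Proof.
  intro H. apply Rabs_lt_between in H as H'.
  assert (Hx : 0 < x) by (generalize (Rabs_pos y); lra).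
  exists (ln (sqrt (x * x + y * y))), (atan (y / x)). split.
  - rewrite <- atan_1. rewrite <- atan_opp.
    split; apply atan_increasing; apply Rmult_lt_reg_r with x; trivial;
      unfold Rdiv; rewrite Rmult_assoc, Rinv_l; lra.
  - unfold cexp. simpl fst; simpl snd.
    assert (S : 0 < x * x + y * y) by nra.
    rewrite exp_ln by (apply sqrt_lt_R0; exact S).
    rewrite cos_atan, sin_atan.
    assert (E : sqrt (x * x + y * y) = x * sqrt (1 + (y / x) ^ 2)).
    { replace (x * x + y * y) with (Rsqr x * (1 + (y / x) ^ 2)) by (unfold Rsqr; field; lra).
      rewrite sqrt_mult, sqrt_Rsqr; try lra; [apply Rle_0_sqr | nra]. }
    assert (Q : 0 < sqrt (1 + (y / x) ^ 2)) by (apply sqrt_lt_R0; nra).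
    rewrite E. unfold Rsqr. replace (y / x * (y / x)) with ((y / x) ^ 2) by ring.
    f_equal; field; lra.
Qed.

(** In the coordinate [z = exp zeta] the sector is a horizontal strip. The factor
    [exp(- d * exp(4 zeta / 3))] beats exponential growth in [z], because
    [cos(4 theta / 3) >= 1/2] on the strip; then [d] tends to 0. *)
Theorem phragmen_lindelof_sector (F : C -> C) (K r B : R) :
  (forall z, holo F z) -> 0 <= K ->
  (forall z, r <= Cmod z -> Cmod (F z) <= exp (K * Cmod z)) ->
  (forall t, 0 <= t -> Cmod (F (t, t)) <= B /\ Cmod (F (t, - t)) <= B) ->
  exists B', forall x y, Rabs y <= x -> Cmod (F (x, y)) <= B'.
Proof.
  intros HF HK Hr HB.
  destruct (holo_cont _ _ (HF 0) 1 Rlt_0_1) as (d0 & Hd0 & H0).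
  assert (HB0 : 0 <= B) by (eapply Rle_trans; [apply Cmod_ge_0 | apply (HB 0); lra]).
  set (B' := B + Cmod (F 0) + 1). assert (P0 := Cmod_ge_0 (F 0)).
  assert (HB' : 1 <= B') by (unfold B'; lra).
  exists B'. intros x y Hxy.
  assert (Ex : Rabs y = x \/ Rabs y < x) by lra. destruct Ex as [E|Hlt].
  { assert (Hx : 0 <= x) by (rewrite <- E; apply Rabs_pos).
    destruct (Rle_dec 0 y) as [Hy|Hy].
    - rewrite Rabs_pos_eq in E by lra. subst y. destruct (HB x Hx). unfold B'. lra.
    - rewrite Rabs_left in E by lra. replace y with (- x) by lra.
      destruct (HB x Hx). unfold B'. lra. }
  destruct (polar_sector x y Hlt) as (t0 & th0 & Hth & Ez). rewrite <- Ez.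
  assert (P := PI_RGT_0).
  assert (Key : forall d, 0 < d ->
     Cmod (F (cexp (t0, th0))) <= B' * exp (d * exp (4 / 3 * t0))).
  { intros d Hd.
    set (H := fun z => (F (cexp z) * cexp (- d * cexp (4 / 3 * z)))%C).
    assert (HH : forall z, holo H z).
    { intro z. unfold H.
      assert (HE : forall z, holo cexp z) by (intro; eexists; apply diff_at_cexp).
      apply holo_mult; [now apply holo_comp|].
      apply (holo_comp (fun w => - d * cexp (4 / 3 * w))%C cexp); [|apply HE].
      apply holo_scal. apply (holo_comp (fun w => 4 / 3 * w)%C cexp); [|apply HE].
      apply holo_scal, holo_id. }
    assert (MH : forall t th, Cmod (H (t, th))
       = Cmod (F (cexp (t, th))) * exp (- d * (exp (4 / 3 * t) * cos (4 / 3 * th)))).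
    { intros t th. unfold H. rewrite Cmod_mult, Cmod_cexp.
      replace (4 / 3 * (t, th))%C with (4 / 3 * t, 4 / 3 * th).
      2: { rewrite <- RtoC_div by lra. apply injective_projections; simpl; ring. }
      do 2 f_equal. unfold cexp. simpl. ring. }
    assert (Cos : forall th, - (PI / 4) <= th <= PI / 4 -> 1 / 2 <= cos (4 / 3 * th)).
    { intros th Hth'. apply cos_ge_half, Rabs_le. lra. }
    set (T := Rabs t0 + 1 + Rabs r + / d0 + 6 * K / d).
    assert (Q1 := Rabs_pos t0). assert (Q2 := Rabs_pos r).
    assert (Q3 : 0 < / d0) by now apply Rinv_0_lt_compat.
    assert (Q4 : 0 <= 6 * K / d) by (apply Rmult_le_pos; [lra | left; now apply Rinv_0_lt_compat]).
    assert (Bd : Cmod (H (t0, th0)) <= B').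
    { apply (maximum_modulus_rect H (t0, th0) (- T) T (- (PI / 4)) (PI / 4)); simpl; try lra.
      - unfold T. assert (A := Rle_abs t0). assert (A' := Rle_abs (- t0)).
        rewrite Rabs_Ropp in A'. lra.
      - intros u v _ _. apply HH.
      - assert (Damp : forall t th, - (PI / 4) <= th <= PI / 4 ->
          Cmod (H (t, th)) <= Cmod (F (cexp (t, th))) * exp (- (d / 2) * exp (4 / 3 * t))).
        { intros t th Hth'. rewrite MH. apply Rmult_le_compat_l; [apply Cmod_ge_0|].
          apply exp_le. specialize (Cos th Hth'). assert (E := exp_pos (4 / 3 * t)).
          assert (exp (4 / 3 * t) * (1 / 2) <= exp (4 / 3 * t) * cos (4 / 3 * th))
            by (apply Rmult_le_compat_l; lra). nra. }
        assert (Damp' : forall t th, - (PI / 4) <= th <= PI / 4 ->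
          Cmod (H (t, th)) <= Cmod (F (cexp (t, th)))).
        { intros t th Hth'. eapply Rle_trans; [now apply Damp|].
          rewrite <- (Rmult_1_r (Cmod (F (cexp (t, th))))) at 2.
          apply Rmult_le_compat_l; [apply Cmod_ge_0|].
          rewrite <- exp_0. apply exp_le. assert (E := exp_pos (4 / 3 * t)). nra. }
        assert (PT : forall t, 0 <= exp t * (1 / sqrt 2)).
        { intro t. apply Rmult_le_pos; [left; apply exp_pos | left; apply Rdiv_lt_0_compat;
            [lra | apply sqrt_lt_R0; lra]]. }
        split.
        + intros t _. split; (eapply Rle_trans; [apply Damp'; lra|]);
          unfold cexp; simpl; rewrite ?cos_neg, ?sin_neg, cos_PI4, sin_PI4;
          rewrite ?Ropp_mult_distr_r_reverse;
          destruct (HB (exp t * (1 / sqrt 2)) (PT t)) as [H1 H2]; unfold B'; lra.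
        + intros th Hth'. split.
          * eapply Rle_trans; [now apply Damp'|].
            assert (N : Cmod (F (cexp ((- T)%R, th)) - F 0)%C < 1).
            { apply H0. replace (cexp ((- T)%R, th) - 0)%C with (cexp ((- T)%R, th)) by ring.
              rewrite Cmod_cexp. simpl. rewrite exp_Ropp.
              rewrite <- (Rinv_inv d0). apply Rinv_lt_contravar.
              - apply Rmult_lt_0_compat; [exact Q3 | apply exp_pos].
              - apply Rlt_le_trans with T; [unfold T; lra|].
                generalize (exp_ineq1_le T). lra. }
            assert (N' := Cmod_sub_ge (F (cexp ((- T)%R, th))) (F 0)). unfold B'. lra.
          * eapply Rle_trans; [now apply Damp|].
            apply Rle_trans with 1; [|exact HB'].
            assert (M : Cmod (cexp (T, th)) = exp T) by apply Cmod_cexp.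
            assert (ET := exp_ineq1_le T).
            eapply Rle_trans; [apply Rmult_le_compat_r; [left; apply exp_pos | apply Hr]|].
            -- rewrite M. generalize (Rle_abs r). unfold T in *. lra.
            -- rewrite M, <- exp_plus, <- exp_0. apply exp_le.
               replace (4 / 3 * T) with (T + T / 3) by field. rewrite exp_plus.
               assert (ET3 := exp_ineq1_le (T / 3)). assert (PeT := exp_pos T).
               assert (2 * K / d <= exp (T / 3)).
               { apply Rle_trans with (T / 3); [|lra]. unfold T. lra. }
               assert (K <= d / 2 * exp (T / 3)).
               { apply Rmult_le_compat_l with (r := d / 2) in H1; [|lra].
                 replace (d / 2 * (2 * K / d)) with K in H1 by (field; lra). exact H1. }
               nra. }
    rewrite MH in Bd.
    assert (E1 := exp_pos (- d * (exp (4 / 3 * t0) * cos (4 / 3 * th0)))).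
    assert (E2 : exp (- d * (exp (4 / 3 * t0) * cos (4 / 3 * th0)))
      * exp (d * (exp (4 / 3 * t0) * cos (4 / 3 * th0))) = 1).
    { rewrite <- exp_plus. replace (- d * _ + _) with 0 by ring. apply exp_0. }
    apply Rle_trans with (B' * exp (d * (exp (4 / 3 * t0) * cos (4 / 3 * th0)))).
    - assert (E3 := exp_pos (d * (exp (4 / 3 * t0) * cos (4 / 3 * th0)))).
      apply Rmult_le_compat_r with (r := exp (d * (exp (4 / 3 * t0) * cos (4 / 3 * th0)))) in Bd; [|lra].
      rewrite Rmult_assoc, E2, Rmult_1_r in Bd. exact Bd.
    - apply Rmult_le_compat_l; [lra|]. apply exp_le.
      apply Rmult_le_compat_l; [lra|]. rewrite <- (Rmult_1_r (exp _)) at 2.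
      apply Rmult_le_compat_l; [left; apply exp_pos | apply COS_bound]. }
  apply le_epsilon. intros e He.
  set (m := exp (4 / 3 * t0)) in *. assert (Hm : 0 < m) by apply exp_pos.
  assert (He' : 0 < ln (1 + e / B')).
  { rewrite <- ln_1. apply ln_increasing; [lra|]. assert (0 < e / B') by (apply Rdiv_lt_0_compat; lra). lra. }
  specialize (Key (ln (1 + e / B') / m)).
  replace (ln (1 + e / B') / m * m) with (ln (1 + e / B')) in Key by (field; lra).
  rewrite exp_ln in Key by (assert (0 < e / B') by (apply Rdiv_lt_0_compat; lra); lra).
  replace (B' * (1 + e / B')) with (B' + e) in Key by (field; lra).
  apply Key. now apply Rdiv_lt_0_compat.
Qed.

(** The sector principle, rotated by [arg u] and applied to [f] times an exponential whose
    modulus is [exp (- sg |Im z|)] on the quadrant. *)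
Lemma quadrant_bound (f : C -> C) (u : C) (s sg r B : R) :
  (forall z, holo f z) -> 0 <= sg -> Rabs s = 1 -> Cmod u = sqrt 2 ->
  (forall z, r <= Cmod z -> Cmod (f z) <= exp (sg * Cmod z)) ->
  (forall t, 0 <= t ->
     Cmod (f (u * (t, t))%C) <= B * exp (sg * (s * snd (u * (t, t))%C)) /\
     Cmod (f (u * (t, (- t)%R))%C) <= B * exp (sg * (s * snd (u * (t, (- t)%R))%C))) ->
  exists B', forall x y, Rabs y <= x ->
    Cmod (f (u * (x, y))%C) <= B' * exp (sg * (s * snd (u * (x, y))%C)).
Proof.
  intros Hf Hsg Hs Hu Hr HB.
  set (F := fun z => (f (u * z) * cexp (s * sg * Ci * (u * z)))%C).
  assert (MF : forall z, Cmod (F z) * exp (sg * (s * snd (u * z)%C)) = Cmod (f (u * z)%C)).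
  { intro z. unfold F. rewrite Cmod_mult, Cmod_cexp, Rmult_assoc, <- exp_plus.
    replace (fst (s * sg * Ci * (u * z))%C + sg * (s * snd (u * z)%C)) with 0 by (simpl; ring).
    rewrite exp_0. ring. }
  assert (Div : forall z c, Cmod (f (u * z)%C) <= c * exp (sg * (s * snd (u * z)%C)) <-> Cmod (F z) <= c).
  { intros z c. rewrite <- MF. assert (E := exp_pos (sg * (s * snd (u * z)%C))).
    split; intro H; nra. }
  assert (S2 : 1 <= sqrt 2 <= 2).
  { split.
    - rewrite <- sqrt_1 at 1. apply sqrt_le_1; lra.
    - rewrite <- (sqrt_square 2) at 2 by lra. apply sqrt_le_1; lra. }
  destruct (phragmen_lindelof_sector F (4 * sg) (Rabs r) B) as [B' H'].
  - intro z. unfold F. apply holo_mult.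
    + apply (holo_comp (fun z => u * z)%C f); [apply holo_scal, holo_id | apply Hf].
    + apply (holo_comp (fun z => s * sg * Ci * (u * z))%C cexp).
      * apply holo_scal, holo_scal, holo_id.
      * eexists. apply diff_at_cexp.
  - lra.
  - intros z Hz. assert (Pz := Cmod_ge_0 z).
    unfold F. rewrite Cmod_mult, Cmod_cexp.
    assert (M : Cmod (u * z)%C = sqrt 2 * Cmod z) by (rewrite Cmod_mult, Hu; reflexivity).
    apply Rle_trans with (exp (2 * sg * Cmod z) * exp (2 * sg * Cmod z)).
    + apply Rmult_le_compat; [apply Cmod_ge_0 | left; apply exp_pos | |].
      * eapply Rle_trans; [apply Hr|].
        -- rewrite M. generalize (Rle_abs r). nra.
        -- apply exp_le. rewrite M. assert (sqrt 2 * Cmod z <= 2 * Cmod z) by nra. nra.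
      * apply exp_le. eapply Rle_trans; [apply Rle_abs|].
        eapply Rle_trans; [apply fst_le_Cmod|].
        rewrite (Cmod_mult _ (u * z)%C), M, !Cmod_mult, Cmod_Ci, !Cmod_R, Hs, (Rabs_pos_eq sg) by lra.
        assert (sqrt 2 * Cmod z <= 2 * Cmod z) by nra. nra.
    + rewrite <- exp_plus. right. f_equal. ring.
  - intros t Ht. rewrite <- !Div. now apply HB.
  - exists B'. intros x y Hxy. apply Div. now apply H'.
Qed.

(** Use the quadrants one by one: on the real axis [f] is bounded by hypothesis, and on the
    imaginary axis [exp (sg |Im z|)] is the growth that is allowed. *)
Theorem exponential_type_bound (f : C -> C) (sg r M : R) :
  (forall z, holo f z) -> 0 <= sg ->
  (forall z, r <= Cmod z -> Cmod (f z) <= exp (sg * Cmod z)) ->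
  (forall x : R, Cmod (f x) <= M) ->
  exists B, forall z, Cmod (f z) <= B * exp (sg * Rabs (snd z)).
Proof.
  intros Hf Hsg Hr HM.
  destruct (bounded_on_segment (fun t => f (0, t)) (- Rabs r) (Rabs r)) as [K HK].
  { intro t. apply rcont_vertical, holo_cont, Hf. }
  assert (HM0 : 0 <= M) by (eapply Rle_trans; [apply Cmod_ge_0 | apply (HM 0)]).
  assert (HK0 : 0 <= K).
  { eapply Rle_trans; [apply Cmod_ge_0 | apply (HK 0)]. generalize (Rabs_pos r). lra. }
  set (B0 := M + K + 1).
  assert (Im : forall t, Cmod (f (0, t)) <= B0 * exp (sg * Rabs t)).
  { intro t. assert (E : 1 <= exp (sg * Rabs t)).
    { rewrite <- exp_0 at 1. apply exp_le. generalize (Rabs_pos t). nra. }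
    destruct (Rle_dec (Rabs t) (Rabs r)) as [H|H].
    - apply Rle_trans with K; [apply HK; now apply Rabs_le_between | unfold B0; nra].
    - assert (Ct : Cmod (0, t) = Rabs t).
      { replace ((0, t) : C) with (Ci * t)%C by (apply injective_projections; simpl; ring).
        rewrite Cmod_mult, Cmod_Ci, Cmod_R. ring. }
      eapply Rle_trans; [apply Hr|]; rewrite Ct; [generalize (Rle_abs r); lra | unfold B0; nra]. }
  assert (Re : forall t, Cmod (f (t, 0)) <= B0).
  { intro t. specialize (HM t). unfold RtoC in HM. unfold B0. lra. }
  assert (S2 : forall a b : R, Rabs a = 1 -> Rabs b = 1 -> Cmod (a, b) = sqrt 2).
  { intros a b Ha Hb. unfold Cmod. f_equal. simpl.
    assert (a * a = 1) by (rewrite <- (Rabs_pos_eq (a * a)), Rabs_mult, Ha by nra; ring).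
    assert (b * b = 1) by (rewrite <- (Rabs_pos_eq (b * b)), Rabs_mult, Hb by nra; ring). lra. }
  assert (Q : forall a b, (a = 1 \/ a = -1) -> (b = 1 \/ b = -1) ->
    exists B', forall x y, Rabs y <= x ->
    Cmod (f ((a, b) * (x, y))%C) <= B' * exp (sg * (b * snd ((a, b) * (x, y))%C))).
  { intros a b Ha Hb.
    assert (Aa : Rabs a = 1) by (destruct Ha as [-> | ->]; [apply Rabs_R1 | rewrite Rabs_left; lra]).
    assert (Ab : Rabs b = 1) by (destruct Hb as [-> | ->]; [apply Rabs_R1 | rewrite Rabs_left; lra]).
    apply (quadrant_bound f (a, b) b sg r B0); trivial; [now apply S2|].
    assert (Axis : forall u v, u = 0 \/ v = 0 -> 0 <= b * v ->
      Cmod (f (u, v)) <= B0 * exp (sg * (b * v))).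
    { intros u v [-> | ->] Hv.
      - replace (b * v) with (Rabs v); [apply Im|].
        rewrite <- (Rabs_pos_eq (b * v)), Rabs_mult, Ab by exact Hv. ring.
      - rewrite Rmult_0_r, Rmult_0_r, exp_0, Rmult_1_r. apply Re. }
    intros t Ht.
    replace ((a, b) * (t, t))%C with ((a - b) * t, (a + b) * t)
      by (apply injective_projections; simpl; ring).
    replace ((a, b) * (t, (- t)%R))%C with ((a + b) * t, (b - a) * t)
      by (apply injective_projections; simpl; ring).
    simpl snd. split; apply Axis; destruct Ha as [-> | ->], Hb as [-> | ->]; lra. }
  destruct (Q 1 1) as [B1 H1]; [lra | lra|]. destruct (Q (-1) 1) as [B2 H2]; [lra | lra|].
  destruct (Q (-1) (-1)) as [B3 H3]; [lra | lra|]. destruct (Q 1 (-1)) as [B4 H4]; [lra | lra|].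
  exists (Rabs B1 + Rabs B2 + Rabs B3 + Rabs B4). intros [x y]. simpl snd.
  assert (P1 := Rabs_pos B1). assert (P2 := Rabs_pos B2).
  assert (P3 := Rabs_pos B3). assert (P4 := Rabs_pos B4).
  assert (R1 := Rle_abs B1). assert (R2 := Rle_abs B2).
  assert (R3 := Rle_abs B3). assert (R4 := Rle_abs B4).
  assert (Fin : forall a b B, (a = 1 \/ a = -1) -> (b = 1 \/ b = -1) ->
    (forall x y, Rabs y <= x ->
      Cmod (f ((a, b) * (x, y))%C) <= B * exp (sg * (b * snd ((a, b) * (x, y))%C))) ->
    B <= Rabs B1 + Rabs B2 + Rabs B3 + Rabs B4 -> 0 <= a * x -> 0 <= b * y ->
    Cmod (f (x, y)) <= (Rabs B1 + Rabs B2 + Rabs B3 + Rabs B4) * exp (sg * Rabs y)).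
  { intros a b B Ha Hb H HBB Hx Hy.
    specialize (H ((a * x + b * y) / 2) ((a * y - b * x) / 2)).
    replace ((a, b) * (((a * x + b * y) / 2)%R, ((a * y - b * x) / 2)%R))%C with ((x, y) : C) in H.
    2: { apply injective_projections; simpl; destruct Ha as [-> | ->], Hb as [-> | ->]; field. }
    assert (Hle : Rabs ((a * y - b * x) / 2) <= (a * x + b * y) / 2).
    { apply Rabs_le. destruct Ha as [-> | ->], Hb as [-> | ->]; lra. }
    specialize (H Hle). simpl snd in H. replace (b * y) with (Rabs y) in H.
    - eapply Rle_trans; [exact H|].
      apply Rmult_le_compat_r; [left; apply exp_pos | exact HBB].
    - rewrite <- (Rabs_pos_eq (b * y)), Rabs_mult by exact Hy.
      destruct Hb as [-> | ->]; [rewrite Rabs_R1 | rewrite (Rabs_left (-1)) by lra]; ring. }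
  destruct (Rle_dec 0 x), (Rle_dec 0 y).
  - apply (Fin 1 1 B1); trivial; lra.
  - apply (Fin 1 (-1) B4); trivial; lra.
  - apply (Fin (-1) 1 B2); trivial; lra.
  - apply (Fin (-1) (-1) B3); trivial; lra.
Qed.

(** * Exponential type and the approximation error as inequalities *)

Lemma exp_type_le (f : C -> C) : exp_type_at_most_one f ->
  forall sg, 1 < sg -> exists r, 0 < r /\
    forall z, r <= Cmod z -> Cmod (f z) <= exp (sg * Cmod z).
Proof.
  unfold exp_type_at_most_one, limsup_Cinfty, Rbar_glb.
  destruct (Rbar_ex_glb _) as [m [Hlb Hm]]; simpl proj1_sig. intros H1 sg Hsg.
  set (Good := exists r, 0 < r /\ forall z, r <= Cmod z -> Cmod (f z) <= exp (sg * Cmod z)).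
  destruct (Classical_Prop.classic Good) as [HG|HG]; [exact HG|exfalso].
  assert (K : Rbar_le (Finite sg) m).
  { apply Hm. intros s [r [Hr ->]].
    unfold Rbar_lub. destruct (Rbar_ex_lub _) as [l [Hub Hl]]; simpl proj1_sig.
    destruct (Rbar_le_lt_dec (Finite sg) l) as [|Hlt]; [assumption|exfalso].
    apply HG. exists r. split; [exact Hr|]. intros z Hz.
    assert (Hu := Hub _ (ex_intro _ z (conj Hz eq_refl))).
    assert (Hu' := Rbar_le_trans _ _ _ Hu (Rbar_lt_le _ _ Hlt)).
    unfold log_ext in Hu'. destruct (Rlt_dec 0 (Cmod (f z))) as [Hp|Hp].
    - simpl in Hu'. rewrite <- (exp_ln _ Hp). apply exp_le.
      apply Rmult_le_compat_l with (r := Cmod z) in Hu'; [|lra].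
      rewrite <- Rmult_assoc, Rinv_r, Rmult_1_l in Hu' by lra. lra.
    - apply Rle_trans with 0; [lra | left; apply exp_pos]. }
  assert (K' := Rbar_le_trans _ _ _ K H1). simpl in K'. lra.
Qed.

Lemma exp_type_intro (f : C -> C) (K : R) :
  (forall z, Cmod (f z) <= K * Cmod z * exp (Cmod z)) -> exp_type_at_most_one f.
Proof.
  intro HK. unfold exp_type_at_most_one, limsup_Cinfty, Rbar_glb.
  destruct (Rbar_ex_glb _) as [m [Hlb Hm]]; simpl proj1_sig.
  assert (Main : forall e, 0 < e -> Rbar_le m (Finite (1 + e))).
  { intros e He.
    set (r := (Rabs K + 1) * (4 / (e * e))). assert (PK := Rabs_pos K).
    assert (Hr : 0 < r) by (apply Rmult_lt_0_compat; [lra | apply Rdiv_lt_0_compat; nra]).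
    eapply Rbar_le_trans.
    - apply Hlb. exists r. split; [exact Hr | reflexivity].
    - unfold Rbar_lub. destruct (Rbar_ex_lub _) as [l [Hub Hl]]; simpl proj1_sig.
      apply Hl. intros y [z [Hz ->]].
      assert (Hz0 : 0 < Cmod z) by lra.
      assert (Hi : 0 < / Cmod z) by now apply Rinv_0_lt_compat.
      unfold log_ext. destruct (Rlt_dec 0 (Cmod (f z))) as [Hp|Hp].
      + simpl. apply Rmult_le_reg_l with (Cmod z); [exact Hz0|].
        rewrite <- Rmult_assoc, Rinv_r, Rmult_1_l by lra.
        apply Rle_trans with (ln (exp (Cmod z * (1 + e)))); [|rewrite ln_exp; lra].
        apply ln_le; [exact Hp|]. eapply Rle_trans; [apply HK|].
        rewrite Rmult_plus_distr_l, Rmult_1_r, exp_plus, (Rmult_comm (exp (Cmod z))).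
        apply Rmult_le_compat_r; [left; apply exp_pos|].
        (* exp (e |z|) is the square of exp (e |z| / 2), hence at least a multiple of |z|^2 *)
        replace (Cmod z * e) with (Cmod z * e / 2 + Cmod z * e / 2) by field.
        rewrite exp_plus. assert (E := exp_ineq1_le (Cmod z * e / 2)).
        assert (Hze : 0 < Cmod z * e / 2) by nra.
        apply Rle_trans with (Cmod z * e / 2 * (Cmod z * e / 2)); [|nra].
        apply Rle_trans with (Cmod z * (Cmod z * (e * e / 4))); [|right; field].
        rewrite Rmult_comm. apply Rmult_le_compat_l; [lra|].
        apply Rle_trans with (Rabs K); [apply Rle_abs|].
        apply Rle_trans with (r * (e * e / 4)); [|apply Rmult_le_compat_r; nra].
        replace (r * (e * e / 4)) with (Rabs K + 1) by (unfold r; field; lra). lra.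
      + rewrite Rbar_mult_comm, (is_Rbar_mult_unique m_infty (Finite (/ Cmod z)) m_infty).
        * exact I.
        * apply is_Rbar_mult_m_infty_pos. exact Hi. }
  destruct m as [m| |]; simpl in *.
  - apply le_epsilon. intros e He. apply (Main e He).
  - apply (Main 1). lra.
  - exact I.
Qed.

Lemma sgn_error_le (A M : R) (f : C -> C) :
  (forall x, A <= Rabs x -> Cmod (f (RtoC x) - RtoC (sign x))%C <= M) ->
  Rbar_le (sgn_error A f) (Finite M).
Proof.
  intro H. unfold sgn_error, Rbar_lub. destruct (Rbar_ex_lub _) as [l [Hub Hl]]; simpl proj1_sig.
  apply Hl. intros y [x [Hx ->]]. now apply H.
Qed.

Lemma sgn_error_ge (A x : R) (f : C -> C) : A <= Rabs x ->
  Rbar_le (Finite (Cmod (f (RtoC x) - RtoC (sign x))%C)) (sgn_error A f).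
Proof.
  intro H. unfold sgn_error, Rbar_lub. destruct (Rbar_ex_lub _) as [l [Hub Hl]]; simpl proj1_sig.
  apply Hub. now exists x.
Qed.

Lemma L_le (A M : R) (f : C -> C) : (forall z, holo f z) -> exp_type_at_most_one f ->
  (forall x, A <= Rabs x -> Cmod (f (RtoC x) - RtoC (sign x))%C <= M) -> L A <= M.
Proof.
  intros Hf Ht HM. unfold L. assert (F := best_sgn_error_finite A).
  enough (H : Rbar_le (best_sgn_error A) (Finite M)) by (rewrite <- F in H; exact H).
  eapply Rbar_le_trans; [|apply sgn_error_le, HM].
  unfold best_sgn_error, Rbar_glb. destruct (Rbar_ex_glb _) as [l [Hlb Hl]]; simpl proj1_sig.
  apply Hlb. exists f. split; [|now split]. intro z. now apply ex_derive_holo.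
Qed.

Lemma L_ge (A m : R) :
  (forall f M, (forall z, holo f z) -> exp_type_at_most_one f ->
    (forall x, A <= Rabs x -> Cmod (f (RtoC x) - RtoC (sign x))%C <= M) -> m <= M) ->
  m <= L A.
Proof.
  intro H. unfold L. assert (F := best_sgn_error_finite A).
  enough (K : Rbar_le (Finite m) (best_sgn_error A)) by (rewrite <- F in K; exact K).
  unfold best_sgn_error, Rbar_glb. destruct (Rbar_ex_glb _) as [l [Hlb Hl]]; simpl proj1_sig.
  apply Hl. intros e [f [Hf [Ht ->]]].
  assert (P := sgn_error_ge0 A f).
  assert (G := fun x Hx => sgn_error_ge A x f Hx).
  destruct (sgn_error A f) as [M| |]; [|exact I|easy].
  apply (H f M); trivial. intro z. apply ex_derive_holo, Hf.
Qed.

(** * The extremal functions on the real axis *)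

Definition cos_sqrt (v : R) : R := fst (ccos_sqrt (RtoC v)).
Definition sinc_sqrt (v : R) : R := fst (csinc_sqrt (RtoC v)).

Lemma real_sq_cases (v : R) : exists q, 0 <= q /\ (v = q * q \/ v = - (q * q)).
Proof.
  exists (sqrt (Rabs v)). split; [apply sqrt_pos|]. rewrite sqrt_sqrt by apply Rabs_pos.
  unfold Rabs. destruct (Rcase_abs v); lra.
Qed.

Lemma ccos_sqrt_real (v : R) : ccos_sqrt (RtoC v) = RtoC (cos_sqrt v).
Proof.
  unfold cos_sqrt. destruct (real_sq_cases v) as [q [_ [-> | ->]]].
  - now rewrite ccos_sqrt_pos.
  - now rewrite ccos_sqrt_neg.
Qed.

Lemma csinc_sqrt_real (v : R) : csinc_sqrt (RtoC v) = RtoC (sinc_sqrt v).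
Proof.
  unfold sinc_sqrt. destruct (Req_dec v 0) as [->|Hv]; [now rewrite csinc_sqrt_0|].
  destruct (real_sq_cases v) as [q [_ [E|E]]]; subst v.
  - now rewrite (csinc_sqrt_div _ _ Hv (mult_csinc_sqrt_pos q)).
  - now rewrite (csinc_sqrt_div _ _ Hv (mult_csinc_sqrt_neg q)).
Qed.

Lemma cos_sqrt_pos (q : R) : cos_sqrt (q * q) = cos q.
Proof. unfold cos_sqrt. now rewrite ccos_sqrt_pos. Qed.

Lemma cos_sqrt_neg (w : R) : cos_sqrt (- (w * w)) = cosh w.
Proof. unfold cos_sqrt. now rewrite ccos_sqrt_neg. Qed.

Lemma mult_sinc_sqrt_pos (q : R) : q * q * sinc_sqrt (q * q) = q * sin q.
Proof. apply RtoC_inj. rewrite RtoC_mult, <- csinc_sqrt_real. apply mult_csinc_sqrt_pos. Qed.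

Lemma mult_sinc_sqrt_neg (w : R) : w * w * sinc_sqrt (- (w * w)) = w * sinh w.
Proof.
  apply Ropp_eq_reg, RtoC_inj. rewrite Ropp_mult_distr_l, RtoC_mult, <- csinc_sqrt_real. apply mult_csinc_sqrt_neg.
Qed.

Lemma is_derive_real (f : C -> C) (x : R) (l : C) : diff_at f (RtoC x) l ->
  is_derive (fun t : R => fst (f (RtoC t))) x (fst l).
Proof.
  intro H. replace (RtoC x) with (0 + x * 1)%C in H by ring.
  destruct (diff_at_segment f 0 1 l x H) as [H1 _].
  replace (l * 1)%C with l in H1 by ring.
  apply (is_derive_ext (fun s : R => fst (f (0 + s * 1)%C))); [|exact H1].
  intro t. f_equal. f_equal. ring.
Qed.

Lemma is_derive_cos_sqrt (v : R) : is_derive cos_sqrt v (- (sinc_sqrt v / 2)).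
Proof.
  assert (H := is_derive_real ccos_sqrt v _ (diff_at_ccos_sqrt (RtoC v))).
  replace (- (sinc_sqrt v / 2)) with (fst (- (/ 2) * csinc_sqrt (RtoC v))%C); [exact H|].
  rewrite csinc_sqrt_real. simpl. field.
Qed.

Lemma is_derive_mult_sinc_sqrt (v : R) : is_derive (fun v => v * sinc_sqrt v) v ((sinc_sqrt v + cos_sqrt v) / 2).
Proof.
  assert (H := is_derive_real _ v _ (diff_at_mult_csinc_sqrt (RtoC v))).
  replace ((sinc_sqrt v + cos_sqrt v) / 2) with (fst (/ 2 * (csinc_sqrt (RtoC v) + ccos_sqrt (RtoC v)))%C).
  - apply (is_derive_ext (fun t => fst (RtoC t * csinc_sqrt (RtoC t))%C)); [|exact H].
    intro t. rewrite csinc_sqrt_real. simpl. ring.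
  - rewrite csinc_sqrt_real, ccos_sqrt_real. simpl. field.
Qed.

(** [kern A z = cos q + A sin q / q] with [q^2 = z^2 - A^2]. On the real axis outside
    [(-A, A)] its zeros are the extremal points of [dev A x / x]. *)
Definition kern (A : R) (z : C) : C := (ccos_sqrt (z * z - A * A) + A * csinc_sqrt (z * z - A * A))%C.

Definition kernr (A x : R) : R := cos_sqrt (x * x - A * A) + A * sinc_sqrt (x * x - A * A).

Lemma kern_real (A x : R) : kern A (RtoC x) = RtoC (kernr A x).
Proof.
  unfold kern, kernr. rewrite <- !RtoC_mult, <- RtoC_minus, ccos_sqrt_real, csinc_sqrt_real.
  now rewrite <- RtoC_mult, <- RtoC_plus.
Qed.

Lemma holo_kern (A : R) (z : C) : holo (kern A) z.
Proof.
  assert (H : holo (fun z => z * z - A * A)%C z).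
  { apply holo_minus; [apply holo_mult; apply holo_id | apply holo_const]. }
  apply holo_plus; [|apply holo_scal].
  - apply (holo_comp _ ccos_sqrt); [exact H | apply holo_ccos_sqrt].
  - apply (holo_comp _ csinc_sqrt); [exact H | apply holo_csinc_sqrt].
Qed.

Lemma Cmod_csqrt (v : C) : Cmod (csqrt v) * Cmod (csqrt v) = Cmod v.
Proof. now rewrite <- Cmod_mult, csqrt_sq. Qed.

Lemma Cmod_kern_le (A : R) (z : C) : 0 < A ->
  Cmod (kern A z) <= (1 + A) * exp A * exp (Cmod z).
Proof.
  intro HA. unfold kern. set (v := (z * z - A * A)%C).
  assert (Hz := Cmod_ge_0 z). assert (Hq := Cmod_ge_0 (csqrt v)).
  assert (B : Rabs (snd (csqrt v)) <= A + Cmod z).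
  { eapply Rle_trans; [apply snd_le_Cmod|].
    apply Rsqr_incr_0_var; [unfold Rsqr; rewrite Cmod_csqrt | lra].
    unfold v. eapply Rle_trans; [apply Cmod_sub_le|].
    rewrite !Cmod_mult, Cmod_R, Rabs_pos_eq by lra. nra. }
  apply exp_le in B. rewrite exp_plus in B.
  eapply Rle_trans; [apply Cmod_triangle|]. rewrite Cmod_mult, Cmod_R, (Rabs_pos_eq A) by lra.
  assert (B1 := Cmod_ccos_le (csqrt v)). assert (B2 := Cmod_csinc_le (csqrt v)).
  fold (ccos_sqrt v) in B1. fold (csinc_sqrt v) in B2. nra.
Qed.

Lemma Cmod_primitive_le (f : C -> C) (z : C) (M : R) : (forall w, holo f w) ->
  (forall w, Cmod w <= Cmod z -> Cmod (f w) <= M) ->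
  Cmod (primitive f z) <= M * (2 * Cmod z).
Proof.
  intros Hf HM. unfold primitive.
  assert (H1 : forall e t, rcont (fun s => f (s, e)) t) by (intros; apply rcont_horizontal, holo_cont, Hf).
  assert (H2 : forall e t, rcont (fun s => f (e, s)) t) by (intros; apply rcont_vertical, holo_cont, Hf).
  assert (HM0 : 0 <= M) by (eapply Rle_trans; [apply Cmod_ge_0 | apply (HM z); lra]).
  assert (X := fst_le_Cmod z). assert (Y := snd_le_Cmod z).
  assert (Small : forall u t, Rmin 0 u <= t <= Rmax 0 u -> t * t <= u * u).
  { intros u t Ht. unfold Rmin, Rmax in Ht. destruct (Rle_dec 0 u); nra. }
  assert (Q : forall x y : R, x * x + y * y <= fst z * fst z + snd z * snd z -> Cmod (x, y) <= Cmod z).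
  { intros x y H. apply Rsqr_incr_0_var; [unfold Rsqr|apply Cmod_ge_0]. now rewrite !Cmod_sqr. }
  eapply Rle_trans; [apply Cmod_triangle|]. rewrite Cmod_mult, Cmod_Ci, Rmult_1_l.
  assert (B1 : Cmod (CInt (fun s => f (s, 0)) 0 (fst z)) <= M * Rabs (fst z - 0)).
  { apply CInt_bound_abs; [apply H1|]. intros t Ht. apply HM, Q.
    assert (S := Small _ _ Ht). assert (0 <= snd z * snd z) by apply Rle_0_sqr. lra. }
  assert (B2 : Cmod (CInt (fun t => f (fst z, t)) 0 (snd z)) <= M * Rabs (snd z - 0)).
  { apply CInt_bound_abs; [apply H2|]. intros t Ht. apply HM, Q.
    assert (S := Small _ _ Ht). lra. }
  rewrite Rminus_0_r in B1, B2. nra.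
Qed.

Lemma exp_type_primitive_kern (A k : R) : 0 < A ->
  exp_type_at_most_one (fun z => RtoC k * primitive (kern A) z)%C.
Proof.
  intro HA. apply (exp_type_intro _ (Rabs k * ((1 + A) * exp A * 2))). intro z.
  rewrite Cmod_mult, Cmod_R.
  assert (B := Cmod_primitive_le (kern A) z ((1 + A) * exp A * exp (Cmod z)) (holo_kern A)).
  replace (Rabs k * ((1 + A) * exp A * 2) * Cmod z * exp (Cmod z))
    with (Rabs k * ((1 + A) * exp A * exp (Cmod z) * (2 * Cmod z))) by ring.
  apply Rmult_le_compat_l; [apply Rabs_pos|]. apply B.
  intros w Hw. eapply Rle_trans; [now apply Cmod_kern_le|].
  apply Rmult_le_compat_l; [|now apply exp_le].
  apply Rmult_le_pos; [lra | left; apply exp_pos].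
Qed.

Definition kern_integral (A x : R) : R := RInt (kernr A) 0 x.

Lemma continuous_kernr (A x : R) : continuous (kernr A) x.
Proof.
  assert (H := rcont_horizontal (kern A) 0 x (holo_cont _ _ (holo_kern A _))).
  destruct H as [H _]. eapply continuous_ext; [|exact H].
  intro t. simpl. change (fst (kern A (RtoC t)) = kernr A t). now rewrite kern_real.
Qed.

Lemma ex_RInt_kernr (A a b : R) : ex_RInt (kernr A) a b.
Proof.
  apply ex_RInt_cont. intros; apply continuous_kernr.
Qed.

Lemma primitive_kern_real (A x : R) : primitive (kern A) (RtoC x) = RtoC (kern_integral A x).
Proof.
  unfold primitive, kern_integral, CInt. simpl fst; simpl snd. rewrite !RInt_point.
  rewrite (RInt_ext (fun t => fst (kern A (t, 0))) (kernr A)).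
  2: { intros t _. change (fst (kern A (RtoC t)) = kernr A t). now rewrite kern_real. }
  rewrite (RInt_ext (fun t => snd (kern A (t, 0))) (fun _ => 0)).
  2: { intros t _. change (snd (kern A (RtoC t)) = 0). now rewrite kern_real. }
  rewrite RInt_const. unfold zero, scal; simpl. unfold mult; simpl.
  apply injective_projections; simpl; ring.
Qed.

Lemma kernr_even (A x : R) : kernr A (- x) = kernr A x.
Proof. unfold kernr. now replace (- x * - x) with (x * x) by ring. Qed.

Lemma kern_integral_odd (A x : R) : kern_integral A (- x) = - kern_integral A x.
Proof.
  unfold kern_integral. apply is_RInt_unique.
  replace 0 with (- 0) at 1 by ring.
  apply (is_RInt_ext (fun y => - - kernr A (- y))).
  { intros y _. rewrite kernr_even, Ropp_involutive. reflexivity. }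
  apply (is_RInt_opp (V := R_NormedModule)).
  apply (is_RInt_comp_opp (V := R_NormedModule) (kernr A)).
  rewrite !Ropp_involutive. apply (RInt_correct (V := R_CompleteNormedModule)), ex_RInt_kernr.
Qed.

(** * The upper bound *)

Lemma is_derive_kern_integral (A x : R) : is_derive (kern_integral A) x (kernr A x).
Proof.
  apply (is_derive_RInt (V := R_NormedModule) (kernr A) (kern_integral A) 0).
  - exists (mkposreal 1 Rlt_0_1). intros y _.
    apply (RInt_correct (V := R_CompleteNormedModule)), ex_RInt_kernr.
  - apply continuous_kernr.
Qed.

(** [A cos q - q sin q] with [q^2 = x^2 - A^2]; up to normalization, [dev A x / x] is the
    error curve of the best approximation. *)
Definition dev (A x : R) : R :=
  A * cos_sqrt (x * x - A * A) - (x * x - A * A) * sinc_sqrt (x * x - A * A).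

Lemma Rabs_dev_le (A x : R) : 0 < A -> A <= x -> Rabs (dev A x) <= x.
Proof.
  intros HA Hx. unfold dev.
  set (q := sqrt (x * x - A * A)).
  assert (Hq : q * q = x * x - A * A) by (apply sqrt_sqrt; nra).
  rewrite <- Hq, mult_sinc_sqrt_pos, cos_sqrt_pos.
  apply Rsqr_incr_0_var; [|lra]. rewrite <- Rsqr_abs. unfold Rsqr.
  assert (T := sin2_cos2 q). unfold Rsqr in T.
  assert (S : 0 <= (A * sin q + q * cos q) * (A * sin q + q * cos q)) by apply Rle_0_sqr.
  replace (x * x) with ((A * A + q * q) * (sin q * sin q + cos q * cos q)) by (rewrite T; lra).
  nra.
Qed.

Lemma is_derive_dev (A x : R) :
  is_derive (dev A) x (- (x * (A * sinc_sqrt (x * x - A * A) + sinc_sqrt (x * x - A * A) + cos_sqrt (x * x - A * A)))).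
Proof.
  set (v := x * x - A * A).
  assert (Hv : is_derive (fun x => x * x - A * A) x (2 * x)) by (auto_derive; [easy | ring]).
  assert (D1 := is_derive_comp cos_sqrt (fun x => x * x - A * A) x _ _ (is_derive_cos_sqrt v) Hv).
  assert (D2 := is_derive_comp (fun v => v * sinc_sqrt v) (fun x => x * x - A * A) x _ _ (is_derive_mult_sinc_sqrt v) Hv).
  assert (D3 := is_derive_minus _ _ _ _ _ (is_derive_scal _ x A _ D1) D2).
  replace (- (x * (A * sinc_sqrt v + sinc_sqrt v + cos_sqrt v)))
    with (minus (A * (scal (2 * x) (- (sinc_sqrt v / 2)))) (scal (2 * x) ((sinc_sqrt v + cos_sqrt v) / 2))); [exact D3|].
  unfold minus, plus, opp, scal; simpl. unfold mult; simpl. field.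
Qed.

(** [kern] is designed so that [kern * (1 + A/x^2)] is the derivative of [- dev A x / x].
    Integrating by parts, the primitive of [kern] differs from a constant by
    [- dev A x * x / (x^2 + A)], up to a term of relative size [1/A]. *)
Lemma is_derive_kern_integral_plus_dev (A x : R) : 0 < A ->
  is_derive (fun x => kern_integral A x + dev A x * (x / (x * x + A))) x
    (2 * A * dev A x / ((x * x + A) * (x * x + A))).
Proof.
  intro HA. assert (P : 0 < x * x + A) by nra.
  assert (D0 := is_derive_kern_integral A x). assert (D1 := is_derive_dev A x).
  assert (D2 : is_derive (fun x => x / (x * x + A)) x
     ((A - x * x) / ((x * x + A) * (x * x + A)))).
  { auto_derive; [lra|]. field. lra. }
  assert (D3 := is_derive_plus _ _ _ _ _ D0 (is_derive_mult _ _ _ _ _ D1 D2 Rmult_comm)).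
  match type of D3 with is_derive _ _ ?l =>
    replace (2 * A * dev A x / ((x * x + A) * (x * x + A))) with l; [exact D3|] end.
  unfold plus, mult; simpl. unfold dev, kernr.
  generalize (cos_sqrt (x * x - A * A)) (sinc_sqrt (x * x - A * A)). intros c s. field. lra.
Qed.

(** With [P] the primitive and [U = P + dev * x / (x^2 + A)], the bound on [dev] makes [|U'|]
    at most the derivative of [V = x^2 / (x^2 + A)], whose total variation beyond [A] is
    [1 / (A + 1)]. *)
Lemma kern_integral_deviation (A x : R) : 0 < A -> A <= x ->
  Rabs (kern_integral A x - (kern_integral A A + A / (A + 1))) <= 1 + 1 / (A + 1).
Proof.
  intros HA Hx.
  set (U := fun x => kern_integral A x + dev A x * (x / (x * x + A))).
  set (V := fun x => x * x / (x * x + A)).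
  assert (HU : forall t, A <= t -> is_derive U t (2 * A * dev A t / ((t * t + A) * (t * t + A)))).
  { intros t Ht. now apply is_derive_kern_integral_plus_dev. }
  assert (HV : forall t, A <= t -> is_derive V t (2 * A * t / ((t * t + A) * (t * t + A)))).
  { intros t Ht. unfold V. auto_derive; [nra|]. field. nra. }
  assert (UV : forall s : R, s = 1 \/ s = -1 -> s * (U x - U A) <= V x - V A).
  { intros s Hs.
    set (dW := fun t => minus (2 * A * t / ((t * t + A) * (t * t + A)))
           (s * (2 * A * dev A t / ((t * t + A) * (t * t + A))))).
    assert (HW : forall t, A <= t -> is_derive (fun t => minus (V t) (s * U t)) t (dW t)).
    { intros t Ht. apply (is_derive_minus (V := R_NormedModule)); [now apply HV|].
      apply (is_derive_scal U t s), HU, Ht. }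
    destruct (mean_value (fun t => minus (V t) (s * U t)) dW A x) as [c [Hc E]].
    { intros t Ht. apply HW. rewrite Rmin_left in Ht; lra. }
    rewrite Rmin_left, Rmax_right in Hc by lra. unfold minus, plus, opp in E; simpl in E.
    assert (0 <= dW c).
    { unfold dW, minus, plus, opp; simpl.
      replace (2 * A * c / ((c * c + A) * (c * c + A)) + - (s * (2 * A * dev A c / ((c * c + A) * (c * c + A)))))
        with (2 * A * (c - s * dev A c) / ((c * c + A) * (c * c + A))) by (field; nra).
      apply Rmult_le_pos; [|left; apply Rinv_0_lt_compat; nra].
      assert (D := Rabs_dev_le A c HA (proj1 Hc)). apply Rabs_le_between in D.
      destruct Hs as [-> | ->]; nra. }
    nra. }
  assert (UV1 := UV 1 ltac:(lra)). assert (UV2 := UV (-1) ltac:(lra)).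
  assert (EA : dev A A = A).
  { unfold dev. replace (A * A - A * A) with (0 * 0) by ring. rewrite cos_sqrt_pos, cos_0. ring. }
  assert (UA : U A = kern_integral A A + A / (A + 1)) by (unfold U; rewrite EA; field; nra).
  assert (VA : V A = 1 - 1 / (A + 1)) by (unfold V; field; nra).
  assert (Vx : V x <= 1).
  { unfold V. apply Rmult_le_reg_r with (x * x + A); [nra|]. unfold Rdiv.
    rewrite Rmult_assoc, Rinv_l; nra. }
  assert (Dx : Rabs (dev A x * (x / (x * x + A))) <= V x).
  { rewrite Rabs_mult, (Rabs_pos_eq (x / (x * x + A))).
    - unfold V. replace (x * x / (x * x + A)) with (x * (x / (x * x + A))) by (field; nra).
      apply Rmult_le_compat_r; [|now apply Rabs_dev_le].
      apply Rmult_le_pos; [lra | left; apply Rinv_0_lt_compat; nra].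
    - apply Rmult_le_pos; [lra | left; apply Rinv_0_lt_compat; nra]. }
  rewrite <- UA. apply Rabs_le_between in Dx.
  replace (kern_integral A x) with (U x - dev A x * (x / (x * x + A))) by (unfold U; ring).
  apply Rabs_le. lra.
Qed.

Lemma exp_sqrt_le_kernr (A x : R) : 0 < A -> 0 <= x <= A -> exp (sqrt (A * A - x * x)) <= kernr A x.
Proof.
  intros HA Hx. set (w := sqrt (A * A - x * x)).
  assert (Hw0 : 0 <= w) by apply sqrt_pos.
  assert (Hw : w * w = A * A - x * x) by (apply sqrt_sqrt; nra).
  assert (HwA : w <= A) by nra.
  unfold kernr. replace (x * x - A * A) with (- (w * w)) by lra.
  assert (S := mult_sinc_sqrt_neg w). rewrite cos_sqrt_neg.
  destruct (Req_dec w 0) as [E|E].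
  - rewrite E, exp_0, cosh_0. replace (- (0 * 0)) with 0 by ring.
    assert (S0 : sinc_sqrt 0 = 1) by (unfold sinc_sqrt; now rewrite csinc_sqrt_0). rewrite S0. lra.
  - assert (S' : w * sinc_sqrt (- (w * w)) = sinh w) by (apply Rmult_eq_reg_l with w; [lra | exact E]).
    assert (Sp : 0 <= sinh w).
    { unfold sinh. assert (exp (- w) <= exp w) by (apply exp_le; lra). lra. }
    assert (0 <= sinc_sqrt (- (w * w))).
    { apply Rmult_le_reg_l with w; [lra|]. rewrite Rmult_0_r, S'. exact Sp. }
    replace (exp w) with (cosh w + sinh w) by (unfold cosh, sinh; field). nra.
Qed.

Lemma continuous_exp_sqrt (A x : R) : continuous (fun x => exp (sqrt (A * A - x * x))) x.
Proof.
  apply (continuous_comp (fun x => sqrt (A * A - x * x)) exp).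
  - apply (continuous_comp (fun x => A * A - x * x) sqrt).
    + apply ex_derive_cont. now auto_derive.
    + apply continuous_sqrt.
  - apply continuous_exp.
Qed.

(** The approximating function is the primitive of [kern], divided by the constant around which
    it oscillates on [[A, +oo)]. *)
Theorem L_upper (A : R) : 0 < A ->
  L A <= (1 + 1 / A) / RInt (fun x => exp (sqrt (A * A - x * x))) 0 A.
Proof.
  intro HA. set (J := RInt _ 0 A).
  assert (HJ : 0 < J).
  { apply RInt_gt_0; [exact HA | intros; apply exp_pos | intros; apply continuous_exp_sqrt]. }
  assert (HP : J <= kern_integral A A).
  { apply RInt_le; [lra | | apply ex_RInt_kernr|].
    - apply ex_RInt_cont. intros; apply continuous_exp_sqrt.
    - intros x Hx. apply exp_sqrt_le_kernr; lra. }
  assert (HA1 : 0 < A / (A + 1)) by (apply Rdiv_lt_0_compat; lra).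
  set (k := kern_integral A A + A / (A + 1)). assert (Hk : J <= k) by (unfold k; lra).
  assert (H1A : 0 < 1 / A) by (apply Rdiv_lt_0_compat; lra).
  assert (H1A' : 1 / (A + 1) <= 1 / A).
  { unfold Rdiv. apply Rmult_le_compat_l; [lra|]. apply Rinv_le_contravar; lra. }
  apply (L_le A _ (fun z => RtoC (/ k) * primitive (kern A) z)%C).
  - intro z. apply holo_scal. eexists. apply diff_at_primitive, holo_kern.
  - now apply exp_type_primitive_kern.
  - assert (Pos : forall x, A <= x -> Rabs (/ k * kern_integral A x - 1) <= (1 + 1 / A) / J).
    { intros x Hx. replace (/ k * kern_integral A x - 1) with (/ k * (kern_integral A x - k)) by (field; lra).
      rewrite Rabs_mult, Rabs_pos_eq by (left; apply Rinv_0_lt_compat; lra).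
      unfold Rdiv. rewrite Rmult_comm. apply Rmult_le_compat.
      - apply Rabs_pos.
      - left; apply Rinv_0_lt_compat; lra.
      - eapply Rle_trans; [now apply kern_integral_deviation|]. lra.
      - apply Rinv_le_contravar; lra. }
    intros x Hx. rewrite primitive_kern_real, <- RtoC_mult, <- RtoC_minus, Cmod_R.
    destruct (Rle_dec 0 x) as [H|H].
    + rewrite Rabs_pos_eq in Hx by exact H. rewrite sign_eq_1 by lra. now apply Pos.
    + rewrite Rabs_left in Hx by lra. rewrite sign_eq_m1 by lra.
      replace x with (- - x) by ring. rewrite kern_integral_odd.
      replace (/ k * - kern_integral A (- x) - -1) with (- (/ k * kern_integral A (- x) - 1)) by ring.
      rewrite Rabs_Ropp. now apply Pos.
Qed.

(** * The nodes of the extremal measure *)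

Lemma pole_at_div (N D : C -> C) (p d : C) :
  cont_at N p -> diff_at D p d -> D p = 0 -> d <> 0 ->
  pole_at (fun z => N z / D z)%C p (N p / d)%C.
Proof.
  intros HN [phi [Hc [Ed E]]] D0 Hd eps He. subst d.
  destruct (cont_at_div N phi p HN Hc Hd eps He) as (d1 & Hd1 & H1).
  apply Cmod_gt_0 in Hd as Hp.
  destruct (Hc (Cmod (phi p)) Hp) as (d2 & Hd2 & H2).
  exists (Rmin d1 d2). split; [now apply Rmin_pos|]. intros w Hw Hwd.
  specialize (H1 w (Rlt_le_trans _ _ _ Hwd (Rmin_l _ _))).
  specialize (H2 w (Rlt_le_trans _ _ _ Hwd (Rmin_r _ _))).
  assert (Hphi : phi w <> 0).
  { intro E0. rewrite E0 in H2. replace (0 - phi p)%C with (- phi p)%C in H2 by ring.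
    rewrite Cmod_opp in H2. lra. }
  assert (Hwp : (w - p)%C <> 0) by now apply Csub_neq0.
  replace ((w - p) * (N w / D w))%C with (N w / phi w)%C; [exact H1|].
  rewrite (E w), D0. replace (0 + phi w * (w - p))%C with (phi w * (w - p))%C by ring.
  field. now split.
Qed.

(** The factor [z^2 - A^2] adds the end point [A] to the nodes and makes the residues of [1 / den]
    summable. *)
Definition den (A : R) (z : C) : C := ((z * z - A * A) * kern A z)%C.

Lemma den_root (A : R) (q z : C) : (q * q)%C = (z * z - A * A)%C ->
  den A z = (q * (q * ccos q + A * csin q))%C.
Proof.
  intro E. unfold den, kern. rewrite <- E.
  replace (q * q * (ccos_sqrt (q * q) + A * csinc_sqrt (q * q)))%C
    with (q * q * ccos_sqrt (q * q) + A * (q * q * csinc_sqrt (q * q)))%C by ring.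
  rewrite ccos_sqrt_sq, mult_csinc_sqrt_sq. ring.
Qed.

Lemma holo_den (A : R) (z : C) : holo (den A) z.
Proof.
  apply holo_mult; [|apply holo_kern].
  apply holo_minus; [apply holo_mult; apply holo_id | apply holo_const].
Qed.

(** The derivative of [v (ccos_sqrt v + A csinc_sqrt v)] with respect to [v = z^2 - A^2]. *)
Definition den_slope (A v : R) : R := cos_sqrt v - v * sinc_sqrt v / 2 + A * ((sinc_sqrt v + cos_sqrt v) / 2).

Lemma diff_at_den (A x : R) : diff_at (den A) (RtoC x) (RtoC (2 * x * den_slope A (x * x - A * A))).
Proof.
  set (v := x * x - A * A).
  assert (Hv : diff_at (fun z => z * z - A * A)%C (RtoC x) (2 * x)%C).
  { replace (2 * x)%C with (1 * x + x * 1 - 0)%C by ring.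
    apply diff_at_minus; [apply diff_at_mult; apply diff_at_id | apply diff_at_const]. }
  assert (Ev : (RtoC x * RtoC x - A * A)%C = RtoC v) by (unfold v; now rewrite RtoC_minus, !RtoC_mult).
  assert (D : diff_at (fun v => v * ccos_sqrt v + A * (v * csinc_sqrt v))%C (RtoC v) (RtoC (den_slope A v))).
  { replace (RtoC (den_slope A v)) with (1 * ccos_sqrt v + v * (- (/ 2) * csinc_sqrt v) + A * (/ 2 * (csinc_sqrt v + ccos_sqrt v)))%C.
    - apply diff_at_plus.
      + apply (diff_at_mult (fun v => v) ccos_sqrt); [apply diff_at_id | apply diff_at_ccos_sqrt].
      + apply diff_at_scal, diff_at_mult_csinc_sqrt.
    - rewrite ccos_sqrt_real, csinc_sqrt_real. unfold den_slope. apply injective_projections; simpl; field. }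
  rewrite <- Ev in D.
  assert (K := diff_at_comp _ _ _ _ _ Hv D).
  replace (RtoC (2 * x * den_slope A v)) with (RtoC (den_slope A v) * (2 * x))%C.
  - eapply diff_at_ext; [|exact K]. intro z. unfold den, kern. ring.
  - rewrite !RtoC_mult. ring.
Qed.

(** The argument of [(A + i q) exp (i q)]. *)
Definition phase (A q : R) : R := q + atan (q / A).

Lemma sin_phase (A q : R) : 0 < A ->
  A * sin q + q * cos q = sqrt (A * A + q * q) * sin (phase A q).
Proof.
  intro HA. unfold phase. rewrite sin_plus, sin_atan, cos_atan.
  assert (E : sqrt (A * A + q * q) = A * sqrt (1 + Rsqr (q / A))).
  { replace (A * A + q * q) with (Rsqr A * (1 + Rsqr (q / A))) by (unfold Rsqr; field; lra).
    rewrite sqrt_mult, sqrt_Rsqr; try lra; [apply Rle_0_sqr | generalize (Rle_0_sqr (q / A)); lra]. }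
  assert (Q : 0 < sqrt (1 + Rsqr (q / A))).
  { apply sqrt_lt_R0. generalize (Rle_0_sqr (q / A)). lra. }
  rewrite E. field. lra.
Qed.

Lemma phase_incr (A p q : R) : 0 < A -> p < q -> phase A p < phase A q.
Proof.
  intros HA H. unfold phase. assert (atan (p / A) < atan (q / A)); [|lra].
  apply atan_increasing. apply Rmult_lt_compat_r; [now apply Rinv_0_lt_compat | exact H].
Qed.

Lemma phase_0 (A : R) : phase A 0 = 0.
Proof. unfold phase. replace (0 / A) with 0 by (unfold Rdiv; ring). rewrite atan_0. ring. Qed.

Lemma phase_bounds (A q : R) : 0 < A -> 0 < q -> q < phase A q < q + PI / 2.
Proof.
  intros HA Hq. unfold phase. assert (B := atan_bound (q / A)).
  assert (P : 0 < atan (q / A)).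
  { rewrite <- atan_0. apply atan_increasing. now apply Rdiv_lt_0_compat. }
  lra.
Qed.

(** Every zero of [den] comes from a real [q]: the imaginary part of
    [A sin q * conj (cos q) = - q |cos q|^2] forbids [Im q <> 0]. *)
Lemma trig_zero_real (A a b : R) : 0 < A ->
  ((a, b) * ccos (a, b) + A * csin (a, b))%C = 0 -> b = 0.
Proof.
  intros HA E. rewrite ccos_components, csin_components in E.
  assert (E1 := f_equal fst E). assert (E2 := f_equal snd E). clear E. simpl in E1, E2.
  set (c := cos a) in *. set (s := sin a) in *. set (ch := cosh b) in *. set (sh := sinh b) in *.
  assert (T : s * s + c * c = 1) by (generalize (sin2_cos2 a); unfold Rsqr; fold s c; lra).
  assert (K : A * (sh * ch) = - b * ((c * ch) * (c * ch) + (s * sh) * (s * sh))).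
  { replace (sh * ch) with (sh * ch * (s * s + c * c)) by (rewrite T; ring).
    assert (E1' : A * (s * ch) = - (a * (c * ch) + b * (s * sh))) by lra.
    assert (E2' : A * (c * sh) = - (b * (c * ch) - a * (s * sh))) by lra.
    replace (A * (sh * ch * (s * s + c * c))) with (A * (c * sh) * (c * ch) + A * (s * ch) * (s * sh)) by ring.
    rewrite E1', E2'. ring. }
  assert (Hch : 0 < ch).
  { unfold ch, cosh. generalize (exp_pos b) (exp_pos (- b)). lra. }
  assert (S1 := Rle_0_sqr (c * ch)). assert (S2 := Rle_0_sqr (s * sh)). unfold Rsqr in S1, S2.
  set (X := c * ch * (c * ch) + s * sh * (s * sh)) in *.
  assert (HX : 0 <= X) by (unfold X; lra). clearbody X.
  destruct (Rtotal_order b 0) as [H|[H|H]]; [|exact H|].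
  - assert (sh < 0).
    { unfold sh, sinh. assert (exp b < exp (- b)) by (apply exp_increasing; lra). lra. }
    assert (0 < A * (- sh * ch)) by (apply Rmult_lt_0_compat; [exact HA | apply Rmult_lt_0_compat; lra]).
    assert (0 <= - b * X) by (apply Rmult_le_pos; lra). lra.
  - assert (0 < sh).
    { unfold sh, sinh. assert (exp (- b) < exp b) by (apply exp_increasing; lra). lra. }
    assert (0 < A * (sh * ch)) by (apply Rmult_lt_0_compat; [exact HA | apply Rmult_lt_0_compat; lra]).
    assert (0 <= b * X) by (apply Rmult_le_pos; lra). lra.
Qed.

Definition node (A q : R) : R := sqrt (A * A + q * q).

Lemma node_sq (A q : R) : node A q * node A q = A * A + q * q.
Proof. apply sqrt_sqrt. nra. Qed.

Lemma node_pos (A q : R) : 0 < A -> 0 < node A q.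
Proof. intro H. apply sqrt_lt_R0. nra. Qed.

Lemma node_incr (A p q : R) : 0 <= p -> p < q -> node A p < node A q.
Proof. intros Hp H. apply sqrt_lt_1; nra. Qed.

Lemma node_le_inv (A p q : R) : 0 <= p -> node A p <= node A q -> 0 <= q -> p <= q.
Proof.
  intros Hp H Hq. destruct (Rle_lt_dec p q) as [|K]; [assumption|].
  assert (L := node_incr A q p Hq K). lra.
Qed.

Lemma den_zero (A : R) (z : C) : 0 < A -> 0 <= fst z -> den A z = 0 ->
  exists q, 0 <= q /\ z = RtoC (node A q) /\ sin (phase A q) = 0.
Proof.
  intros HA Hz E. set (q := csqrt (z * z - A * A)%C).
  assert (Eq := csqrt_sq (z * z - A * A)%C). fold q in Eq.
  rewrite (den_root A q z Eq) in E.
  assert (Fin : forall p, 0 <= p -> (p * p)%C = (z * z - A * A)%C -> A * sin p + p * cos p = 0 ->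
    exists q, 0 <= q /\ z = RtoC (node A q) /\ sin (phase A q) = 0).
  { intros p Hp Ep Sp. exists p. split; [exact Hp|]. split.
    - assert (Ez : (z * z)%C = (RtoC (node A p) * RtoC (node A p))%C).
      { rewrite <- RtoC_mult, node_sq, RtoC_plus, !RtoC_mult, Ep. ring. }
      destruct (Csqr_eq _ _ Ez) as [K|K]; [exact K|].
      exfalso. apply (f_equal fst) in K. simpl in K. generalize (node_pos A p HA). lra.
    - rewrite sin_phase in Sp by exact HA. apply Rmult_integral in Sp.
      destruct Sp as [Sp|Sp]; [|exact Sp]. generalize (node_pos A p HA). unfold node. lra. }
  destruct (Ceq_dec q 0) as [Hq|Hq].
  - apply (Fin 0); [lra | rewrite <- Eq, Hq; ring | rewrite sin_0; ring].
  - assert (E' : (q * ccos q + A * csin q)%C = 0).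
    { destruct (Ceq_dec (q * ccos q + A * csin q)%C 0) as [K|K]; [exact K|].
      exfalso. now apply (Cmult_neq_0 _ _ Hq K). }
    clear E. destruct q as [a b]. assert (Hb := trig_zero_real A a b HA E'). subst b.
    change ((a, 0) : C) with (RtoC a) in *.
    rewrite ccos_real, csin_real, <- !RtoC_mult, <- RtoC_plus in E'. apply RtoC_inj in E'.
    destruct (Rle_dec 0 a) as [Ha|Ha].
    + apply (Fin a Ha Eq). lra.
    + apply (Fin (- a)); [lra | rewrite RtoC_opp, <- Eq; ring | rewrite sin_neg, cos_neg; lra].
Qed.

Lemma den_node (A q : R) : 0 < A -> sin (phase A q) = 0 -> den A (RtoC (node A q)) = 0.
Proof.
  intros HA E. rewrite (den_root A (RtoC q)).
  - rewrite ccos_real, csin_real, <- !RtoC_mult, <- RtoC_plus.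
    replace (q * cos q + A * sin q) with (A * sin q + q * cos q) by ring.
    rewrite sin_phase, E, Rmult_0_r by exact HA. ring.
  - rewrite <- !RtoC_mult, node_sq, <- RtoC_minus. f_equal. ring.
Qed.

(** At a node [A sin q = - q cos q] and hence [|cos q| = A / x]. *)
Lemma den_derivative_node (A q : R) : 0 < A -> 0 < q -> sin (phase A q) = 0 ->
  Rabs (2 * node A q * den_slope A (node A q * node A q - A * A)) = node A q * node A q + A.
Proof.
  intros HA Hq E. assert (S := sin_phase A q HA). rewrite E, Rmult_0_r in S.
  assert (N := node_pos A q HA). assert (N2 := node_sq A q). set (x := node A q) in *.
  assert (T := sin2_cos2 q). unfold Rsqr in T.
  replace (x * x - A * A) with (q * q) by lra.
  assert (Hs : sinc_sqrt (q * q) * q = sin q).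
  { apply Rmult_eq_reg_l with q; [|lra]. rewrite <- mult_sinc_sqrt_pos. ring. }
  assert (Es : sin q = - (q * cos q / A)) by (apply Rmult_eq_reg_l with A; [field_simplify; lra | lra]).
  assert (Esr : sinc_sqrt (q * q) = - (cos q / A)).
  { apply Rmult_eq_reg_r with q; [|lra]. rewrite Hs, Es. field. lra. }
  assert (Ec : (x * cos q) * (x * cos q) = A * A).
  { rewrite Es in T. replace (x * cos q * (x * cos q)) with (x * x * (cos q * cos q)) by ring.
    rewrite N2. apply Rmult_eq_reg_r with (/ (A * A)).
    - rewrite Rinv_r by nra. rewrite <- T. field. lra.
    - apply Rinv_neq_0_compat. nra. }
  unfold den_slope. rewrite Esr, cos_sqrt_pos.
  replace (2 * x * (cos q - q * q * - (cos q / A) / 2 + A * ((- (cos q / A) + cos q) / 2)))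
    with (x * cos q * ((A + (A * A + q * q)) / A)) by (field; lra).
  rewrite <- N2, Rabs_mult.
  assert (Ea : Rabs (x * cos q) = A).
  { rewrite <- sqrt_Rsqr_abs. unfold Rsqr. rewrite Ec. apply sqrt_square. lra. }
  rewrite Ea, Rabs_pos_eq; [field; lra|].
  apply Rmult_le_pos; [nra | left; now apply Rinv_0_lt_compat].
Qed.

Lemma den_slope_0 (A : R) : den_slope A 0 = 1 + A.
Proof.
  assert (S0 : sinc_sqrt 0 = 1) by (unfold sinc_sqrt; now rewrite csinc_sqrt_0).
  assert (C0 : cos_sqrt 0 = 1) by (replace 0 with (0 * 0) by ring; now rewrite cos_sqrt_pos, cos_0).
  unfold den_slope. rewrite S0, C0. field.
Qed.

(** The masses [1/(x^2+A)] at the nodes are dominated by increments of [atan (q/A)], because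
    [pi] is the increment of [phase] from [p] to [q], and the ratio [A / (x^2 + A)] of the
    derivatives of [atan (q/A)] and [phase] decreases in [q]. *)
Lemma mass_le_atan (A p q : R) : 0 < A -> 0 <= p -> p < q -> phase A q = phase A p + PI ->
  1 / (node A q * node A q + A) <= (atan (q / A) - atan (p / A)) / (PI * A).
Proof.
  intros HA Hp Hpq E. rewrite node_sq.
  set (k := A / (A * A + q * q + A)).
  assert (Pi := PI_RGT_0).
  assert (Mono : k * (phase A q - phase A p) <= atan (q / A) - atan (p / A)).
  { destruct (mean_value (fun t => atan (t / A) - k * (t + atan (t / A)))
      (fun t => A / (A * A + t * t) - k * (1 + A / (A * A + t * t))) p q) as [c [Hc Ec]].
    { intros t _. auto_derive; [lra|]. field. split; [nra|lra]. }
    rewrite Rmin_left, Rmax_right in Hc by lra.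
    assert (0 <= A / (A * A + c * c) - k * (1 + A / (A * A + c * c))).
    { replace (A / (A * A + c * c) - k * (1 + A / (A * A + c * c)))
        with (A * (q * q - c * c) / ((A * A + q * q + A) * (A * A + c * c)))
        by (unfold k; field; split; nra).
      apply Rmult_le_pos; [apply Rmult_le_pos; nra | left; apply Rinv_0_lt_compat].
      apply Rmult_lt_0_compat; nra. }
    unfold phase. nra. }
  rewrite E in Mono. replace (phase A p + PI - phase A p) with PI in Mono by ring.
  apply Rmult_le_reg_r with (PI * A); [nra|]. unfold Rdiv at 2.
  rewrite Rmult_assoc, Rinv_l, Rmult_1_r by nra.
  eapply Rle_trans; [|exact Mono]. right. unfold k. field. nra.
Qed.

(** * Growth of the denominator *)

Lemma Cmod_ccos_sqr (a b : R) :
  Cmod (ccos (a, b)) * Cmod (ccos (a, b)) = cos a * cos a + sinh b * sinh b.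
Proof.
  rewrite Cmod_sqr, ccos_components. simpl.
  assert (T := sin2_cos2 a). unfold Rsqr in T.
  assert (Ch : cosh b * cosh b = 1 + sinh b * sinh b).
  { unfold cosh, sinh. assert (E : exp b * exp (- b) = 1).
    { rewrite <- exp_plus, Rplus_opp_r. apply exp_0. } nra. }
  replace (cos a * cosh b * (cos a * cosh b) + - (sin a * sinh b) * - (sin a * sinh b))
    with (cos a * cos a * (cosh b * cosh b) + sin a * sin a * (sinh b * sinh b)) by ring.
  rewrite Ch. replace (sin a * sin a) with (1 - cos a * cos a) by lra. ring.
Qed.

Lemma Cmod_ccos_ge (a b : R) : 1 <= Rabs b \/ 1 / 2 <= Rabs (cos a) ->
  exp (Rabs b) / 8 <= Cmod (ccos (a, b)).
Proof.
  intro H. assert (P := Cmod_ge_0 (ccos (a, b))). assert (E := exp_pos (Rabs b)).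
  assert (Q := Cmod_ccos_sqr a b).
  assert (S1 := Rle_0_sqr (cos a)). assert (S2 := Rle_0_sqr (sinh b)). unfold Rsqr in S1, S2.
  apply Rsqr_incr_0_var; [unfold Rsqr; rewrite Q | exact P].
  destruct (Rle_dec 1 (Rabs b)) as [Hb|Hb].
  - assert (Sh : exp (Rabs b) / 8 <= Rabs (sinh b)).
    { assert (Ei : exp (Rabs b) * exp (- Rabs b) = 1) by (rewrite <- exp_plus, Rplus_opp_r; apply exp_0).
      assert (E1 := exp_ineq1_le (Rabs b)). assert (E2 := exp_pos (- Rabs b)).
      assert (E3 : exp (- Rabs b) <= exp (Rabs b) / 2) by nra.
      apply Rle_trans with ((exp (Rabs b) - exp (- Rabs b)) / 2); [lra|].
      unfold sinh. unfold Rabs at 1 2. destruct (Rcase_abs b).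
      - rewrite Ropp_involutive. eapply Rle_trans; [|rewrite <- Rabs_Ropp; apply Rle_abs]. lra.
      - apply Rle_abs. }
    assert (sinh b * sinh b = Rabs (sinh b) * Rabs (sinh b))
      by (rewrite <- Rabs_mult; symmetry; apply Rabs_pos_eq, S2).
    nra.
  - destruct H as [H|H]; [lra|].
    assert (E3 : exp (Rabs b) <= 3).
    { apply Rle_trans with (exp 1); [apply exp_le; lra | apply exp_le_3]. }
    assert (cos a * cos a = Rabs (cos a) * Rabs (cos a))
      by (rewrite <- Rabs_mult; symmetry; apply Rabs_pos_eq, S1).
    nra.
Qed.

Lemma root_components (A x y a b : R) :
  ((a, b) * (a, b))%C = ((x, y) * (x, y) - A * A)%C ->
  a * a - b * b = x * x - y * y - A * A /\
  x * x + y * y - A * A <= a * a + b * b <= x * x + y * y + A * A.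
Proof.
  intro E. assert (M := f_equal Cmod E). rewrite Cmod_mult, Cmod_sqr in M. simpl in M.
  assert (N : Cmod ((x, y) * (x, y))%C = x * x + y * y) by (now rewrite Cmod_mult, Cmod_sqr).
  assert (NA : Cmod (A * A)%C = A * A).
  { rewrite <- RtoC_mult, Cmod_R. apply Rabs_pos_eq, Rle_0_sqr. }
  split.
  - apply (f_equal fst) in E. simpl in E. lra.
  - assert (L := Cmod_sub_ge ((x, y) * (x, y))%C (A * A)%C).
    assert (U := Cmod_sub_le ((x, y) * (x, y))%C (A * A)%C). lra.
Qed.

(** [|Im q| >= |Im z|] by the triangle inequality for [|z^2 - A^2|], so nothing of the
    exponential is lost; for [|q| >= 16 A] the term [q cos q] dominates [A sin q], provided that
    [q] stays away from the zeros of the cosine. *)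
Lemma den_ge (A k x y : R) : 0 < A -> 16 * A <= k ->
  let q := csqrt ((x, y) * (x, y) - A * A)%C in
  k <= Cmod q -> 1 <= Rabs (snd q) \/ 1 / 2 <= Rabs (cos (fst q)) ->
  k * k / 16 * exp (Rabs y) <= Cmod (den A (x, y)).
Proof.
  intros HA Hk q Hq Hc.
  assert (Eq := csqrt_sq ((x, y) * (x, y) - A * A)%C). fold q in Eq. clearbody q.
  rewrite (den_root A q (x, y) Eq).
  destruct q as [a b]. simpl fst in Hc; simpl snd in Hc.
  destruct (root_components A x y a b Eq) as [R1 [R2 R3]].
  assert (Hb : Rabs y <= Rabs b) by (apply Rsqr_le_abs_0; unfold Rsqr; lra).
  assert (C1 := Cmod_ccos_ge a b Hc). assert (C2 := Cmod_csin_le (a, b)). simpl snd in C2.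
  rewrite Cmod_mult. assert (T := Cmod_add_ge ((a, b) * ccos (a, b))%C (A * csin (a, b))%C).
  rewrite !Cmod_mult, Cmod_R, (Rabs_pos_eq A) in T by lra.
  set (m := Cmod (a, b)) in *. assert (E := exp_pos (Rabs b)).
  assert (E' : exp (Rabs y) <= exp (Rabs b)) by now apply exp_le.
  assert (S : m * exp (Rabs b) / 16 <= Cmod ((a, b) * ccos (a, b) + A * csin (a, b))%C).
  { assert (m * (exp (Rabs b) / 8) <= m * Cmod (ccos (a, b))) by (apply Rmult_le_compat_l; lra).
    assert (A * Cmod (csin (a, b)) <= A * exp (Rabs b)) by (apply Rmult_le_compat_l; lra).
    assert (16 * A * exp (Rabs b) <= m * exp (Rabs b)) by (apply Rmult_le_compat_r; lra). lra. }
  apply Rle_trans with (m * (m * exp (Rabs b) / 16)); [|apply Rmult_le_compat_l; lra].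
  replace (k * k / 16 * exp (Rabs y)) with (k * k * exp (Rabs y) / 16) by field.
  replace (m * (m * exp (Rabs b) / 16)) with (m * m * exp (Rabs b) / 16) by field.
  apply Rmult_le_compat_r; [lra|].
  apply Rmult_le_compat; [apply Rmult_le_pos; lra | left; apply exp_pos | | exact E'].
  apply Rmult_le_compat; lra.
Qed.

Lemma Cmod_root_ge (A k x y : R) : 0 <= k ->
  k * k <= x * x + y * y - A * A -> k <= Cmod (csqrt ((x, y) * (x, y) - A * A)%C).
Proof.
  intros Hk H. assert (Eq := csqrt_sq ((x, y) * (x, y) - A * A)%C).
  set (q := csqrt _) in *. clearbody q. destruct q as [a b].
  destruct (root_components A x y a b Eq) as [R1 [R2 R3]].
  apply Rsqr_incr_0_var; [unfold Rsqr; rewrite Cmod_sqr; simpl; lra | apply Cmod_ge_0].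
Qed.

(** The value of [q] at which the contour separates the nodes of index [n] and [n + 1]. The
    shift by [1/4] keeps it away both from the zeros of the cosine and from the nodes, since
    [0 < phase A q - q < pi / 2]. *)
Definition cutq (n : nat) : R := (INR n + 1 / 4) * PI.

Lemma cos_cutq (n : nat) : cos (cutq n) * cos (cutq n) = 1 / 2.
Proof.
  assert (E : cos (2 * cutq n) = 0).
  { unfold cutq. replace (2 * ((INR n + 1 / 4) * PI)) with (PI / 2 + 2 * INR n * PI) by field.
    rewrite cos_period. apply cos_PI2. }
  rewrite cos_2a_cos in E. lra.
Qed.

Lemma cos_lip (s t : R) : Rabs (cos s - cos t) <= Rabs (s - t).
Proof.
  destruct (mean_value cos (fun u => - sin u) t s) as [c [_ E]].
  { intros u _. auto_derive; [easy | ring]. }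
  rewrite E, Rabs_mult. assert (B : Rabs (- sin c) <= 1) by (apply Rabs_le; generalize (SIN_bound c); lra).
  generalize (Rabs_pos (s - t)). nra.
Qed.

(** On the vertical line through the [n]-th cut, [Re q] stays within [A^2 / cutq n] of
    [cutq n], where [|cos|] is [1 / sqrt 2]. *)
Lemma den_ge_vertical (A y : R) (n : nat) : 0 < A -> 16 * A <= cutq n -> 10 * (A * A) <= cutq n ->
  cutq n * cutq n / 16 * exp (Rabs y) <= Cmod (den A (node A (cutq n), y)).
Proof.
  intros HA H1 H2. set (k := cutq n) in *. set (X := node A k).
  assert (X2 : X * X = A * A + k * k) by apply node_sq.
  assert (XP : 0 < X) by now apply node_pos.
  apply den_ge; trivial.
  - apply Cmod_root_ge; [nra|]. generalize (Rle_0_sqr y). unfold Rsqr. lra.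
  - right. assert (Eq := csqrt_sq ((X, y) * (X, y) - A * A)%C).
    assert (Ha : 0 <= fst (csqrt ((X, y) * (X, y) - A * A)%C)) by apply sqrt_pos.
    set (q := csqrt _) in *. clearbody q. destruct q as [a b]. simpl fst in *.
    destruct (root_components A X y a b Eq) as [R1 [R2 R3]].
    assert (Hak : k <= a) by nra.
    assert (HaX : a * a <= X * X) by lra.
    assert (D : a - k <= 1 / 10).
    { assert (H : (a - k) * (2 * k) <= A * A) by nra. nra. }
    assert (L := cos_lip a k). rewrite (Rabs_pos_eq (a - k)) in L by lra.
    assert (CK := cos_cutq n). fold k in CK.
    assert (CK' : 7 / 10 <= Rabs (cos k)).
    { assert (cos k * cos k = Rabs (cos k) * Rabs (cos k))
        by (rewrite <- Rabs_mult; symmetry; apply Rabs_pos_eq; lra).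
      generalize (Rabs_pos (cos k)). nra. }
    assert (T := Rabs_triang_inv (cos k) (cos a)). rewrite Rabs_minus_sym in T. lra.
Qed.

Lemma den_ge_horizontal (A k x y : R) : 0 < A -> 16 * A <= k -> 1 <= k ->
  A * A + k * k <= y * y -> k * k / 16 * exp (Rabs y) <= Cmod (den A (x, y)).
Proof.
  intros HA H1 H2 H. assert (Sx := Rle_0_sqr x). unfold Rsqr in Sx.
  apply den_ge; trivial.
  - apply Cmod_root_ge; lra.
  - left. assert (Eq := csqrt_sq ((x, y) * (x, y) - A * A)%C).
    set (q := csqrt _) in *. clearbody q. destruct q as [a b]. simpl snd.
    destruct (root_components A x y a b Eq) as [R1 [R2 R3]].
    rewrite <- (Rabs_pos_eq 1) by lra. apply Rsqr_le_abs_0. unfold Rsqr. nra.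
Qed.

(** * The contour argument *)

Definition quot (A : R) (f : C -> C) (z : C) : C := ((1 - f z) / den A z)%C.

Lemma sin_zero_between (t : R) (n : nat) : sin t = 0 ->
  (INR n - 1) * PI < t < (INR n + 1) * PI -> t = INR n * PI.
Proof.
  intros Hs [H1 H2]. destruct (sin_eq_0_0 t Hs) as [k ->].
  assert (P := PI_RGT_0).
  apply Rmult_lt_reg_r in H1; [|lra]. apply Rmult_lt_reg_r in H2; [|lra].
  rewrite INR_IZR_INZ in *. rewrite <- minus_IZR in H1. rewrite <- plus_IZR in H2.
  apply lt_IZR in H1. apply lt_IZR in H2. f_equal. f_equal. lia.
Qed.

Lemma quot_rect_node (A : R) (f : C -> C) (n : nat) (p a b Y m M : R) :
  0 < A -> (forall z, holo f z) -> 0 < Y -> 0 <= a ->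
  phase A p = INR n * PI -> 0 <= p -> a < node A p < b ->
  (forall q, 0 <= q -> a <= node A q <= b -> (INR n - 1) * PI < phase A q < (INR n + 1) * PI) ->
  0 < m -> Rabs (2 * node A p * den_slope A (node A p * node A p - A * A)) = m ->
  Cmod (1 - f (RtoC (node A p)))%C <= M ->
  Cmod (rect (quot A f) a b (- Y) Y) <= 2 * PI * (M / m).
Proof.
  intros HA Hf HY Ha Hp Hp0 Hab Hq Hm Em HM.
  set (x := node A p) in *. set (d := 2 * x * den_slope A (x * x - A * A)) in *.
  assert (Hd : d <> 0) by (intro E; rewrite E, Rabs_R0 in Em; lra).
  assert (HdC : RtoC d <> 0) by (intro E; apply Hd, RtoC_inj, E).
  assert (Sp : sin (phase A p) = 0).
  { apply sin_eq_0_1. exists (Z.of_nat n). now rewrite <- INR_IZR_INZ. }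
  assert (HN : forall z, holo (fun z => 1 - f z)%C z) by (intro z; apply holo_minus; [apply holo_const | apply Hf]).
  rewrite (residue_rect (quot A f) (RtoC x) ((1 - f (RtoC x)) / d)%C); simpl; try lra.
  - unfold Cdiv. rewrite !Cmod_mult, Cmod_Ci, Cmod_inv, !Cmod_R, Em by exact HdC.
    assert (P := PI_RGT_0). rewrite !Rabs_pos_eq by lra.
    rewrite Rmult_1_r. apply Rmult_le_compat_l; [lra|].
    apply Rmult_le_compat_r; [left; now apply Rinv_0_lt_compat | exact HM].
  - intros u v Hu Hv Hne. apply holo_div; [apply HN | apply holo_den|].
    intro E. apply den_zero in E; simpl; [|exact HA | lra].
    destruct E as [q [Hq0 [Eq Sq]]]. apply Hne. rewrite Eq.
    assert (Eu := f_equal fst Eq). simpl in Eu. subst u.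
    specialize (Hq q Hq0 Hu). apply (sin_zero_between _ n) in Sq; [|exact Hq].
    destruct (Rtotal_order q p) as [H|[H|H]].
    + apply (phase_incr A) in H; [lra | exact HA].
    + now subst q.
    + apply (phase_incr A) in H; [lra | exact HA].
  - apply (pole_at_div (fun z => 1 - f z)%C (den A)); [apply holo_cont, HN | apply diff_at_den | | exact HdC].
    now apply den_node.
Qed.

Lemma phase_node_exists (A : R) (n : nat) : 0 < A -> exists q, 0 <= q /\ phase A q = INR n * PI.
Proof.
  intro HA. assert (P := PI_RGT_0). assert (Pn := pos_INR n).
  assert (H0 : 0 <= INR n * PI) by nra.
  destruct (IVT_gen (phase A) 0 (INR n * PI) (INR n * PI)) as [q [Hq E]].
  - intro t. apply ex_derive_continuity_pt. unfold phase. auto_derive. lra.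
  - rewrite phase_0, Rmin_left by (destruct H0 as [H|H];
      [generalize (phase_bounds A _ HA H); lra | rewrite <- H, phase_0; lra]).
    split; [exact H0|]. eapply Rle_trans; [|apply Rmax_r].
    destruct H0 as [H|H]; [generalize (phase_bounds A _ HA H); lra | rewrite <- H, phase_0; lra].
  - exists q. rewrite Rmin_left in Hq by exact H0. split; [lra | exact E].
Qed.

Lemma phase_cutq (A : R) (n : nat) : 0 < A -> INR n * PI < phase A (cutq n) < (INR n + 1) * PI.
Proof.
  intro HA. assert (P := PI_RGT_0). assert (Pn := pos_INR n).
  assert (0 < cutq n) by (unfold cutq; nra).
  destruct (phase_bounds A (cutq n) HA H). unfold cutq in *. lra.
Qed.

Lemma phase_lt_inv (A p q : R) : 0 < A -> phase A p < phase A q -> p < q.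
Proof.
  intros HA H. destruct (Rlt_le_dec p q) as [|K]; [assumption|exfalso].
  destruct K as [K|K]; [apply (phase_incr A) in K; [lra | exact HA] | subst; lra].
Qed.

Lemma phase_le (A p q : R) : 0 < A -> p <= q -> phase A p <= phase A q.
Proof. intros HA [H|H]; [left; now apply phase_incr | subst; lra]. Qed.

Lemma cont_at_quot (A : R) (f : C -> C) (z : C) : (forall z, holo f z) ->
  den A z <> 0 -> cont_at (quot A f) z.
Proof.
  intros Hf H. apply holo_cont, holo_div; [|apply holo_den | exact H].
  apply holo_minus; [apply holo_const | apply Hf].
Qed.

Lemma den_nz_off_axis (A x y : R) : 0 < A -> 0 <= x -> y <> 0 -> den A (x, y) <> 0.
Proof.
  intros HA Hx Hy E. apply den_zero in E; [|exact HA | exact Hx].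
  destruct E as [q [_ [E _]]]. apply Hy. now apply (f_equal snd) in E.
Qed.

Lemma den_nz_cut (A y : R) (n : nat) : 0 < A -> den A (node A (cutq n), y) <> 0.
Proof.
  intros HA E. assert (N := node_pos A (cutq n) HA).
  assert (C := phase_cutq A n HA). assert (Pn := pos_INR n). assert (P := PI_RGT_0).
  assert (Hc : 0 <= cutq n) by (unfold cutq; nra).
  apply den_zero in E; [|exact HA | simpl; lra].
  destruct E as [q [Hq [E S]]]. apply (f_equal fst) in E. simpl in E.
  assert (q = cutq n).
  { apply Rle_antisym; apply (node_le_inv A); lra. }
  subst q. destruct (sin_eq_0_0 _ S) as [k Ek]. rewrite Ek, INR_IZR_INZ in C.
  destruct C as [C1 C2]. apply Rmult_lt_reg_r in C1; [|lra]. apply Rmult_lt_reg_r in C2; [|lra].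
  rewrite <- plus_IZR in C2. apply lt_IZR in C1. apply lt_IZR in C2. lia.
Qed.

Lemma den_nz_imaginary (A y : R) : 0 < A -> den A (0, y) <> 0.
Proof.
  intros HA E. apply den_zero in E; [|exact HA | simpl; lra].
  destruct E as [q [_ [E _]]]. apply (f_equal fst) in E. simpl in E.
  generalize (node_pos A q HA). lra.
Qed.

(** The residues up to the [n]-th node add up to at most [M] times their total mass, which is
    bounded by telescoping. *)
Lemma quot_rect_bound (A : R) (f : C -> C) (M Y : R) : 0 < A -> (forall z, holo f z) -> 0 < Y ->
  (forall x, A <= x -> Cmod (1 - f (RtoC x))%C <= M) ->
  forall n, exists p, 0 <= p /\ phase A p = INR n * PI /\
    Cmod (rect (quot A f) 0 (node A (cutq n)) (- Y) Y)
      <= 2 * PI * (M / (2 * A * (A + 1)) + M * (atan (p / A) / (PI * A))).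
Proof.
  intros HA Hf HY HM.
  assert (Pi := PI_RGT_0).
  assert (NA : forall q, A <= node A q).
  { intro q. apply Rsqr_incr_0_var; [unfold Rsqr; rewrite node_sq|left; now apply node_pos].
    generalize (Rle_0_sqr q). unfold Rsqr. lra. }
  assert (N0 : node A 0 = A).
  { unfold node. replace (A * A + 0 * 0) with (A * A) by ring. apply sqrt_square. lra. }
  assert (HM0 : 0 <= M) by (eapply Rle_trans; [apply Cmod_ge_0 | apply (HM A); lra]).
  assert (Cpos : forall n, 0 < cutq n) by (intro n; generalize (pos_INR n); unfold cutq; nra).
  induction n as [|n [p [Hp0 [Hp IH]]]].
  - exists 0. rewrite phase_0. split; [lra|]. split; [simpl; ring|].
    replace (atan (0 / A)) with 0 by (unfold Rdiv; rewrite Rmult_0_l, atan_0; reflexivity).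
    replace (M * (0 / (PI * A))) with 0 by (unfold Rdiv; ring). rewrite Rplus_0_r.
    apply (quot_rect_node A f 0 0); trivial; try lra.
    + rewrite phase_0. simpl. ring.
    + split; [rewrite N0; exact HA|]. apply node_incr; [lra | apply Cpos].
    + intros q Hq [_ Hn]. assert (K : q <= cutq 0) by (apply (node_le_inv A); trivial; left; apply Cpos).
      assert (C := phase_cutq A 0 HA). apply (phase_le A) in K; [|exact HA].
      apply (phase_le A) in Hq; [|exact HA]. rewrite phase_0 in Hq. simpl in *. lra.
    + nra.
    + rewrite N0. replace (A * A - A * A) with 0 by ring. rewrite den_slope_0, Rabs_pos_eq; nra.
    + rewrite N0. apply HM. lra.
  - destruct (phase_node_exists A (S n) HA) as [q [Hq0 Hq]].
    assert (Pn := pos_INR n).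
    assert (C1 := phase_cutq A n HA). assert (C2 := phase_cutq A (S n) HA).
    rewrite S_INR in *.
    assert (Hpq : p < q) by (apply (phase_lt_inv A); trivial; rewrite Hp, Hq; lra).
    assert (K1 : cutq n < q) by (apply (phase_lt_inv A); trivial; lra).
    assert (K2 : q < cutq (S n)) by (apply (phase_lt_inv A); trivial; lra).
    exists q. split; [exact Hq0|]. split; [exact Hq|].
    rewrite <- (rect_split_x (quot A f) 0 (node A (cutq n)) (node A (cutq (S n)))).
    + eapply Rle_trans; [apply Cmod_triangle|].
      assert (B : Cmod (rect (quot A f) (node A (cutq n)) (node A (cutq (S n))) (- Y) Y)
               <= 2 * PI * (M / (node A q * node A q + A))).
      { apply (quot_rect_node A f (S n) q); trivial; try lra.
        - left. now apply node_pos.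
        - now rewrite S_INR.
        - split; apply node_incr; trivial; left; apply Cpos.
        - intros t Ht [T1 T2]. rewrite S_INR.
          assert (T1' : cutq n <= t) by (apply (node_le_inv A); trivial; left; apply Cpos).
          assert (T2' : t <= cutq (S n)) by (apply (node_le_inv A); trivial; left; apply Cpos).
          apply (phase_le A) in T1', T2'; trivial. lra.
        - generalize (node_sq A q). nra.
        - apply den_derivative_node; trivial; [lra|].
          apply sin_eq_0_1. exists (Z.of_nat (S n)). now rewrite <- INR_IZR_INZ, S_INR.
        - apply HM, NA. }
      assert (Mass := mass_le_atan A p q HA Hp0 Hpq ltac:(rewrite Hp, Hq; ring)).
      apply (Rmult_le_compat_l M) in Mass; [|exact HM0].
      replace (M * (1 / (node A q * node A q + A))) with (M / (node A q * node A q + A)) in Mass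
        by (unfold Rdiv; ring).
      replace (M * ((atan (q / A) - atan (p / A)) / (PI * A)))
        with (M * (atan (q / A) / (PI * A)) - M * (atan (p / A) / (PI * A))) in Mass
        by (unfold Rdiv; ring).
      nra.
    + split; [left; now apply node_pos | left; apply node_incr; [left; apply Cpos|]; lra].
    + lra.
    + split.
      * intros t Ht. split; apply cont_at_quot; trivial; apply den_nz_off_axis; lra.
      * intros t _. split; apply cont_at_quot; trivial; [now apply den_nz_imaginary | now apply den_nz_cut].
Qed.

(** * The lower bound *)

Definition denr (A y : R) : R := node A y * (node A y * cosh (node A y) + A * sinh (node A y)).

Lemma den_imaginary (A y : R) : den A (0, y) = RtoC (- denr A y).
Proof.
  assert (N := node_sq A y). unfold denr. set (r := node A y) in *.
  rewrite (den_root A (0, r)).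
  - rewrite ccos_components, csin_components, cos_0, sin_0.
    apply injective_projections; simpl; ring.
  - apply injective_projections; simpl; lra.
Qed.

Lemma denr_bounds (A y : R) : 0 < A ->
  0 < denr A y <= (A * A + y * y) * exp (node A y).
Proof.
  intro HA. assert (N := node_sq A y). assert (P := node_pos A y HA). unfold denr.
  assert (HAr : A <= node A y) by nra.
  rewrite <- N. set (r := node A y) in *.
  assert (E1 : exp (- r) <= exp r) by (apply exp_le; lra).
  assert (E2 := exp_pos r). assert (E3 := exp_pos (- r)).
  assert (Ch : 0 < cosh r) by (unfold cosh; lra). assert (Sh : 0 <= sinh r) by (unfold sinh; lra).
  assert (Es : cosh r + sinh r = exp r) by (unfold cosh, sinh; field).
  assert (Hs : A * sinh r <= r * sinh r) by (apply Rmult_le_compat_r; assumption).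
  assert (Hc : 0 < r * cosh r) by (apply Rmult_lt_0_compat; assumption).
  assert (Hs0 : 0 <= A * sinh r) by (apply Rmult_le_pos; lra).
  rewrite <- Es, Rmult_assoc. split.
  - apply Rmult_lt_0_compat; lra.
  - apply Rmult_le_compat_l; lra.
Qed.

Lemma continuous_exp_node (A y : R) : 0 < A ->
  continuous (fun y => exp (- node A y) / (A * A + y * y)) y.
Proof.
  intro HA. apply ex_derive_cont. unfold node. auto_derive.
  assert (0 < A * A + y * y) by nra. repeat split; lra.
Qed.

(** The part of the contour on the imaginary axis; [f] drops out because it is odd. *)
Lemma imaginary_axis_integral (A X : R) (f : C -> C) : 0 < A -> 0 < X ->
  (forall z, holo f z) -> (forall z, f (- z)%C = (- f z)%C) ->
  2 * RInt (fun y => exp (- node A y) / (A * A + y * y)) 0 X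
   <= Cmod (CInt (fun y => quot A f (0, y)) (- X) X).
Proof.
  intros HA HX Hf Hodd.
  set (h := fun y => fst (quot A f (0, y))).
  assert (Hc : forall y, continuous h y).
  { intro y. apply (rcont_vertical (quot A f) 0 y).
    apply cont_at_quot; [exact Hf | now apply den_nz_imaginary]. }
  assert (Hex : forall a b, ex_RInt h a b).
  { intros a b. apply ex_RInt_cont. intros; apply Hc. }
  assert (Hopp : ex_RInt (fun y => h (- y)) 0 X).
  { apply ex_RInt_cont. intros y _.
    apply (continuous_comp Ropp h); [|apply Hc]. apply (continuous_opp (V := R_NormedModule)), continuous_id. }
  assert (Hh : forall y, h y = - ((1 - fst (f (0, y))) / denr A y)).
  { intro y. destruct (denr_bounds A y HA) as [Hd _]. unfold h, quot. rewrite den_imaginary.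
    unfold Cdiv. rewrite <- RtoC_inv by lra. simpl. field. lra. }
  assert (Sym : forall y, h y + h (- y) = - (2 / denr A y)).
  { intro y. rewrite !Hh.
    assert (Ed : denr A (- y) = denr A y) by (unfold denr, node; now replace (- y * - y) with (y * y) by ring).
    rewrite Ed. replace ((0, (- y)%R) : C) with (- (0, y))%C by (apply injective_projections; simpl; ring).
    rewrite Hodd. simpl. destruct (denr_bounds A y HA) as [Hd _]. field. lra. }
  assert (E : RInt h (- X) X = RInt (fun y => - (2 / denr A y)) 0 X).
  { rewrite <- (RInt_Chasles (V := R_CompleteNormedModule) h (- X) 0 X) by apply Hex.
    assert (E1 : RInt h (- X) 0 = RInt (fun y => h (- y)) 0 X).
    { symmetry. apply is_RInt_unique.
      apply (is_RInt_ext (fun y => - - h (- y))).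
      { intros y _. apply Ropp_involutive. }
      replace (RInt h (- X) 0) with (- - RInt h (- X) 0) by ring.
      apply (is_RInt_opp (V := R_NormedModule)).
      apply (is_RInt_comp_opp (V := R_NormedModule) h).
      replace (- 0) with 0 by ring.
      assert (S := is_RInt_swap _ _ _ _ (RInt_correct (V := R_CompleteNormedModule) _ _ _ (Hex (- X) 0))).
      exact S. }
    rewrite E1. 
    assert (Pl := RInt_plus (V := R_CompleteNormedModule) (fun y => h (- y)) h 0 X Hopp (Hex 0 X)).
    rewrite <- Pl. apply RInt_ext. intros y _. rewrite <- Sym. apply Rplus_comm. }
  eapply Rle_trans; [|apply fst_le_Cmod].
  change (fst (CInt (fun y => quot A f (0, y)) (- X) X)) with (RInt h (- X) X).
  rewrite <- Rabs_Ropp. eapply Rle_trans; [|apply Rle_abs]. rewrite E.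
  assert (Ex2 : ex_RInt (fun y => 2 / denr A y) 0 X).
  { apply (ex_RInt_ext (fun y => opp (h (- y) + h y))).
    - intros y _. unfold opp; simpl. rewrite Rplus_comm, Sym. apply Ropp_involutive.
    - apply (ex_RInt_opp (V := R_NormedModule)), (ex_RInt_plus (V := R_NormedModule)); [exact Hopp | apply Hex]. }
  assert (Exw : ex_RInt (fun y => exp (- node A y) / (A * A + y * y)) 0 X).
  { apply ex_RInt_cont. intros; now apply continuous_exp_node. }
  assert (Eo : RInt (fun y => - (2 / denr A y)) 0 X = - RInt (fun y => 2 / denr A y) 0 X)
    by exact (RInt_opp (V := R_CompleteNormedModule) _ _ _ Ex2).
  assert (Es := RInt_scal (V := R_CompleteNormedModule) _ _ _ 2 Exw).
  change (2 * RInt (fun y => exp (- node A y) / (A * A + y * y)) 0 X)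
    with (scal 2 (RInt (fun y => exp (- node A y) / (A * A + y * y)) 0 X)).
  rewrite <- Es.
  rewrite Eo, Ropp_involutive.
  apply RInt_le; [lra | now apply (ex_RInt_scal (V := R_NormedModule)) | exact Ex2|].
  intros y _. unfold scal; simpl. unfold mult; simpl.
  destruct (denr_bounds A y HA) as [D1 D2]. assert (E0 := exp_pos (node A y)).
  assert (P2 : 0 < A * A + y * y) by nra.
  unfold Rdiv. apply Rmult_le_compat_l; [lra|].
  rewrite exp_Ropp, <- Rinv_mult. apply Rinv_le_contravar; [exact D1|]. lra.
Qed.

Lemma quot_le (A B k x y : R) (f : C -> C) : 0 < k -> 0 <= B ->
  Cmod (f (x, y)) <= B * exp (Rabs y) ->
  k * k / 16 * exp (Rabs y) <= Cmod (den A (x, y)) ->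
  Cmod (quot A f (x, y)) <= 16 * (1 + B) / (k * k).
Proof.
  intros Hk HB Hf Hd. assert (E : 1 <= exp (Rabs y)).
  { rewrite <- exp_0 at 1. apply exp_le, Rabs_pos. }
  assert (Hk2 : 0 < k * k) by nra.
  assert (Hd0 : 0 < Cmod (den A (x, y))) by nra.
  unfold quot, Cdiv. rewrite Cmod_mult, Cmod_inv by (apply Cmod_gt_0; exact Hd0).
  apply Rmult_le_reg_r with (Cmod (den A (x, y))); [exact Hd0|].
  rewrite Rmult_assoc, Rinv_l, Rmult_1_r by lra.
  eapply Rle_trans; [apply Cmod_sub_le|]. rewrite Cmod_1.
  apply Rle_trans with (16 * (1 + B) / (k * k) * (k * k / 16 * exp (Rabs y))).
  - replace (16 * (1 + B) / (k * k) * (k * k / 16 * exp (Rabs y))) with ((1 + B) * exp (Rabs y))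
      by (field; lra). lra.
  - apply Rmult_le_compat_l; [|exact Hd].
    apply Rmult_le_pos; [lra | left; now apply Rinv_0_lt_compat].
Qed.

(** Let the rectangle [[0, X] x [-X, X]] grow: the three sides off the imaginary axis have total
    length [4 X] and carry an integrand of size [O(1 / X^2)]. *)
Theorem deviation_lower_bound (A M B Y : R) (f : C -> C) : 0 < A -> 0 < Y ->
  (forall z, holo f z) -> (forall z, f (- z)%C = (- f z)%C) ->
  (forall z, Cmod (f z) <= B * exp (Rabs (snd z))) ->
  (forall x, A <= x -> Cmod (1 - f (RtoC x))%C <= M) ->
  RInt (fun y => exp (- node A y) / (A * A + y * y)) 0 Y
    <= PI * M / (2 * A) * (1 + 1 / (A + 1)).
Proof.
  intros HA HY Hf Hodd HB HM.
  assert (HB0 : 0 <= B).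
  { assert (H := HB 0). simpl in H. rewrite Rabs_R0, exp_0 in H. generalize (Cmod_ge_0 (f 0)). lra. }
  assert (HM0 : 0 <= M) by (eapply Rle_trans; [apply Cmod_ge_0 | apply (HM A); lra]).
  assert (Pi := PI_RGT_0).
  apply le_epsilon. intros e He.
  destruct (INR_unbounded (16 * A + 10 * (A * A) + 1 + Y + 64 * (1 + B) / e)) as [n Hn].
  assert (Pe : 0 <= 64 * (1 + B) / e) by (apply Rmult_le_pos; [lra | left; now apply Rinv_0_lt_compat]).
  assert (HA2 : 0 < A * A) by nra.
  set (k := cutq n).
  assert (Hk : INR n <= k) by (unfold k, cutq; generalize PI2_1; nra).
  set (X := node A k).
  assert (X2 : X * X = A * A + k * k) by apply node_sq.
  assert (XP : 0 < X) by now apply node_pos.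
  assert (Xk : k <= X) by nra. assert (Xk2 : X <= 2 * k) by nra.
  destruct (quot_rect_bound A f M X HA Hf XP HM n) as [p [Hp0 [_ HR]]].
  fold k in HR. fold X in HR.
  set (c := 16 * (1 + B) / (k * k)).
  assert (Hc : 0 <= c) by (apply Rmult_le_pos; [lra | left; apply Rinv_0_lt_compat; nra]).
  assert (CB : on_boundary (cont_at (quot A f)) 0 X (- X) X).
  { split.
    - intros t Ht. split; apply cont_at_quot; trivial; apply den_nz_off_axis; lra.
    - intros t _. split; apply cont_at_quot; trivial; [now apply den_nz_imaginary | now apply den_nz_cut]. }
  destruct (boundary_rcont (quot A f) 0 X (- X) X) as (F1 & F2 & F3 & F4); trivial; try lra.
  assert (Hor : forall t y, y = X \/ y = - X -> Cmod (quot A f (t, y)) <= c).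
  { intros t y Hy. apply (quot_le A B k); [lra | exact HB0 | apply HB|].
    apply den_ge_horizontal; try lra. destruct Hy as [-> | ->]; lra. }
  assert (Ver : forall y, Cmod (quot A f (X, y)) <= c).
  { intros y. apply (quot_le A B k); [lra | exact HB0 | apply HB|].
    apply den_ge_vertical; fold k; lra. }
  assert (B1 := CInt_bound _ 0 X c ltac:(lra) F1 (fun t _ => Hor t (- X) (or_intror eq_refl))).
  assert (B2 := CInt_bound _ 0 X c ltac:(lra) F2 (fun t _ => Hor t X (or_introl eq_refl))).
  assert (B4 := CInt_bound _ (- X) X c ltac:(lra) F4 (fun t _ => Ver t)).
  assert (V := imaginary_axis_integral A X f HA XP Hf Hodd).
  set (Vl := CInt (fun y => quot A f (0, y)) (- X) X) in *.
  assert (EV : (Ci * Vl)%C = ((CInt (fun x => quot A f (x, (- X)%R)) 0 X - CInt (fun x => quot A f (x, X)) 0 X)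
     + (Ci * CInt (fun y => quot A f (X, y)) (- X) X - rect (quot A f) 0 X (- X) X))%C).
  { unfold rect. fold Vl. ring. }
  apply (f_equal Cmod) in EV. rewrite Cmod_mult, Cmod_Ci, Rmult_1_l in EV.
  assert (T1 := Cmod_triangle (CInt (fun x => quot A f (x, (- X)%R)) 0 X - CInt (fun x => quot A f (x, X)) 0 X)
    (Ci * CInt (fun y => quot A f (X, y)) (- X) X - rect (quot A f) 0 X (- X) X)).
  assert (T2 := Cmod_sub_le (CInt (fun x => quot A f (x, (- X)%R)) 0 X) (CInt (fun x => quot A f (x, X)) 0 X)).
  assert (T3 := Cmod_sub_le (Ci * CInt (fun y => quot A f (X, y)) (- X) X) (rect (quot A f) 0 X (- X) X)).
  rewrite Cmod_mult, Cmod_Ci, Rmult_1_l in T3.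
  assert (Sm : 4 * X * c <= 2 * e).
  { apply Rle_trans with (4 * (2 * k) * c); [apply Rmult_le_compat_r; lra|].
    unfold c. replace (4 * (2 * k) * (16 * (1 + B) / (k * k))) with (2 * (64 * (1 + B) / k)) by (field; lra).
    apply Rmult_le_compat_l; [lra|]. apply Rmult_le_reg_r with k; [lra|].
    unfold Rdiv. rewrite Rmult_assoc, Rinv_l, Rmult_1_r by lra.
    assert (K : e * (64 * (1 + B) / e) <= e * k) by (apply Rmult_le_compat_l; lra).
    replace (e * (64 * (1 + B) / e)) with (64 * (1 + B)) in K by (field; lra). lra. }
  assert (At : M * (atan (p / A) / (PI * A)) <= M / (2 * A)).
  { unfold Rdiv at 3. apply Rmult_le_compat_l; [exact HM0|].
    assert (Ba := atan_bound (p / A)).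
    apply Rmult_le_reg_r with (PI * A); [nra|]. unfold Rdiv at 1.
    rewrite Rmult_assoc, Rinv_l, Rmult_1_r by nra.
    replace (/ (2 * A) * (PI * A)) with (PI / 2) by (field; lra). lra. }
  assert (Mono : RInt (fun y => exp (- node A y) / (A * A + y * y)) 0 Y
     <= RInt (fun y => exp (- node A y) / (A * A + y * y)) 0 X).
  { assert (Ex : forall a b, ex_RInt (fun y => exp (- node A y) / (A * A + y * y)) a b).
    { intros. apply ex_RInt_cont. intros; now apply continuous_exp_node. }
    rewrite <- (RInt_Chasles (V := R_CompleteNormedModule) _ 0 Y X (Ex _ _) (Ex _ _)).
    unfold plus; simpl.
    assert (0 <= RInt (fun y => exp (- node A y) / (A * A + y * y)) Y X); [|lra].
    apply RInt_ge_0; [lra | apply Ex|]. intros y _.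
    apply Rmult_le_pos; [left; apply exp_pos | left; apply Rinv_0_lt_compat; nra]. }
  replace (PI * M / (2 * A) * (1 + 1 / (A + 1)))
    with (PI * (M / (2 * A * (A + 1)) + M / (2 * A))) by (field; lra).
  assert (2 * PI * (M / (2 * A * (A + 1)) + M * (atan (p / A) / (PI * A)))
    <= 2 * PI * (M / (2 * A * (A + 1)) + M / (2 * A))) by (apply Rmult_le_compat_l; lra).
  lra.
Qed.

(** Let [l = A / A' < 1]. As [f] has type at most [1 < 1 / l], [exponential_type_bound] bounds
    [f z] by a multiple of [exp (|Im z| / l)], hence [f (l z)] by a multiple of [exp |Im z|].
    The odd part of [f (l z)] approximates the sign on [|x| >= A'] as well as [f] does on
    [|x| >= A]. *)
Theorem L_lower_integral (A A' Y : R) : 0 < A -> A < A' -> 0 < Y ->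
  2 * A' / PI * RInt (fun y => exp (- node A' y) / (A' * A' + y * y)) 0 Y / (1 + 1 / (A' + 1)) <= L A.
Proof.
  intros HA HA' HY. apply L_ge. intros f M Hf Ht HM.
  set (l := A / A'). assert (Hl : 0 < l) by (apply Rdiv_lt_0_compat; lra).
  assert (ElA : l * A' = A) by (unfold l; field; lra).
  assert (Hsg : 1 < / l).
  { apply Rmult_lt_reg_l with l; [exact Hl|]. rewrite Rinv_r by lra. nra. }
  destruct (exp_type_le f Ht (/ l) Hsg) as (r & Hr & Hgrowth).
  assert (HM0 : 0 <= M).
  { eapply Rle_trans; [apply Cmod_ge_0 | apply (HM A)]. rewrite Rabs_pos_eq; lra. }
  destruct (bounded_on_segment (fun t => f (t, 0)) (- A) A) as [K HK].
  { intro t. apply rcont_horizontal, holo_cont, Hf. }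
  assert (HK0 : 0 <= K) by (eapply Rle_trans; [apply Cmod_ge_0 | apply (HK 0); lra]).
  destruct (exponential_type_bound f (/ l) r (M + 1 + K) Hf) as [B HB]; [lra | exact Hgrowth | |].
  { intro x. destruct (Rle_dec A (Rabs x)) as [H|H].
    - specialize (HM x H). assert (T := Cmod_sub_ge (f x) (sign x)). rewrite Cmod_R in T.
      assert (Rabs (sign x) <= 1).
      { apply Rabs_le. unfold sign. destruct (total_order_T 0 x) as [[?|?]|?]; lra. }
      lra.
    - assert (Hx : - A <= x <= A) by (apply Rabs_le_between; lra).
      specialize (HK x Hx). change (Cmod (f x) <= K) in HK. lra. }
  set (g := fun z => (/ 2 * (f (l * z) - f (- (l * z))))%C).
  assert (Mhalf : Cmod (/ 2) = / 2) by (rewrite Cmod_inv, Cmod_R, Rabs_pos_eq; [reflexivity | lra | apply C2_nz]).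
  assert (Bd := deviation_lower_bound A' M B Y g).
  assert (J : RInt (fun y => exp (- node A' y) / (A' * A' + y * y)) 0 Y
    <= PI * M / (2 * A') * (1 + 1 / (A' + 1))).
  { apply Bd; try lra; clear Bd.
    - intro z. unfold g. apply holo_scal, holo_minus.
      + apply (holo_comp (fun z => l * z)%C f); [apply holo_scal, holo_id | apply Hf].
      + apply (holo_comp (fun z => - (l * z))%C f); [|apply Hf].
        apply (holo_ext (fun z => - l * z)%C); [intro; ring|]. apply holo_scal, holo_id.
    - intro z. unfold g. replace (l * - z)%C with (- (l * z))%C by ring.
      replace (- - (l * z))%C with (l * z)%C by ring. ring.
    - intro z. unfold g. rewrite Cmod_mult, Mhalf.
      assert (T := Cmod_sub_le (f (l * z)%C) (f (- (l * z))%C)).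
      assert (H1 := HB (l * z)%C). assert (H2 := HB (- (l * z))%C).
      assert (E : / l * Rabs (snd (l * z)%C) = Rabs (snd z)).
      { simpl. replace (l * snd z + 0 * fst z) with (l * snd z) by ring.
        rewrite Rabs_mult, (Rabs_pos_eq l) by lra. field. lra. }
      change (snd (- (l * z))%C) with (- snd (l * z)%C) in H2. rewrite Rabs_Ropp in H2.
      rewrite E in H1, H2. lra.
    - intros x Hx. assert (Hlx : A <= l * x) by nra.
      assert (H1 := HM (l * x)). assert (H2 := HM (- (l * x))).
      rewrite Rabs_Ropp in H2. rewrite Rabs_pos_eq in H1, H2 by lra.
      rewrite sign_eq_1 in H1 by lra. rewrite sign_eq_m1 in H2 by lra.
      specialize (H1 Hlx). specialize (H2 Hlx). rewrite RtoC_opp, !RtoC_mult in *.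
      unfold g.
      replace (1 - / 2 * (f (l * x) - f (- (l * x))))%C
        with (/ 2 * (- (f (l * x) - 1) + (f (- (l * x)) - - (1))))%C by cfield.
      rewrite Cmod_mult, Mhalf.
      assert (T := Cmod_triangle (- (f (l * x) - 1))%C (f (- (l * x)) - - (1))%C).
      rewrite Cmod_opp in T.
      replace (RtoC (-1)) with (- (1))%C in H2 by (apply injective_projections; simpl; ring). lra. }
  assert (P := PI_RGT_0).
  assert (Q : 0 < 1 + 1 / (A' + 1)) by (assert (0 < 1 / (A' + 1)) by (apply Rdiv_lt_0_compat; lra); lra).
  apply Rmult_le_reg_r with (1 + 1 / (A' + 1)); [exact Q|].
  unfold Rdiv at 1. rewrite Rmult_assoc, Rinv_l, Rmult_1_r by lra.
  apply Rmult_le_compat_l with (r := 2 * A' / PI) in J.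
  2: { apply Rmult_le_pos; [lra | left; now apply Rinv_0_lt_compat]. }
  replace (2 * A' / PI * (PI * M / (2 * A') * (1 + 1 / (A' + 1)))) with (M * (1 + 1 / (A' + 1))) in J
    by (field; lra).
  exact J.
Qed.

(** * The Gaussian integral *)

Definition gauss (T : R) : R := RInt (fun t => exp (- (t * t / 2))) 0 T.

Lemma continuous_gauss_density (t : R) : continuous (fun t => exp (- (t * t / 2))) t.
Proof. apply ex_derive_cont. now auto_derive. Qed.

Lemma ex_RInt_gauss (a b : R) : ex_RInt (fun t => exp (- (t * t / 2))) a b.
Proof.
  apply ex_RInt_cont. intros; apply continuous_gauss_density.
Qed.

Lemma is_derive_gauss (x : R) : is_derive gauss x (exp (- (x * x / 2))).
Proof.
  apply (is_derive_RInt (V := R_NormedModule) (fun t => exp (- (t * t / 2))) gauss 0).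
  - exists (mkposreal 1 Rlt_0_1). intros y _.
    apply (RInt_correct (V := R_CompleteNormedModule)), ex_RInt_gauss.
  - apply continuous_gauss_density.
Qed.

(** Half of the integral of [exp (- (t^2 + u^2) / 2)] over the part of the first quadrant outside
    the square of side [x], in polar coordinates; [s] is the tangent of the angle. *)
Definition gauss_tail (x : R) : R := RInt (fun s => exp (- (x * x * (1 + s * s) / 2)) / (1 + s * s)) 0 1.

Lemma is_derive_gauss_tail (x : R) :
  is_derive gauss_tail x (- (exp (- (x * x / 2)) * gauss x)).
Proof.
  assert (D : forall z v, is_derive (fun z => exp (- (z * z * (1 + v * v) / 2)) / (1 + v * v)) z
      (- (z * exp (- (z * z * (1 + v * v) / 2))))).
  { intros z v. auto_derive; [nra|]. unfold Rdiv. field. nra. }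
  replace (- (exp (- (x * x / 2)) * gauss x))
    with (RInt (fun t => Derive (fun u => exp (- (u * u * (1 + t * t) / 2)) / (1 + t * t)) x) 0 1).
  - apply is_derive_RInt_param.
    + exists (mkposreal 1 Rlt_0_1). intros y _ t _. eexists. apply D.
    + intros t _. apply (continuity_2d_pt_ext (fun u v => - (u * exp (- (u * u * (1 + v * v) / 2))))).
      { intros u v. symmetry. apply is_derive_unique, D. }
      apply continuity_2d_pt_opp, continuity_2d_pt_mult; [apply continuity_2d_pt_id1|].
      apply (continuity_1d_2d_pt_comp exp (fun u v => - (u * u * (1 + v * v) / 2))).
      * apply derivable_continuous_pt, derivable_pt_exp.
      * apply continuity_2d_pt_opp, continuity_2d_pt_mult; [|apply continuity_2d_pt_const].
        apply continuity_2d_pt_mult.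
        -- apply continuity_2d_pt_mult; apply continuity_2d_pt_id1.
        -- apply continuity_2d_pt_plus; [apply continuity_2d_pt_const|].
           apply continuity_2d_pt_mult; apply continuity_2d_pt_id2.
    + exists (mkposreal 1 Rlt_0_1). intros y _.
      apply ex_RInt_cont. intros s _.
      apply ex_derive_cont. auto_derive. nra.
  - rewrite (RInt_ext _ (fun s => scal (- exp (- (x * x / 2))) (x * exp (- ((x * s + 0) * (x * s + 0) / 2))))).
    + rewrite (RInt_scal (V := R_CompleteNormedModule)).
      * assert (RC : RInt (fun s => x * exp (- ((x * s + 0) * (x * s + 0) / 2))) 0 1 = gauss x).
        { assert (R0 := RInt_comp_lin (V := R_CompleteNormedModule) (fun t => exp (- (t * t / 2))) x 0 0 1
            (ex_RInt_gauss _ _)).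
          replace (x * 0 + 0) with 0 in R0 by ring. replace (x * 1 + 0) with x in R0 by ring. exact R0. }
        rewrite RC. unfold scal; simpl. unfold mult; simpl. ring.
      * apply (ex_RInt_comp_lin (V := R_NormedModule) (fun t => exp (- (t * t / 2))) x 0 0 1).
        apply ex_RInt_gauss.
    + intros s _. etransitivity; [exact (is_derive_unique _ _ _ (D x s))|]. unfold scal; simpl. unfold mult; simpl.
      replace (- (x * x * (1 + s * s) / 2)) with (- (x * x / 2) + - ((x * s + 0) * (x * s + 0) / 2)) by field.
      rewrite exp_plus. ring.
Qed.

(** The sum is constant in [x], and equals [2 * atan 1] at [x = 0]. *)
Lemma gauss_sqr (x : R) : gauss x * gauss x + 2 * gauss_tail x = PI / 2.
Proof.
  assert (D : forall t, is_derive (fun t => gauss t * gauss t + 2 * gauss_tail t) t 0).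
  { intro t. assert (Dg := is_derive_gauss t).
    assert (D1 := is_derive_mult _ _ _ _ _ Dg Dg Rmult_comm).
    assert (D2 := is_derive_scal _ _ 2 _ (is_derive_gauss_tail t)).
    assert (D3 := is_derive_plus _ _ _ _ _ D1 D2).
    match type of D3 with is_derive _ _ ?l => replace 0 with l; [exact D3|] end.
    unfold plus, mult; simpl. ring. }
  assert (E0 : gauss 0 * gauss 0 + 2 * gauss_tail 0 = PI / 2).
  { unfold gauss. rewrite RInt_point. unfold zero; simpl.
    assert (E : gauss_tail 0 = PI / 4).
    { unfold gauss_tail. rewrite <- atan_1.
      rewrite (RInt_ext _ (fun s => / (1 + s * s))).
      - apply is_RInt_unique. replace (atan 1) with (minus (atan 1) (atan 0)).
        + apply (is_RInt_derive (V := R_CompleteNormedModule) atan).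
          * intros t _. auto_derive; [easy|]. field. nra.
          * intros t _. apply ex_derive_cont. auto_derive. nra.
        + rewrite atan_0. unfold minus, plus, opp; simpl. ring.
      - intros s _. replace (- (0 * 0 * (1 + s * s) / 2)) with 0 by field. rewrite exp_0.
        unfold Rdiv. apply Rmult_1_l. }
    rewrite E. field. }
  rewrite <- E0.
  destruct (mean_value (fun t => gauss t * gauss t + 2 * gauss_tail t) (fun _ => 0) 0 x) as [c [_ E]].
  { intros t _. apply D. }
  lra.
Qed.

Lemma gauss_tail_bounds (x : R) : 0 <= gauss_tail x <= exp (- (x * x / 2)).
Proof.
  assert (Ex : ex_RInt (fun s => exp (- (x * x * (1 + s * s) / 2)) / (1 + s * s)) 0 1).
  { apply ex_RInt_cont. intros s _.
    apply ex_derive_cont. auto_derive. nra. }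
  split.
  - apply RInt_ge_0; [lra | exact Ex|]. intros s _.
    apply Rmult_le_pos; [left; apply exp_pos | left; apply Rinv_0_lt_compat; nra].
  - replace (exp (- (x * x / 2))) with (RInt (fun _ => exp (- (x * x / 2))) 0 1).
    2: { rewrite RInt_const. unfold scal; simpl. unfold mult; simpl. ring. }
    apply RInt_le; [lra | exact Ex | apply ex_RInt_const|]. intros s _.
    assert (E := exp_pos (- (x * x / 2))).
    assert (Le : exp (- (x * x * (1 + s * s) / 2)) <= exp (- (x * x / 2))).
    { apply exp_le. assert (0 <= (x * s) * (x * s)) by apply Rle_0_sqr. nra. }
    apply Rmult_le_reg_r with (1 + s * s); [nra|]. unfold Rdiv at 1.
    rewrite Rmult_assoc, Rinv_l by nra. nra.
Qed.

Lemma gauss_pos (x : R) : 0 < x -> 0 < gauss x.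
Proof.
  intro Hx. apply RInt_gt_0; [exact Hx | intros; apply exp_pos | intros; apply continuous_gauss_density].
Qed.

Lemma gauss_limit : is_lim gauss p_infty (Finite (sqrt (PI / 2))).
Proof.
  assert (H : is_lim (fun x => PI / 2 - 2 * gauss_tail x) p_infty (PI / 2 - 2 * 0)).
  { apply is_lim_minus'; [apply is_lim_const|].
    apply (is_lim_scal_l gauss_tail 2 p_infty 0).
    apply (is_lim_le_le_loc (fun _ => 0) (fun x => exp (- x))).
    - exists 2. intros x Hx. destruct (gauss_tail_bounds x) as [H1 H2]. split; [exact H1|].
      eapply Rle_trans; [exact H2|]. apply exp_le. nra.
    - apply is_lim_const.
    - apply (is_lim_comp exp Ropp p_infty 0 m_infty).
      + apply is_lim_exp_m.
      + apply (is_lim_opp (fun x => x) p_infty p_infty). apply is_lim_id.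
      + exists 0. easy. }
  replace (PI / 2 - 2 * 0) with (PI / 2) in H by ring.
  apply (is_lim_ext_loc (fun x => sqrt (PI / 2 - 2 * gauss_tail x))).
  - exists 0. intros x Hx. rewrite <- (gauss_sqr x).
    replace (gauss x * gauss x + 2 * gauss_tail x - 2 * gauss_tail x) with (gauss x * gauss x) by ring.
    apply sqrt_square. left. now apply gauss_pos.
  - apply (is_lim_comp_continuous (fun x => PI / 2 - 2 * gauss_tail x) sqrt p_infty (PI / 2)); [exact H|].
    apply continuous_sqrt.
Qed.

(** * Asymptotics of the two bounds *)

Lemma RInt_rescale (h : R -> R) (A T : R) : 0 < A -> ex_RInt h 0 (sqrt A * T) ->
  RInt h 0 (sqrt A * T) = sqrt A * RInt (fun t => h (sqrt A * t)) 0 T.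
Proof.
  intros HA Hex.
  assert (E := RInt_comp_lin (V := R_CompleteNormedModule) h (sqrt A) 0 0 T).
  rewrite Rmult_0_r, !Rplus_0_r in E. rewrite <- E by exact Hex.
  assert (S := sqrt_lt_R0 A HA).
  assert (Ex : ex_RInt (fun t => h (sqrt A * t)) 0 T).
  { apply (ex_RInt_ext (fun t => scal (/ sqrt A) (scal (sqrt A) (h (sqrt A * t + 0))))).
    - intros t _. unfold scal; simpl. unfold mult; simpl. rewrite Rplus_0_r.
      rewrite <- Rmult_assoc, Rinv_l by lra. apply Rmult_1_l.
    - apply (ex_RInt_scal (V := R_NormedModule)).
      apply (ex_RInt_comp_lin (V := R_NormedModule) h (sqrt A) 0 0 T).
      now rewrite Rmult_0_r, !Rplus_0_r. }
  change (sqrt A * RInt (fun t => h (sqrt A * t)) 0 T) with (scal (sqrt A) (RInt (fun t => h (sqrt A * t)) 0 T)).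
  rewrite <- (RInt_scal (V := R_CompleteNormedModule)) by exact Ex.
  apply RInt_ext. intros t _. now rewrite Rplus_0_r.
Qed.

(** Substitute [y = sqrt A' t]; then [sqrt (A'^2 + y^2) <= A' + t^2 / 2]. *)
Lemma L_lower_gauss_gt (A A' T : R) : 0 < A -> A < A' -> 0 < T ->
  2 * A' / PI * (sqrt A' * (exp (- A') / (A' * A' + A' * (T * T)) * gauss T)) / (1 + 1 / (A' + 1)) <= L A.
Proof.
  intros HA HA' HT. assert (P := PI_RGT_0). assert (HA0 : 0 < A') by lra.
  assert (S := sqrt_lt_R0 A' HA0). assert (S2 := sqrt_sqrt A' (Rlt_le _ _ HA0)).
  eapply Rle_trans; [|apply (L_lower_integral A A' (sqrt A' * T)); trivial; nra].
  assert (Q : 0 < 1 + 1 / (A' + 1)) by (assert (0 < 1 / (A' + 1)) by (apply Rdiv_lt_0_compat; lra); lra).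
  apply Rmult_le_compat_r; [left; now apply Rinv_0_lt_compat|].
  apply Rmult_le_compat_l; [apply Rmult_le_pos; [lra | left; now apply Rinv_0_lt_compat]|].
  assert (Ex : forall a b, ex_RInt (fun y => exp (- node A' y) / (A' * A' + y * y)) a b).
  { intros. apply ex_RInt_cont. intros; now apply continuous_exp_node. }
  rewrite RInt_rescale by (trivial; apply Ex).
  apply Rmult_le_compat_l; [lra|].
  unfold gauss.
  change (exp (- A') / (A' * A' + A' * (T * T)) * RInt (fun t => exp (- (t * t / 2))) 0 T)
    with (scal (exp (- A') / (A' * A' + A' * (T * T))) (RInt (fun t => exp (- (t * t / 2))) 0 T)).
  rewrite <- (RInt_scal (V := R_CompleteNormedModule)) by apply ex_RInt_gauss.
  apply RInt_le; [lra | apply (ex_RInt_scal (V := R_NormedModule)), ex_RInt_gauss | |].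
  - apply ex_RInt_cont. intros t _.
    apply (continuous_comp (fun t => sqrt A' * t) (fun y => exp (- node A' y) / (A' * A' + y * y))).
    + apply ex_derive_cont. now auto_derive.
    + now apply continuous_exp_node.
  - intros t Ht. unfold scal; simpl. unfold mult; simpl.
    replace (sqrt A' * t * (sqrt A' * t)) with (A' * (t * t)) by (rewrite <- S2 at 1; ring).
    assert (Htt : 0 <= t * t) by apply Rle_0_sqr.
    assert (HtT : t * t <= T * T) by (apply Rmult_le_compat; lra).
    assert (N : node A' (sqrt A' * t) <= A' + t * t / 2).
    { apply Rsqr_incr_0_var; [|nra]. unfold Rsqr. rewrite node_sq.
      replace (sqrt A' * t * (sqrt A' * t)) with (A' * (t * t)) by (rewrite <- S2 at 1; ring). nra. }
    assert (Ee : exp (- A') * exp (- (t * t / 2)) <= exp (- node A' (sqrt A' * t))).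
    { rewrite <- exp_plus. apply exp_le. lra. }
    apply Rle_trans with (exp (- A') * exp (- (t * t / 2)) * / (A' * A' + A' * (T * T))).
    + right. unfold Rdiv. ring.
    + apply Rmult_le_compat; trivial.
      * apply Rmult_le_pos; left; apply exp_pos.
      * left. apply Rinv_0_lt_compat. nra.
      * apply Rinv_le_contravar; nra.
Qed.

(** The bound of [L_lower_gauss_gt] is continuous in [A'], so [A'] may decrease to [A]. *)
Lemma L_lower_gauss (A T : R) : 0 < A -> 0 < T ->
  2 / PI * gauss T / ((1 + T * T / A) * (1 + 1 / (A + 1))) <= sqrt A * exp A * L A.
Proof.
  intros HA HT. assert (P := PI_RGT_0). assert (S := sqrt_lt_R0 A HA).
  assert (S2 := sqrt_sqrt A (Rlt_le _ _ HA)).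
  set (F := fun x => 2 * x / PI * (sqrt x * (exp (- x) / (x * x + x * (T * T)) * gauss T)) / (1 + 1 / (x + 1))).
  assert (HF : F A <= L A).
  { destruct (Rle_lt_dec (F A) (L A)) as [|Hlt]; [assumption|exfalso].
    assert (Hc : continuous F A).
    { apply ex_derive_cont. unfold F. auto_derive.
      assert (0 < 1 / (A + 1)) by (apply Rdiv_lt_0_compat; lra).
      repeat split; try lra; try nra. }
    assert (He : 0 < F A - L A) by lra.
    destruct (proj1 (filterlim_locally F (F A)) Hc (mkposreal _ He)) as [d Hd].
    assert (Hd0 := cond_pos d).
    specialize (Hd (A + d / 2)). simpl in Hd.
    assert (B : ball A d (A + d / 2)).
    { change (Rabs (A + d / 2 - A) < d). rewrite Rabs_pos_eq; lra. }
    specialize (Hd B). change (Rabs (F (A + d / 2) - F A) < F A - L A) in Hd.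
    apply Rabs_lt_between in Hd.
    assert (K := L_lower_gauss_gt A (A + d / 2) T HA ltac:(lra) HT). unfold F in *. lra. }
  assert (E : exp A * exp (- A) = 1) by (rewrite <- exp_plus, Rplus_opp_r; apply exp_0).
  assert (Ep := exp_pos A).
  apply Rle_trans with (sqrt A * exp A * F A); [|apply Rmult_le_compat_l; nra].
  right. unfold F.
  replace (sqrt A * exp A * (2 * A / PI * (sqrt A * (exp (- A) / (A * A + A * (T * T)) * gauss T)) / (1 + 1 / (A + 1))))
    with ((sqrt A * sqrt A) * (exp A * exp (- A)) * (2 * A / PI * (/ (A * A + A * (T * T)) * gauss T) / (1 + 1 / (A + 1))))
    by (unfold Rdiv; ring).
  rewrite S2, E. field. repeat split; nra.
Qed.

(** Keep the part [x <= sqrt A * T] of the integral and substitute [x = sqrt A * t]. *)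
Lemma L_upper_gauss (A T : R) : 0 < A -> 0 < T -> T * T <= A ->
  sqrt A * exp A * L A <= (1 + 1 / A) * exp (T * T * (T * T) / (2 * A)) / gauss T.
Proof.
  intros HA HT HTA. assert (S := sqrt_lt_R0 A HA).
  assert (S2 := sqrt_sqrt A (Rlt_le _ _ HA)).
  assert (HsT : sqrt A * T <= A).
  { apply Rsqr_incr_0_var; [unfold Rsqr|lra].
    replace (sqrt A * T * (sqrt A * T)) with (A * (T * T)) by (rewrite <- S2 at 1; ring). nra. }
  set (J := RInt (fun x => exp (sqrt (A * A - x * x))) 0 A).
  assert (G := gauss_pos T HT).
  assert (Ex : forall a b, ex_RInt (fun x => exp (sqrt (A * A - x * x))) a b).
  { intros. apply ex_RInt_cont. intros; apply continuous_exp_sqrt. }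
  set (k := exp (A - T * T * (T * T) / (2 * A))).
  assert (Hk : 0 < k) by apply exp_pos.
  assert (HJ : sqrt A * (k * gauss T) <= J).
  { unfold J. rewrite <- (RInt_Chasles (V := R_CompleteNormedModule) _ 0 (sqrt A * T) A (Ex _ _) (Ex _ _)).
    unfold plus; simpl.
    assert (0 <= RInt (fun x => exp (sqrt (A * A - x * x))) (sqrt A * T) A).
    { apply RInt_ge_0; [exact HsT | apply Ex|]. intros; left; apply exp_pos. }
    rewrite RInt_rescale by (trivial; apply Ex).
    enough (k * gauss T <= RInt (fun t => exp (sqrt (A * A - sqrt A * t * (sqrt A * t)))) 0 T) by nra.
    unfold gauss.
    change (k * RInt (fun t => exp (- (t * t / 2))) 0 T) with (scal k (RInt (fun t => exp (- (t * t / 2))) 0 T)).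
    rewrite <- (RInt_scal (V := R_CompleteNormedModule)) by apply ex_RInt_gauss.
    apply RInt_le; [lra | apply (ex_RInt_scal (V := R_NormedModule)), ex_RInt_gauss | |].
    - apply ex_RInt_cont. intros t _.
      apply (continuous_comp (fun t => sqrt A * t) (fun x => exp (sqrt (A * A - x * x)))).
      + apply ex_derive_cont. now auto_derive.
      + apply continuous_exp_sqrt.
    - intros t Ht. unfold scal; simpl. unfold mult; simpl. unfold k. rewrite <- exp_plus. apply exp_le.
      replace (sqrt A * t * (sqrt A * t)) with (A * (t * t)) by (rewrite <- S2 at 1; ring).
      (* sqrt (1 - u) >= 1 - u/2 - u^2/2 with u = t^2/A in [0,1] *)
      set (u := t * t / A).
      assert (Eu : t * t = A * u) by (unfold u; field; lra).
      assert (Htt : t * t <= T * T) by nra.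
      assert (Hu0 : 0 <= u) by (apply Rmult_le_pos; [nra | left; now apply Rinv_0_lt_compat]).
      assert (Hu1 : u <= 1) by nra.
      apply Rle_trans with (A * ((1 - u) * (1 + u / 2))).
      + replace (A * ((1 - u) * (1 + u / 2))) with (A - t * t / 2 - t * t * (t * t) / (2 * A))
          by (rewrite Eu; field; lra).
        assert (t * t * (t * t) / (2 * A) <= T * T * (T * T) / (2 * A)).
        { apply Rmult_le_compat_r; [left; apply Rinv_0_lt_compat; lra|]. apply Rmult_le_compat; nra. }
        lra.
      + rewrite Eu. apply Rsqr_incr_0_var; [|apply sqrt_pos].
        unfold Rsqr. rewrite sqrt_sqrt by nra.
        assert (C1 : (1 - u) * ((1 + u / 2) * (1 + u / 2)) <= 1).
        { assert (0 <= u * u * u) by (apply Rmult_le_pos; [apply Rle_0_sqr | exact Hu0]). nra. }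
        replace (A * ((1 - u) * (1 + u / 2)) * (A * ((1 - u) * (1 + u / 2))))
          with (A * A * ((1 - u) * ((1 - u) * ((1 + u / 2) * (1 + u / 2))))) by ring.
        replace (A * A - A * (A * u)) with (A * A * ((1 - u) * 1)) by ring.
        apply Rmult_le_compat_l; [nra|]. apply Rmult_le_compat_l; lra. }
  assert (U := L_upper A HA). fold J in U.
  assert (Pp : 0 < sqrt A * (k * gauss T)) by (repeat apply Rmult_lt_0_compat; assumption).
  assert (H1A : 0 < 1 / A) by (apply Rdiv_lt_0_compat; lra).
  assert (Ep := exp_pos A).
  apply Rle_trans with (sqrt A * exp A * ((1 + 1 / A) / (sqrt A * (k * gauss T)))).
  - apply Rmult_le_compat_l; [nra|]. eapply Rle_trans; [exact U|].
    apply Rmult_le_compat_l; [lra|]. apply Rinv_le_contravar; assumption.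
  - right. assert (Ek : exp A = k * exp (T * T * (T * T) / (2 * A))).
    { unfold k. rewrite <- exp_plus. f_equal. ring. }
    rewrite Ek. field. repeat split; lra.
Qed.

Lemma is_lim_sqrt_comp (f : R -> R) :
  is_lim f p_infty p_infty -> is_lim (fun x => sqrt (f x)) p_infty p_infty.
Proof.
  intro H. unfold is_lim. simpl.
  apply (filterlim_comp _ _ _ f sqrt _ (Rbar_locally p_infty)); [exact H|]. exact filterlim_sqrt_p.
Qed.

Theorem theorem2 :
  is_lim (fun A : R => sqrt A * exp A * L A) p_infty (Finite (sqrt (2 / PI))).
Proof.
  assert (P := PI_RGT_0).
  set (c := sqrt (PI / 2)).
  assert (Hc : 0 < c) by (apply sqrt_lt_R0; lra).
  assert (Hc2 : c * c = PI / 2) by (apply sqrt_sqrt; lra).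
  assert (Ec : sqrt (2 / PI) = / c).
  { unfold c. rewrite <- sqrt_inv. f_equal. field. lra. }
  (* any T with T -> oo and T^4 = o(A) would do *)
  set (T := fun A => sqrt (sqrt (sqrt A))). set (s := fun A => / sqrt A).
  assert (Lsq := is_lim_sqrt_comp _ (is_lim_id p_infty)).
  assert (LT : is_lim T p_infty p_infty) by now do 2 apply is_lim_sqrt_comp.
  assert (Lg : is_lim (fun A => gauss (T A)) p_infty c).
  { apply (is_lim_comp gauss T p_infty c p_infty); [exact gauss_limit | exact LT | exists 0; easy]. }
  assert (Ls : is_lim s p_infty 0).
  { apply (is_lim_inv (fun A => sqrt A) p_infty p_infty); easy. }
  assert (Ls1 : is_lim (fun A => 1 + s A) p_infty 1).
  { replace (Finite 1) with (Finite (1 + 0)) by (f_equal; ring).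
    apply is_lim_plus'; [apply is_lim_const | exact Ls]. }
  assert (Lex : is_lim (fun A => exp (/ 2 * s A)) p_infty 1).
  { replace (Finite 1) with (Finite (exp (/ 2 * 0))) by (f_equal; rewrite Rmult_0_r; apply exp_0).
    apply (is_lim_comp_continuous (fun A => / 2 * s A) exp p_infty (/ 2 * 0)).
    - apply (is_lim_scal_l s (/ 2) p_infty 0 Ls).
    - apply continuous_exp. }
  assert (Mult : forall f g (a b : R), is_lim f p_infty a -> is_lim g p_infty b ->
    is_lim (fun x => f x * g x) p_infty (a * b)).
  { intros f g a b Hf Hg. apply (is_lim_mult f g p_infty a b Hf Hg). exact I. }
  assert (Inv : forall f (a : R), is_lim f p_infty a -> a <> 0 -> is_lim (fun x => / f x) p_infty (/ a)).
  { intros f a Hf Ha. apply (is_lim_inv f p_infty a Hf). intro E. apply Ha. now injection E. }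
  apply (is_lim_le_le_loc
    (fun A => 2 / PI * gauss (T A) * / ((1 + s A) * (1 + s A)))
    (fun A => (1 + s A) * exp (/ 2 * s A) * / gauss (T A))).
  - exists 1. intros A HA.
    assert (Hs : 1 < sqrt A) by (rewrite <- sqrt_1 at 1; apply sqrt_lt_1; lra).
    assert (Hss : 1 < sqrt (sqrt A)) by (rewrite <- sqrt_1 at 1; apply sqrt_lt_1; lra).
    assert (HT : 1 < T A) by (unfold T; rewrite <- sqrt_1 at 1; apply sqrt_lt_1; lra).
    assert (S1 : sqrt A * sqrt A = A) by (apply sqrt_sqrt; lra).
    assert (S2 : sqrt (sqrt A) * sqrt (sqrt A) = sqrt A) by (apply sqrt_sqrt; lra).
    assert (S3 : T A * T A = sqrt (sqrt A)) by (apply sqrt_sqrt; lra).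
    assert (G := gauss_pos (T A) ltac:(lra)).
    assert (Hs0 : 0 < s A) by (apply Rinv_0_lt_compat; lra).
    assert (B0 : 1 / A <= s A).
    { unfold s. replace (1 / A) with (/ A) by (unfold Rdiv; ring). apply Rinv_le_contravar; nra. }
    split.
    + eapply Rle_trans; [|apply (L_lower_gauss A (T A)); lra].
      unfold Rdiv at 2. apply Rmult_le_compat_l.
      * apply Rmult_le_pos; [|lra]. apply Rmult_le_pos; [lra | left; now apply Rinv_0_lt_compat].
      * assert (B1 : T A * T A / A <= s A).
        { rewrite S3. unfold s. apply Rmult_le_reg_r with A; [lra|]. unfold Rdiv.
          rewrite Rmult_assoc, Rinv_l, Rmult_1_r by lra. 
          assert (SA : / sqrt A * A = sqrt A).
          { apply Rmult_eq_reg_l with (sqrt A); [|lra]. rewrite <- Rmult_assoc, Rinv_r; lra. }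
          rewrite SA. nra. }
        assert (B2 : 1 / (A + 1) <= s A).
        { eapply Rle_trans; [|exact B0]. unfold Rdiv. apply Rmult_le_compat_l; [lra|].
          apply Rinv_le_contravar; lra. }
        assert (0 < 1 / (A + 1)) by (apply Rdiv_lt_0_compat; lra).
        assert (0 < T A * T A / A) by (apply Rdiv_lt_0_compat; nra).
        apply Rinv_le_contravar; [apply Rmult_lt_0_compat; lra | apply Rmult_le_compat; lra].
    + eapply Rle_trans; [apply (L_upper_gauss A (T A)); nra|].
      replace (T A * T A * (T A * T A) / (2 * A)) with (/ 2 * s A).
      * apply Rmult_le_compat_r; [left; now apply Rinv_0_lt_compat|].
        apply Rmult_le_compat_r; [left; apply exp_pos | lra].
      * rewrite S3, S2. unfold s. apply Rmult_eq_reg_r with (2 * A); [|lra].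
        replace (sqrt A / (2 * A) * (2 * A)) with (sqrt A) by (field; lra).
        rewrite <- S1 at 2. field. lra.
  - replace (Finite (sqrt (2 / PI))) with (Finite (2 / PI * c * / (1 * 1))).
    + apply Mult; [apply Mult; [apply is_lim_const | exact Lg]|].
      apply Inv; [now apply Mult | lra].
    + f_equal. rewrite Ec. apply Rmult_eq_reg_r with c; [|lra]. rewrite Rinv_l by lra.
      replace (2 / PI * c * / (1 * 1) * c) with (2 / PI * (c * c)) by (field; lra). rewrite Hc2. field. lra.
  - rewrite Ec. replace (Finite (/ c)) with (Finite (1 * 1 * / c)) by (f_equal; ring).
    apply Mult; [now apply Mult | apply Inv; [exact Lg | lra]].
Qed.
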